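(* Let $L$ be an honest time satisfying condition $(\mathbf{A})$: $\mathbb{P}[L=T]=0$ for every $(\mathcal{F}_t)$-stopping time $T$. Write $A=A^L$. Let $M$ be an $L^2$-bounded $(\mathcal{F}_t)$-martingale. Then the following are equivalent: (1) $M\in\mathcal{S}_1$, i.e. $\mathbb{E}[M_L]=\mathbb{E}[M_\infty]$; (2) $M_\infty$ may be represented as $M_\infty=X+\varphi(A_\infty)$, where $X\in\left(L^2(\sigma(A_\infty))\right)^{\perp}$ and $\varphi(A_\infty)\in L^2(\sigma(A_\infty))$ admits the representation $$\varphi(A_\infty)=\alpha_0+\sum_{n=2}^{\infty}\alpha_n\mathcal{L}_n(A_\infty),$$ with $\alpha_0\in\mathbb{R}$ and $(\alpha_n)$ such that $\sum\alpha_n^2<\infty$; i.e. in the expansion of $\varphi$ in the Laguerre basis, the coefficient of $\mathcal{L}_1$ is $\alpha_1=0$.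
   Context: $(\Omega,\mathcal{F},(\mathcal{F}_t)_{t\ge0},\mathbb{P})$ is a filtered probability space satisfying the usual hypotheses; martingales are taken càdlàg. An honest time is a random time $L:\Omega\to\mathbb{R}_+$ which is the end of an $(\mathcal{F}_t)$-optional set $\Gamma$, $L=\sup\{t:(t,\omega)\in\Gamma\}$; it is assumed that $\mathbb{P}[L=0]=\mathbb{P}[L=\infty]=0$. $A^L$ is the $(\mathcal{F}_t)$ dual optional projection of $1_{\{L\le t\}}$, i.e. the increasing right-continuous adapted process with $\mathbb{E}[\int_0^\infty H_s\,dA^L_s]=\mathbb{E}[H_L]$ for every bounded optional process $H$. $\mathcal{H}^1$ is the space of càdlàg martingales with $\mathbb{E}[\sup_t|M_t|]<\infty$, and $\mathcal{S}_1=\{M\in\mathcal{H}^1:\mathbb{E}[M_L]=\mathbb{E}[M_\infty]\}$. $\mathcal{L}_n(x)=\frac{1}{n!}e^{x}\frac{d^n}{dx^n}\left(x^ne^{-x}\right)$ are the Laguerre polynomials, an orthonormal basis of $L^2(\mathbb{R}_+,e^{-x}dx)$ (so $\mathcal{L}_0=1$, $\mathcal{L}_1(x)=1-x$). The orthogonal complement is taken in $L^2(\Omega,\mathcal{F},\mathbb{P})$; the series converges in $L^2$. *)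

(* Defs.v *)
From HB Require Import structures.
From mathcomp Require Import all_boot all_order all_algebra.
From mathcomp Require Import all_classical all_reals all_analysis.
From mathcomp Require Import measurable_realfun.

Set Implicit Arguments.
Unset Strict Implicit.
Unset Printing Implicit Defensive.
Import Order.TTheory GRing.Theory Num.Theory.
Import numFieldNormedType.Exports.

Local Open Scope classical_set_scope.
Local Open Scope ring_scope.

(* The time set is [0, +oo[: a process is a function [X : R -> T -> R] and a
   filtration a function [F : R -> set (set T)], of which only the values at
   times [t >= 0] are relevant, unless stated otherwise. *)

Section processes.
Context (R : realType) (d : measure_display) (T : measurableType d).
Implicit Types (P : probability T R) (F : R -> set (set T)) (G : set (set T)).
Implicit Types (X M H : R -> T -> R) (L tau : T -> \bar R).

Definition measurable_wrt G (f : T -> R) : Prop :=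
  forall B : set R, measurable B -> G (f @^-1` B).

Record usual_filtration P F : Prop := {
  filtration_sigma_algebra :
    forall t, 0 <= t -> sigma_algebra [set: T] (F t) ;
  filtration_sub : forall t, 0 <= t -> F t `<=` measurable ;
  filtration_nondecreasing :
    forall s t, 0 <= s -> s <= t -> F s `<=` F t ;
  filtration_right_continuous :
    forall t, 0 <= t -> \bigcap_(s in [set s | t < s]) F s `<=` F t ;
  (* [negligible] means contained in a null event, so that this also makes
     the probability space complete. *)
  filtration_complete : P.-negligible `<=` F 0 }.

Definition adapted F X : Prop :=
  forall t, 0 <= t -> measurable_wrt (F t) (X t).

Definition cadlag X : Prop := forall w,
  (forall t, 0 <= t -> X s w @[s --> t^'+] --> X t w) /\
  (forall t, 0 < t -> cvg (X s w @[s --> t^'-])).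

Definition timeline_prod : set (R * T) := [set z | 0 <= z.1].

Definition optional_sigma_algebra F : set (set (R * T)) :=
  <<s timeline_prod,
    [set timeline_prod `&` [set z | B (X z.1 z.2)] |
      X in [set X | adapted F X /\ cadlag X] &
      B in [set B : set R | measurable B]] >>.

Definition optional_process F H : Prop :=
  forall B : set R, measurable B ->
    optional_sigma_algebra F (timeline_prod `&` [set z | B (H z.1 z.2)]).

Definition stopping_time F tau : Prop :=
  (forall w, 0 <= tau w)%E /\
  (forall t, 0 <= t -> F t [set w | tau w <= t%:E]%E).

(* The supremum of the empty set of times is [0]. *)
Definition honest_time F L : Prop :=
  measurable_fun [set: T] L /\
  exists2 Gamma : set (R * T), optional_sigma_algebra F Gamma &
    forall w, L w =
      ereal_sup (0%E |` [set t%:E | t in [set t | Gamma (t, w)]]).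

Definition avoids_stopping_times P F L : Prop :=
  forall tau, stopping_time F tau -> P [set w | L w = tau w] = 0%E.

(* The value [X_L] of [X] at the random time [L], with [X_oo := Y]. *)
Definition value_at X (Y : T -> R) L (w : T) : R :=
  if L w is t%:E then X t w else Y w.

(* [lim] is total: the value is meaningless at the [w] for which the path
   does not converge. *)
Definition terminal_value X (w : T) : R := lim (X t w @[t --> +oo%R]).

Definition is_cond_expectation P G (X Y : T -> R) : Prop :=
  [/\ measurable_wrt G Y,
      P.-integrable setT (EFin \o Y) &
      forall B, G B -> (\int[P]_(w in B) (Y w)%:E = \int[P]_(w in B) (X w)%:E)%E].

Definition martingale P F M : Prop :=
  [/\ adapted F M,
      cadlag M,
      forall t, 0 <= t -> P.-integrable setT (EFin \o M t) &
      forall s t, 0 <= s -> s <= t -> is_cond_expectation P (F s) (M t) (M s)].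

Definition L2_bounded P M : Prop :=
  exists C : R, forall t, 0 <= t -> ('E_P[fun w => (M t w ^+ 2)%R] <= C%:E)%E.

Definition H1_martingale P F M : Prop :=
  martingale P F M /\
  (\int[P]_w ereal_sup [set `|M t w|%:E | t in [set t : R | (0 <= t)%R]] < +oo)%E.

Definition S1_martingale P F L M : Prop :=
  H1_martingale P F M /\
  ('E_P[value_at M (terminal_value M) L] = 'E_P[terminal_value M])%E.

(* The paths [A w : cumulative R R] are nondecreasing and right-continuous on
   the whole real line. The requirement [A w t = 0] for [t < 0] is the usual
   convention [A_{0-} = 0]: the integral over [0, +oo[ charges [0] with mass
   [A_0]. *)
Definition dual_optional_projection P F L (A : T -> cumulative R R) : Prop :=
  [/\ adapted F (fun t w => A w t),
      forall w t, t < 0 -> A w t = 0 &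
      forall H, optional_process F H ->
        (exists C : R, forall t w, 0 <= t -> `|H t w| <= C) ->
        (\int[P]_w \int[lebesgue_stieltjes_measure (A w)]_(s in `[0%R, +oo[)
            (H s w)%:E
         = 'E_P[value_at H (cst 0%R) L])%E].

Definition L2 P G : set (T -> R) :=
  [set f | f \in Lfun P 2%:E /\ measurable_wrt G f].

Definition orthogonal_complement P (E : set (T -> R)) : set (T -> R) :=
  [set X | L2 P measurable X /\
    forall Y, E Y -> ('E_P[fun w => (X w * Y w)%R] = 0)%E].

End processes.

Definition laguerre (R : realType) (n : nat) (x : R) : R :=
  (n`!%:R)^-1 * expR x * derive1n n (fun y : R => y ^+ n * expR (- y)) x.

(* Main.v *)
Require Import Defs.
From HB Require Import structures.
From mathcomp Require Import all_boot all_order all_algebra.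
From mathcomp Require Import all_classical all_reals all_analysis.
From mathcomp Require Import measurable_realfun.
From mathcomp Require Import ring lra.
Set Implicit Arguments.
Unset Strict Implicit.
Unset Printing Implicit Defensive.
Import Order.TTheory GRing.Theory Num.Theory.
Import numFieldNormedType.Exports.
Local Open Scope classical_set_scope.
Local Open Scope ring_scope.

(** The theorem is a statement about two orthogonal expansions: the condition
    [E M_L = E M_oo] turns out to be the vanishing of one scalar product, and
    [A_oo] turns out to have the exponential distribution, for which the Laguerre
    polynomials form an orthonormal basis.

    The scalar product. By definition of the dual optional projection, [E M_L] is
    the mean of the integral of [M] against [dA]. Approximating this integral by
    Riemann sums with right endpoints and summing by parts, the martingale
    property removes all terms but the last one, so that
    [E M_L = E (M_oo A_oo)] ([Rintegral_at_L]; Doob's maximal inequality dominates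
    the limits). Hence [M] satisfies (1) if and only if
    [E (M_oo (1 - A_oo)) = 0], where [1 - x] is the Laguerre polynomial of degree 1
    ([S1_martingaleE]).

    The distribution of [A_oo]. As [L] is the end of an optional set [Gamma],
    on the event [L < q] the set [Gamma] has no point after [q]; testing the dual
    projection on the times between [q] and the next point of [Gamma], which do
    not contain [L], shows that [A] does not increase after [L]
    ([A_constant_after]). Since [L] avoids all stopping times, in particular those
    which exhaust the jumps of [A], the process [A] is continuous ([ae_no_jump]).
    Testing the dual projection on the set of times at which [A] exceeds [x] then
    gives [P (A_oo > x) = E (A_oo - x)^+] ([tail_A_oo]), and integrating against
    powers of [x] gives [E A_oo^n = n!] ([moment]). Both arguments need the debut
    of an optional set to be a stopping time, hence the measurable projection
    theorem, which is proved here by Choquet's capacitability argument.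

    The Laguerre basis. Only the moments [n!] are used. The Laguerre polynomials
    of [A_oo] are orthonormal by repeated integration by parts, which is an
    algebraic identity for the functional [X^n |-> n!] ([laguerre_orthonormal]).
    They are complete in [L^2 (sigma (A_oo))] because the exponential moments of
    [A_oo] allow to pass from the powers of [A_oo] to its exponentials and then to
    the indicators of half-lines ([moments_vanish_orthogonal]).

    Given (1), the function [phi] is the sum of the Laguerre series of [M_oo],
    which converges by the theorem of Riesz and Fischer and has no term of degree
    1, and [X] is the remainder ([laguerre_decomposition]). Conversely, in (2) both
    [X] and [phi (A_oo)] are orthogonal to [1 - A_oo] ([laguerre1_orthogonal]). *)

(** * Outer probability relative to a sub-sigma-algebra *)

Section outer_envelope.
Context (R : realType) (d : measure_display) (T : measurableType d).
Variables (P : probability T R) (G : set (set T)).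
Hypotheses (sG : sigma_algebra [set: T] G) (Gsub : G `<=` measurable).

Lemma sub_sigma_measurableE : G.-sigma.-measurable = G.
Proof. exact: measurable_g_measurableTypeE. Qed.

Lemma sigma_bigcup (E : (set T)^nat) : (forall n, G (E n)) -> G (\bigcup_n E n).
Proof. by rewrite -sub_sigma_measurableE; exact: bigcupT_measurable. Qed.

Lemma sigma_bigcap (E : (set T)^nat) : (forall n, G (E n)) -> G (\bigcap_n E n).
Proof. by rewrite -sub_sigma_measurableE; exact: bigcapT_measurable. Qed.

Lemma envelope_ex (E : set T) : exists2 B, G B /\ E `<=` B &
  forall C, G C -> E `<=` C -> (P B <= P C)%E.
Proof.
pose S := [set P C | C in [set C | G C /\ E `<=` C]].
have GT : G setT by rewrite -sub_sigma_measurableE; exact: measurableT.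
have Sfin : ereal_inf S \is a fin_num.
  rewrite ge0_fin_numE.
    apply: (@le_lt_trans _ _ (P setT)); last by rewrite probability_setT ltry.
    by apply: ereal_inf_lbound; exists setT.
  by apply: le_ereal_inf_tmp => _ [C [GC EC] <-].
have /choice [C HC] : forall n, exists C, [/\ G C, E `<=` C &
    (P C < ereal_inf S + (n.+1%:R^-1)%:E)%E].
  move=> n; have [//|_ [C [GC EC] <-] lt] := @lb_ereal_inf_adherent R S (n.+1%:R^-1) _ Sfin.
  by exists C.
exists (\bigcap_n C n).
  split; first by apply: sigma_bigcap => n; have [] := HC n.
  by move=> x Ex n _; have [_ + _] := HC n; apply.
move=> D GD ED.
apply: (@le_trans _ _ (ereal_inf S)); last by apply: ereal_inf_lbound; exists D.
apply/lee_addgt0Pr => e e0.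
have [n en] : exists n : nat, n.+1%:R^-1 <= e.
  by near \oo => n; exists n; apply/ltW; near: n; exact: near_infty_natSinv_lt (PosNum e0).
have [GC _ lt] := HC n.
apply: (@le_trans _ _ (P (C n))).
  apply: le_measure; rewrite ?inE//; last exact: bigcap_inf.
    apply: Gsub; apply: sigma_bigcap => m; by have [] := HC m.
  exact: Gsub.
by apply: (le_trans (ltW lt)); rewrite leeD2l// lee_fin.
Unshelve. all: by end_near. Qed.

(** A set in [G] of minimal probability around [E]. Having a set, and not only
    an infimum, makes the continuity of [outer] along increasing sequences a
    matter of set algebra. *)
Definition envelope (E : set T) : set T := projT1 (cid2 (envelope_ex E)).

Lemma envelopeP E : [/\ G (envelope E), E `<=` envelope E &
  forall C, G C -> E `<=` C -> (P (envelope E) <= P C)%E].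
Proof. by rewrite /envelope; case: cid2 => B [? ?] ?; split. Qed.

Definition outer (E : set T) : R := fine (P (envelope E)).

Lemma outerE E : (outer E)%:E = P (envelope E).
Proof. by rewrite fineK// fin_num_measure//; apply: Gsub; have [] := envelopeP E. Qed.

Lemma outer_le E C : G C -> E `<=` C -> ((outer E)%:E <= P C)%E.
Proof. by move=> GC EC; rewrite outerE; have [_ _] := envelopeP E; apply. Qed.

Lemma le_outer E F : E `<=` F -> outer E <= outer F.
Proof.
move=> EF; rewrite -lee_fin (outerE F); have [GF sF _] := envelopeP F.
exact: outer_le (subset_trans EF sF).
Qed.

(** Envelopes of an increasing sequence can be replaced by their tail
    intersections, which increase and have the same probabilities. *)
Lemma outer_bigcup (E : (set T)^nat) (e : R) :
  (forall n, E n `<=` E n.+1) -> 0 < e ->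
  exists n, outer (\bigcup_n E n) < outer (E n) + e.
Proof.
move=> Ei e0.
have Em m n : (m <= n)%N -> E m `<=` E n.
  by elim: n => [|n IH]; [rewrite leqn0 => /eqP ->|
    rewrite leq_eqVlt => /orP[/eqP->//|/IH] H; apply: subset_trans H _].
pose B n := \bigcap_(k in [set k | (n <= k)%N]) envelope (E k).
have GB n : G (B n).
  rewrite -sub_sigma_measurableE; apply: bigcap_measurableType => k _.
  by rewrite sub_sigma_measurableE; have [] := envelopeP (E k).
have EB n : E n `<=` B n.
  by move=> x Ex k /= nk; have [_ s _] := envelopeP (E k); apply: s; exact: Em Ex.
have Bi : nondecreasing_seq B.
  move=> m n mn; apply/subsetPset => x Bx k /= nk; apply: Bx => /=.
  exact: leq_trans nk.
have PB n : P (B n) = (outer (E n))%:E.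
  apply/eqP; rewrite eq_le outer_le// andbT outerE le_measure ?inE//.
  - exact: Gsub.
  - by apply: Gsub; have [] := envelopeP (E n).
  - by move=> x Bx; apply: Bx => /=.
have mB n : measurable (B n) by exact: Gsub.
have mUB : measurable (\bigcup_n B n) by exact: bigcupT_measurable.
have cv := nondecreasing_cvg_mu (mu := P) mB mUB Bi.
have UB : ((outer (\bigcup_n E n))%:E <= P (\bigcup_n B n))%E.
  apply: outer_le; first exact: sigma_bigcup.
  by move=> x [n _ Ex]; exists n => //; exact: EB.
have Pf : P (\bigcup_n B n) \is a fin_num by exact: fin_num_measure.
have : \forall n \near \oo, (P (\bigcup_n B n) - e%:E < P (B n))%E.
  have lt : (P (\bigcup_n B n) - e%:E < P (\bigcup_n B n))%E.
    by rewrite lteBlDr// lteDl// lte_fin.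
  exact: (cv _ (open_ereal_gt' lt)).
move=> [n _ /(_ n (leqnn _))] /= H; exists n.
rewrite -lte_fin EFinD -PB -lteBlDr//.
by apply: (le_lt_trans _ H); apply: leeD.
Unshelve. all: by end_near. Qed.

End outer_envelope.

(** * The measurable projection theorem *)

Section capacity.
Context (R : realType) (d : measure_display) (T : measurableType d).
Variables (P : probability T R) (G : set (set T)).
Hypotheses (sG : sigma_algebra [set: T] G) (Gsub : G `<=` measurable).

Definition box (r : R * R * set T) : set (R * T) :=
  [set z | r.1.1 <= z.1 <= r.1.2 /\ r.2 z.2].

(** Finite unions of products of a segment and a set of [G]: the class whose
    members have both measurable projections and compact sections. *)
Definition paving (K : set (R * T)) : Prop :=
  exists2 s : seq (R * R * set T), (forall r, r \in s -> G r.2) &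
    K = [set z | exists2 r, r \in s & box r z].

Lemma sigma_setI A B : G A -> G B -> G (A `&` B).
Proof. by rewrite -(sub_sigma_measurableE sG); exact: measurableI. Qed.

Lemma sigma_setU A B : G A -> G B -> G (A `|` B).
Proof. by rewrite -(sub_sigma_measurableE sG); exact: measurableU. Qed.

Lemma sigma_set0 : G set0. Proof. by case: sG. Qed.

Lemma sigma_setC A : G A -> G (~` A).
Proof. by rewrite -(sub_sigma_measurableE sG); exact: measurableC. Qed.

Lemma sigma_setT : G setT.
Proof. by rewrite -(sub_sigma_measurableE sG); exact: measurableT. Qed.

Lemma pavingU K1 K2 : paving K1 -> paving K2 -> paving (K1 `|` K2).
Proof.
move=> [s1 G1 ->] [s2 G2 ->]; exists (s1 ++ s2).
  by move=> r; rewrite mem_cat => /orP[/G1|/G2].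
apply/seteqP; split => z.
  by case=> -[r rs rz]; exists r => //; rewrite mem_cat rs ?orbT.
by case=> r; rewrite mem_cat => /orP[] rs rz; [left|right]; exists r.
Qed.

Lemma pavingI K1 K2 : paving K1 -> paving K2 -> paving (K1 `&` K2).
Proof.
move=> [s1 G1 ->] [s2 G2 ->].
pose f (r1 r2 : R * R * set T) : R * R * set T :=
  (Num.max r1.1.1 r2.1.1, Num.min r1.1.2 r2.1.2, r1.2 `&` r2.2).
exists [seq f r1 r2 | r1 <- s1, r2 <- s2].
  move=> r /allpairsP[[r1 r2]/= [r1s r2s ->]] /=.
  exact: sigma_setI (G1 _ r1s) (G2 _ r2s).
have fE r1 r2 z : box (f r1 r2) z <-> box r1 z /\ box r2 z.
  rewrite /box /f /= ge_max le_min; split.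
    by move=> [/andP[/andP[-> ->] /andP[-> ->]] [? ?]].
  by move=> [[/andP[-> ->] ?] [/andP[-> ->] ?]].
apply/seteqP; split => z.
  case=> -[r1 r1s z1] [r2 r2s z2]; exists (f r1 r2); last exact/fE.
  by apply/allpairsP; exists (r1, r2).
case=> r /allpairsP[[r1 r2]/= [r1s r2s ->]] /fE[z1 z2].
by split; [exists r1|exists r2].
Qed.

Lemma paving_box a b E : G E -> paving [set z | a <= z.1 <= b /\ E z.2].
Proof.
move=> GE; exists [:: (a, b, E)].
  by move=> r; rewrite inE => /eqP ->.
by apply/seteqP; split => z; [move=> zE; exists (a, b, E) => //; rewrite inE|
  case=> r; rewrite inE => /eqP ->].
Qed.

Lemma paving0 : paving set0.
Proof. by exists [::] => //; apply/seteqP; split => // z [r]. Qed.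

Definition proj (B : set (R * T)) : set T := [set w | exists t, B (t, w)].

Lemma paving_proj K : paving K -> G (proj K).
Proof.
move=> [s Gs ->]; elim: s Gs => [_|r s IH Gs].
  rewrite [X in G X](_ : _ = set0); first exact: sigma_set0.
  by apply/seteqP; split => // w [t [r]].
pose E0 : set T := if `[< r.1.1 <= r.1.2 >] then r.2 else set0.
rewrite [X in G X](_ : _ = E0 `|` proj [set z | exists2 r, r \in s & box r z]).
  apply: sigma_setU.
    rewrite /E0; case: asboolP => _; last exact: sigma_set0.
    by apply: Gs; rewrite mem_head.
  by apply: IH => r' r's; apply: Gs; rewrite inE r's orbT.
apply/seteqP; split => w.
  case=> t [r']; rewrite inE => /orP[/eqP -> [/= /andP[at_ tb] rw]|r's rz].
    by left; rewrite /E0 asboolT//; exact: le_trans tb.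
  by right; exists t; exists r'.
case; last by case=> t [r' r's rz]; exists t; exists r' => //; rewrite inE r's orbT.
rewrite /E0; case: asboolP => // ab rw; exists r.1.1; exists r; rewrite ?mem_head//.
by split => //=; rewrite lexx ab.
Qed.

(** Time sections of pavings are finite unions of segments, whence the
    compactness on which the projection theorem rests. *)
Lemma paving_section K w : paving K -> compact [set t | K (t, w)].
Proof.
move=> [s Gs ->]; elim: s {Gs} => [|r s IH].
  rewrite [X in compact X](_ : _ = set0); first exact: compact0.
  by apply/seteqP; split => // t [r].
rewrite [X in compact X](_ : _ = (if `[< r.2 w >] then `[r.1.1, r.1.2]%classic else set0)
    `|` [set t | exists2 r, r \in s & box r (t, w)]).
  apply: compactU => //; case: asboolP => _; last exact: compact0.
  exact: segment_compact.
apply/seteqP; split => t.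
  case=> r'; rewrite inE => /orP[/eqP -> [/= rt rw]|r's rz].
    by left; rewrite asboolT//= in_itv.
  by right; exists r'.
case; last by case=> r' r's rz; exists r' => //; rewrite inE r's orbT.
case: asboolP => // rw /=; rewrite in_itv/= => rt; exists r; rewrite ?mem_head//.
Qed.

(** Compactness of the time sections: the projection commutes with decreasing
    intersections of pavings. *)
Lemma proj_bigcap (K : (set (R * T))^nat) : (forall n, paving (K n)) ->
  (forall n, K n.+1 `<=` K n) -> proj (\bigcap_n K n) = \bigcap_n proj (K n).
Proof.
move=> pK Kd; apply/seteqP; split => w.
  by move=> [t Kt] n _; exists t; exact: Kt.
move=> Kw; have /choice [x Kx] : forall n, exists t, K n (t, w).
  by move=> n; have [t] := Kw n I; exists t.
have Kmn m n : (m <= n)%N -> K n `<=` K m.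
  elim: n => [|n IH]; first by rewrite leqn0 => /eqP ->.
  by rewrite leq_eqVlt => /orP[/eqP->//|/IH] H; apply: subset_trans H.
have cK n := @paving_section (K n) w (pK n).
have evK n : (x @ \oo) [set t | K n (t, w)].
  by exists n => // m /= nm; exact: Kmn (Kx m).
have [t [_ tcl]] := cK 0%N (x @ \oo) _ (evK 0%N).
exists t => n _.
have : closed [set t | K n (t, w)] by apply: compact_closed => //; exact: cK.
apply => /= U tU; have [s [Ks Us]] := tcl _ _ (evK n) tU.
by exists s.
Qed.

(** A set is represented when it is a union of decreasing intersections of
    pavings, indexed monotonically by sequences [s : nat -> nat] in such a way
    that each stage depends on finitely many entries of [s]. Monotonicity makes
    truncating the entries of [s] an exhaustion of the set, which is all that a
    capacity needs to approximate it from inside. *)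
Record represented (B : set (R * T)) (C : nat -> (nat -> nat) -> set (R * T)) :
    Prop := {
  rep_paving : forall n s, paving (C n s) ;
  rep_local : forall n s, exists N, forall s',
    (forall i, (i < N)%N -> s i = s' i) -> C n s = C n s' ;
  rep_decr : forall n s, C n.+1 s `<=` C n s ;
  rep_mono : forall n s s', (forall i, s i <= s' i)%N -> C n s `<=` C n s' ;
  rep_eq : B = \bigcup_s \bigcap_n C n s }.

Definition representable B := exists C, represented B C.

Lemma rep_decr_le B C : represented B C ->
  forall m n s, (m <= n)%N -> C n s `<=` C m s.
Proof.
move=> rC m n s; elim: n => [|n IH]; first by rewrite leqn0 => /eqP ->.
rewrite leq_eqVlt => /orP[/eqP->//|/IH] H.
by apply: subset_trans (rep_decr rC (n:=n) (s:=s)) H.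
Qed.

Lemma representable_paving K : paving K -> representable K.
Proof.
move=> pK; exists (fun _ _ => K); split => //.
  by move=> *; exists 0%N.
- by move=> _ _ z.
- by move=> _ _ _ _ z.
apply/seteqP; split => z; first by move=> Kz; exists (fun=> 0%N).
by move=> [_ _ /(_ 0%N)]; apply.
Qed.

(** The index of the intersection is a sequence that codes one index for each
    set; at stage [n] only the first [n] sets are constrained, so that stages
    remain pavings. *)
Lemma representable_bigcap (B : (set (R * T))^nat) :
  (forall j, representable (B j)) -> representable (\bigcap_j B j).
Proof.
move=> /choice[C rC].
pose sh (j : nat) (s : nat -> nat) (i : nat) := s (pickle (j, i)).
pose D n s := [set z | forall j, (j <= n)%N -> C j n (sh j s) z].
exists D; split.
- move=> n s.
  have H m : paving [set z | forall j, (j <= m)%N -> C j n (sh j s) z].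
    elim: m => [|m IH].
      rewrite [X in paving X](_ : _ = C 0%N n (sh 0%N s)).
        exact: rep_paving (rC 0%N) _ _.
      apply/seteqP; split => z; first exact.
      by move=> Cz j; rewrite leqn0 => /eqP ->.
    rewrite [X in paving X](_ : _ = [set z | forall j, (j <= m)%N -> C j n (sh j s) z]
      `&` C m.+1 n (sh m.+1 s)).
      by apply: pavingI => //; exact: rep_paving (rC _) _ _.
    apply/seteqP; split => z.
      by move=> Hz; split => [j jm|]; apply: Hz => //; exact: leqW.
    by move=> [H1 H2] j; rewrite leq_eqVlt => /orP[/eqP->//|]; exact: H1.
  exact: H.
- move=> n s.
  have /choice[N HN] : forall j, exists N, forall s',
    (forall i, (i < N)%N -> sh j s i = s' i) -> C j n (sh j s) = C j n s'.
    by move=> j; exact: rep_local (rC j) n _.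
  exists (\max_(p : 'I_n.+1 * 'I_(\max_(j < n.+1) N j)) (pickle (val p.1, val p.2)).+1).
  move=> s' ss'.
  suff CC j : (j <= n)%N -> C j n (sh j s) = C j n (sh j s').
    by apply/seteqP; split => z Dz j jn; move: (Dz j jn); rewrite CC.
  move=> jn; apply: HN => i iN; apply: ss'.
  have iM : (i < \max_(j < n.+1) N j)%N.
    apply: leq_trans iN _.
    exact: (leq_bigmax (F := fun j : 'I_n.+1 => N j) (Ordinal (jn : (j < n.+1)%N))).
  exact: (leq_bigmax (F := fun p : 'I_n.+1 * 'I_(\max_(j < n.+1) N j) =>
    (pickle (val p.1, val p.2)).+1) (Ordinal (jn : (j < n.+1)%N), Ordinal iM)).
- move=> n s z Dz j jn; apply: (rep_decr (rC j)).
  by apply: Dz; exact: leqW.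
- move=> n s s' ss' z Dz j jn; apply: (rep_mono (rC j)) (Dz j jn).
  by move=> i; exact: ss'.
- apply/seteqP; split => z.
    move=> Bz.
    have /choice[f Hf] : forall j, exists s, (\bigcap_n C j n s) z.
      by move=> j; have := Bz j I; rewrite (rep_eq (rC j)) => -[s _]; exists s.
    exists (fun k => if unpickle k is Some p then f (p.1 : nat) (p.2 : nat) else 0%N) => // n _ j jn.
    rewrite /sh [X in C _ _ X](_ : _ = f j); first exact: Hf.
    by apply/funext => i; rewrite pickleK.
  move=> [s _ Ds] j _; rewrite (rep_eq (rC j)); exists (sh j s) => // n _.
  apply: (@rep_decr_le _ _ (rC j) _ (maxn n j)); first exact: leq_maxl.
  by apply: Ds => //; exact: leq_maxr.
Qed.

(** The first entry of the index bounds the rank of the set; the constraint is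
    [j <= s 0] and not [j = s 0], to keep the representation monotone. A point of
    all stages lies in one of finitely many sets, since stages decrease. *)
Lemma representable_bigcup (B : (set (R * T))^nat) :
  (forall j, representable (B j)) -> representable (\bigcup_j B j).
Proof.
move=> /choice[C rC].
pose sh (s : nat -> nat) i := s i.+1.
pose D n s := [set z | exists2 j, (j <= s 0%N)%N & C j n (sh s) z].
exists D; split.
- move=> n s.
  suff : forall m, paving [set z | exists2 j, (j <= m)%N & C j n (sh s) z] by exact.
  elim => [|m IH].
    rewrite [X in paving X](_ : _ = C 0%N n (sh s)); first exact: rep_paving (rC 0%N) _ _.
    apply/seteqP; split => z; first by case=> j; rewrite leqn0 => /eqP ->.
    by exists 0%N.
  rewrite [X in paving X](_ : _ = [set z | exists2 j, (j <= m)%N & C j n (sh s) z]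
    `|` C m.+1 n (sh s)).
    by apply: pavingU => //; exact: rep_paving (rC _) _ _.
  apply/seteqP; split => z.
    by case=> j; rewrite leq_eqVlt => /orP[/eqP-> ?|jm ?]; [right|left; exists j].
  by case=> [[j jm]|]; [exists j => //; exact: leqW|exists m.+1].
- move=> n s.
  have /choice[N HN] : forall j, exists N, forall s',
    (forall i, (i < N)%N -> sh s i = s' i) -> C j n (sh s) = C j n s'.
    by move=> j; exact: rep_local (rC j) n _.
  exists (\max_(j < (s 0%N).+1) N j).+1 => s' ss'.
  have CC j : (j <= s 0%N)%N -> C j n (sh s) = C j n (sh s').
    move=> js; apply: HN => i iN; apply: ss'; rewrite ltnS.
    apply: leq_trans iN _.
    exact: (leq_bigmax (F := fun j : 'I_(s 0%N).+1 => N j) (Ordinal (js : (j < (s 0%N).+1)%N))).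
  rewrite /D -(ss' 0%N)//; apply/seteqP; split => z [j js Cz]; exists j => //.
    by rewrite -CC.
  by rewrite CC.
- by move=> n s z [j js Cz]; exists j => //; exact: (rep_decr (rC j)).
- move=> n s s' ss' z [j js Cz]; exists j; first exact: leq_trans (ss' 0%N).
  by apply: (rep_mono (rC j)) Cz => i; exact: ss'.
- apply/seteqP; split => z.
    move=> [j _]; rewrite (rep_eq (rC j)) => -[s _ Cs].
    exists (fun i => if i is k.+1 then s k else j) => // n _.
    by exists j => //; exact: Cs.
  move=> [s _ Ds]; apply: contrapT => nB.
  have /choice[N HN] : forall j, exists n, ~ C j n (sh s) z.
    move=> j; apply: contrapT => /forallNP H; apply: nB; exists j => //.
    by rewrite (rep_eq (rC j)); exists (sh s) => // n _; apply: contrapT; exact: H.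
  have [j js] := Ds (\max_(j < (s 0%N).+1) N j)%N I.
  move/(rep_decr_le (rC j)) => /(_ (N j)) H; apply: (HN j); apply: H.
  exact: (leq_bigmax (F := fun j : 'I_(s 0%N).+1 => N j) (Ordinal (js : (j < (s 0%N).+1)%N))).
Qed.

Lemma representable_setT_box E : G E -> representable [set z : R * T | E z.2].
Proof.
move=> GE.
rewrite [X in representable X](_ : _ =
  \bigcup_n [set z | - n%:R <= z.1 <= n%:R /\ E z.2]).
  by apply: representable_bigcup => n; exact/representable_paving/paving_box.
apply/seteqP; split => z; last by move=> [n _ []].
move=> Ez; exists (Num.trunc `|z.1|).+1 => //; split => //.
by rewrite -ler_norml ltW// truncnS_gt.
Qed.

Lemma representable_ray a : representable [set z : R * T | a <= z.1].
Proof.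
rewrite [X in representable X](_ : _ =
  \bigcup_n [set z | a <= z.1 <= n%:R /\ setT z.2]).
  apply: representable_bigcup => n; apply/representable_paving/paving_box.
  exact: sigma_setT.
apply/seteqP; split => z; last by move=> [n _ [/andP[]]].
move=> az; exists (Num.trunc `|z.1|).+1 => //; split => //.
by rewrite (az : a <= z.1)/= (le_trans (ler_norm _))// ltW// truncnS_gt.
Qed.

Lemma representable_ltray a : representable [set z : R * T | z.1 < a].
Proof.
rewrite [X in representable X](_ : _ =
  \bigcup_n [set z | - n%:R <= z.1 <= a - n.+1%:R^-1 /\ setT z.2]).
  apply: representable_bigcup => n; apply/representable_paving/paving_box.
  exact: sigma_setT.
apply/seteqP; split => z; last first.
  move=> [n _ [/andP[_ /le_lt_trans]]] + _; apply.
  by rewrite ltrBlDr ltrDl invr_gt0.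
move=> /= za.
have [n] : exists n : nat, `|z.1| <= n%:R /\ n.+1%:R^-1 <= a - z.1.
  near \oo => n; exists n; split; last first.
    apply/ltW; near: n.
    by apply: (near_infty_natSinv_lt (PosNum (_ : 0 < a - z.1))); rewrite subr_gt0.
  apply/ltW; near: n; exact: nbhs_infty_gtr.
rewrite ler_norml => -[/andP[nz _] na]; exists n => //; split => //.
by rewrite nz/= lerBrDr -lerBrDl.
Unshelve. all: by end_near. Qed.

(** Representability is not stable under complement; the sets which are
    representable together with their complements form a sigma-algebra, and
    contain the rectangles. *)
Lemma representable_complemented : sigma_algebra [set: R * T]
  [set B | representable B /\ representable (~` B)].
Proof.
have r0 := representable_paving paving0.
have rT : representable setT by have := representable_setT_box sigma_setT.
split => /=.
- by rewrite setC0.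
- by move=> A [rA rAC]; rewrite setTD setCK.
- move=> A rA; split; first by apply: representable_bigcup => n; have [] := rA n.
  by rewrite setC_bigcup; apply: representable_bigcap => n; have [] := rA n.
Qed.

(** Kept as a generating class on [R * T], since [G] is not the canonical
    sigma-algebra of [T] and the product structure of the pair type would refer
    to the latter. *)
Definition rectangles : set (set (R * T)) :=
  [set A `*` E | A in (measurable : set (set R)) & E in G].

Lemma representable_rectangles : <<s rectangles >> `<=` representable.
Proof.
suff : <<s rectangles >> `<=` [set B | representable B /\ representable (~` B)].
  by move=> H B /H[].
apply: smallest_sub; first exact: representable_complemented.
have [C0 CC CU] := representable_complemented.
move=> _ [A mA [E GE <-]].
have -> : A `*` E = ((fst @^-1` A) `&` [set z | E z.2] : set (R * T)).
  by apply/seteqP; split => z [].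
set S := [set B | _] in CC CU *.
have SC B : S B -> S (~` B) by move/CC; rewrite setTD.
have SI B1 B2 : S B1 -> S B2 -> S (B1 `&` B2).
  move=> S1 S2; rewrite -(setCK (B1 `&` B2)) setCI; apply: (SC).
  by rewrite -bigcup2E; apply: CU => -[|[|n]]//=; exact: SC.
apply: SI; last first.
  split; first exact: representable_setT_box.
  exact: representable_setT_box (sigma_setC GE).
have : sigma_algebra [set: R] [set A | S (fst @^-1` A)].
  split => /=; first by rewrite preimage_set0.
    by move=> B SB; rewrite setTD preimage_setC; exact: SC.
  by move=> F SF; rewrite preimage_bigcup; exact: CU.
move=> sS.
suff : (measurable : set (set R)) `<=` [set A | S (fst @^-1` A)] by apply.
rewrite [X in X `<=` _](_ : _ = <<s (@RGenCInfty.G R) >>); last exact: RGenCInfty.measurableE.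
apply: smallest_sub => // _ [a ->] /=.
have -> : fst @^-1` `[a, +oo[%classic = [set z : R * T | a <= z.1].
  by apply/seteqP; split => z /=; rewrite in_itv/= andbT.
split; first exact: representable_ray.
rewrite [X in representable X](_ : _ = [set z : R * T | z.1 < a]).
  exact: representable_ltray.
by apply/seteqP; split => z /=; rewrite real_ltNge ?num_real// => /negP.
Qed.

(** Choquet's capacitability argument: truncate the entries of the index one
    after the other so that the outer probability of the projection drops by
    at most [e]; the intersection of the corresponding pavings lies in the set
    and its projection still has almost full outer probability. *)
Lemma capacitable (B : set (R * T)) (e : R) : representable B -> 0 < e ->
  exists2 K, G K /\ K `<=` proj B & outer P sG Gsub (proj B) <= fine (P K) + e.
Proof.
move=> [C rC] e0; set I := outer P sG Gsub.
pose D (N : nat) (m : nat -> nat) := [set z | exists2 s : nat -> nat,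
  (forall i, (i < N)%N -> s i <= m i)%N & (\bigcap_n C n s) z].
(* [D N m]: the points with an index whose first [N] entries are bounded by [m]. *)
pose upd (N : nat) (m : nat -> nat) k i := if i == N then k else m i.
have D0 m : D 0%N m = B.
  by rewrite (rep_eq rC); apply/seteqP; split => z [s _ sz]; exists s.
have DS N m : D N m = \bigcup_k D N.+1 (upd N m k).
  apply/seteqP; split => z.
    move=> [s sm sz]; exists (s N) => //; exists s => // i.
    rewrite ltnS leq_eqVlt /upd => /orP[/eqP ->|iN]; first by rewrite eqxx.
    by rewrite (ltn_eqF iN) sm.
  move=> [k _ [s sm sz]]; exists s => // i iN.
  by have := sm i (ltnW iN); rewrite /upd (ltn_eqF iN).
have step (N : nat) (m : nat -> nat) : exists k : nat,
    I (proj (D N m)) < I (proj (D N.+1 (upd N m k))) + e / 2 ^+ N.+1.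
  pose E k := proj (D N.+1 (upd N m k)).
  have -> : proj (D N m) = \bigcup_k E k.
    rewrite DS; apply/seteqP; split => w.
      by move=> [t [k _ kz]]; exists k => //; exists t.
    by move=> [k _ [t kz]]; exists t; exists k.
  apply: outer_bigcup; last by rewrite divr_gt0// exprn_gt0.
  move=> k w [t [s sm sz]]; exists t; exists s => // i iN.
  by have := sm i iN; rewrite /upd; case: ifP => // _ /leqW.
have [k Hk] := choice (fun p : nat * (nat -> nat) => step p.1 p.2).
pose m_ := fix m_ N := if N is N'.+1 then upd N' (m_ N') (k (N', m_ N')) else (fun=> 0%N).
have mI N : I (proj B) <= I (proj (D N (m_ N))) + e * (1 - 2^-1 ^+ N).
  elim: N => [|N IH]; first by rewrite D0 expr0 subrr mulr0 addr0.
  have := Hk (N, m_ N) => /=; set a := I (proj (D N.+1 _)) => H.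
  apply: (le_trans IH); rewrite -/a exprS.
  move: H; rewrite exprS invfM -exprVn; set q := 2^-1 ^+ N; lra.
have mst i N : (i < N)%N -> m_ N i = k (i, m_ i).
  elim: N => // N IH; rewrite ltnS leq_eqVlt => /orP[/eqP ->|iN] /=.
    by rewrite /upd eqxx.
  by rewrite /upd (ltn_eqF iN) IH.
pose m i := k (i, m_ i).
have DC n : exists N, D N (m_ N) `<=` C n m.
  have [N HN] := rep_local rC n m; exists N => z [s sm sz].
  have -> : C n m = C n (fun i => maxn (s i) (m i)).
    apply: HN => i iN; apply/esym/maxn_idPr.
    by have := sm i iN; rewrite mst.
  have : C n s `<=` C n (fun i => maxn (s i) (m i)).
    by apply: (rep_mono rC) => i; exact: leq_maxl.
  by apply; apply: sz.
have Ie n : I (proj B) <= I (proj (C n m)) + e.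
  have [N DN] := DC n; apply: (le_trans (mI N)); apply: lerD.
    by apply: le_outer => w [t tz]; exists t; exact: DN.
  by rewrite ler_piMr ?(ltW e0)// gerBl exprn_ge0.
have GC n : G (proj (C n m)) by apply: paving_proj; exact: rep_paving rC _ _.
exists (\bigcap_n proj (C n m)).
  split; first exact: sigma_bigcap.
  rewrite -proj_bigcap; last 2 first.
  - by move=> n; exact: rep_paving rC _ _.
  - by move=> n; exact: (rep_decr rC).
  move=> w [t tz]; exists t; rewrite (rep_eq rC); by exists m.
have mC n : measurable (proj (C n m)) by exact: Gsub.
have mCC : measurable (\bigcap_n proj (C n m)) by exact: bigcapT_measurable.
have dC : nonincreasing_seq (fun n => proj (C n m)).
  move=> i j ij; apply/subsetPset => w [t tz]; exists t.
  exact: (rep_decr_le rC ij).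
have cv : P (proj (C n m)) @[n --> \oo] --> P (\bigcap_n proj (C n m)).
  apply: (nonincreasing_cvg_mu (mu := P)) => //.
  by apply: (le_lt_trans (probability_le1 _ _)) => //; rewrite ltry.
have Pf : P (\bigcap_n proj (C n m)) \is a fin_num by exact: fin_num_measure.
rewrite -lee_fin EFinD (fineK Pf) -leeBlDr//.
apply: (cvge_ge _ cv); apply: nearW => n.
rewrite leeBlDr//.
apply: (@le_trans _ _ (I (proj (C n m)) + e)%:E); first by rewrite lee_fin.
by rewrite EFinD leeD2r// outer_le.
Qed.

(** Capacitability approximates the projection from inside by sets of [G]; its
    envelope approximates it from outside; the difference is negligible, hence in
    [G]. *)
Theorem measurable_projection (B : set (R * T)) :
  P.-negligible `<=` G -> <<s rectangles >> B -> G (proj B).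
Proof.
move=> Gneg /representable_rectangles rB.
have /choice[K HK] : forall n : nat, exists K, [/\ G K, K `<=` proj B &
    outer P sG Gsub (proj B) <= fine (P K) + n.+1%:R^-1].
  move=> n; have [|K [GK KB] le] := @capacitable B n.+1%:R^-1 rB; first by rewrite invr_gt0.
  by exists K.
have [GE BE _] := envelopeP P sG Gsub (proj B).
set E := envelope _ _ _ _ in GE BE.
pose K' := \bigcup_n K n.
have GK' : G K' by apply: sigma_bigcup => // n; have [] := HK n.
have K'B : K' `<=` proj B by move=> w [n _ Kw]; have [_ + _] := HK n; apply.
have mK' := Gsub GK'.
have mE := Gsub GE.
have PEK : P (E `\` K') = 0%E.
  apply/eqP; rewrite eq_le measure_ge0 andbT.
  have -> : P (E `\` K') = (P E - P K')%E.
    rewrite measureD//; last by rewrite (le_lt_trans (probability_le1 _ _))// ltry.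
    by congr (_ - P _)%E; apply/setIidPr; exact: subset_trans K'B BE.
  rewrite leeBlDr ?fin_num_measure// add0e.
  apply/lee_addgt0Pr => e e0.
  have [n en] : exists n : nat, n.+1%:R^-1 <= e.
    by near \oo => n; exists n; apply/ltW; near: n; exact: near_infty_natSinv_lt (PosNum e0).
  have [GK KB le] := HK n.
  rewrite -(outerE P sG Gsub).
  apply: (@le_trans _ _ (P (K n) + n.+1%:R^-1%:E)%E).
    by rewrite -(@fineK _ (P (K n))) ?fin_num_measure//; exact: Gsub.
  rewrite leeD ?lee_fin// le_measure ?inE//; first exact: Gsub.
  by move=> w Kw; exists n.
have -> : proj B = K' `|` (proj B `\` K').
  by rewrite setDUK.
apply: sigma_setU => //; apply: Gneg.
exists (E `\` K'); split => //; first exact: measurableD.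
by apply: setSD.
Unshelve. all: by end_near. Qed.

End capacity.

(** * Dyadic times and cadlag paths *)

Section dyadic_approximation.
Context (R : realType).
Implicit Types (u t : R) (n : nat).

(** The inequality [u < dyadic_up n u] is strict, as needed to evaluate
    right-continuous paths along these times. *)
Definition dyadic_up n u : R := ((Num.trunc (u * 2 ^+ n)).+1)%:R / 2 ^+ n.

Lemma exprn2_gt0 n : 0 < 2 ^+ n :> R. Proof. exact: exprn_gt0. Qed.

Lemma dyadic_up_gt n u : u < dyadic_up n u.
Proof. by rewrite ltr_pdivlMr ?exprn2_gt0// truncnS_gt. Qed.

Lemma dyadic_up_le n u : 0 <= u -> dyadic_up n u <= u + 2^-1 ^+ n.
Proof.
move=> u0; rewrite exprVn ler_pdivrMr ?exprn2_gt0// mulrDl mulVf ?gt_eqF ?exprn2_gt0//.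
by rewrite -natr1 lerD2r truncn_le mulr_ge0// ltW// exprn2_gt0.
Qed.

Lemma cvg_half0 : (2^-1 ^+ n : R) @[n --> \oo] --> (0 : R).
Proof. by apply: cvg_expr; rewrite ger0_norm// invf_lt1// ltr1n. Qed.

Lemma cvg_dyadic_up u : 0 <= u -> dyadic_up n u @[n --> \oo] --> u.
Proof.
move=> u0; apply: (@squeeze_cvgr _ _ _ _ (cst u) (fun n => u + 2^-1 ^+ n)).
- by apply: nearW => n; rewrite ltW ?dyadic_up_gt//= dyadic_up_le.
- exact: cvg_cst.
- by rewrite -[X in _ --> X]addr0; apply: cvgD; [exact: cvg_cst|exact: cvg_half0].
Qed.

Lemma dyadic_upE n u k : 0 <= u ->
  k%:R / 2 ^+ n <= u < k.+1%:R / 2 ^+ n -> dyadic_up n u = k.+1%:R / 2 ^+ n.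
Proof.
move=> u0; rewrite ler_pdivrMr ?exprn2_gt0// ltr_pdivlMr ?exprn2_gt0// => /andP[ku uk].
by congr (_ / _); congr (_.+1%:R); apply/truncn_def; rewrite ku uk.
Qed.

Lemma dyadic_cell n u : 0 <= u ->
  exists k : nat, k%:R / 2 ^+ n <= u < k.+1%:R / 2 ^+ n.
Proof.
move=> u0; exists (Num.trunc (u * 2 ^+ n)).
rewrite ler_pdivrMr ?exprn2_gt0// ltr_pdivlMr ?exprn2_gt0// truncnS_gt andbT.
by rewrite truncn_le mulr_ge0// ltW// exprn2_gt0.
Qed.

End dyadic_approximation.

Section cadlag_paths.
Context (R : realType) (d : measure_display) (T : measurableType d).
Implicit Types (X : R -> T -> R).

Lemma cadlag_cvg_from_right X t (u : R^nat) w : cadlag X -> 0 <= t ->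
  (forall n, t < u n) -> u @ \oo --> t -> X (u n) w @[n --> \oo] --> X t w.
Proof.
by move=> /(_ w)[/(_ t) + _] t0 ut cu => /(_ t0) /cvg_at_rightP; apply.
Qed.

Lemma cadlagB X Y : cadlag X -> cadlag Y -> cadlag (fun t w => X t w - Y t w).
Proof.
move=> cX cY w; have [rX lX] := cX w; have [rY lY] := cY w; split => t t0.
  by apply: cvgB; [exact: rX|exact: rY].
by apply: is_cvgB; [exact: lX|exact: lY].
Qed.

Lemma cadlag_nondecreasing X :
  (forall w s t, s <= t -> X s w <= X t w) ->
  (forall w t, 0 <= t -> X s w @[s --> t^'+] --> X t w) -> cadlag X.
Proof.
move=> nX rX w; split => t t0; first exact: rX.
apply: nondecreasing_at_left_is_cvgr.
  by apply: nearW => x y z _ _; exact: nX.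
apply: nearW => x; exists (X t w) => _ /= [y + <-].
by rewrite in_itv/= => /andP[_ /ltW]; exact: nX.
Qed.

Lemma cadlag_after (tau : T -> \bar R) :
  cadlag (fun s w => (tau w <= s%:E)%E%:R : R).
Proof.
apply: cadlag_nondecreasing => [w s t st|w t t0].
  rewrite ler_nat; case: (leP (tau w) s%:E) => // ts.
  by rewrite (le_trans ts)// lee_fin.
case: (leP (tau w) t%:E) => tt.
  apply: (@cvg_trans _ (1%:R @[s --> t^'+])); last exact: cvg_cst.
  apply: near_eq_cvg; near=> s; rewrite (le_trans tt)// lee_fin.
  by apply/ltW; near: s; exact: nbhs_right_gt.
apply: (@cvg_trans _ (0%:R @[s --> t^'+])); last exact: cvg_cst.
apply: near_eq_cvg.
case: (tau w) tt => [r|//|//]; last first.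
  by move=> _; apply: nearW => s; rewrite leNgt ltry.
rewrite lte_fin => tr.
near=> s; rewrite lee_fin leNgt (_ : s < r)//.
Unshelve. all: by end_near. Qed.

End cadlag_paths.

(** * Optional sets and their debuts *)

Section progressive.
Context (R : realType) (d : measure_display) (T : measurableType d).
Variables (P : probability T R) (F : R -> set (set T)).
Hypothesis uF : usual_filtration P F.

Let sF t : 0 <= t -> sigma_algebra [set: T] (F t).
Proof. exact: (filtration_sigma_algebra uF). Qed.

Lemma filtration_bigcap_right t (E : (set T)^nat) : 0 <= t ->
  (forall n, F (t + n.+1%:R^-1) (E n)) -> (forall n, E n.+1 `<=` E n) ->
  F t (\bigcap_n E n).
Proof.
move=> t0 FE Ed; apply: (filtration_right_continuous uF) => // s /= ts.
have s0 : 0 <= s by rewrite (le_trans t0)// ltW.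
have [N Ns] : exists N : nat, t + N.+1%:R^-1 <= s.
  near \oo => N; exists N; rewrite -lerBrDl; apply/ltW; near: N.
  by apply: (near_infty_natSinv_lt (PosNum (_ : 0 < s - t))); rewrite subr_gt0.
have Emn m n : (m <= n)%N -> E n `<=` E m.
  elim: n => [|n IH]; first by rewrite leqn0 => /eqP ->.
  by rewrite leq_eqVlt => /orP[/eqP->//|/IH] H; apply: subset_trans H.
have -> : \bigcap_n E n = \bigcap_n E (n + N)%N.
  apply/seteqP; split => w Ew n _; first exact: Ew.
  by apply: (Emn n (n + N)%N); [exact: leq_addr|exact: Ew].
apply: (sigma_bigcap (sF s0)) => n.
apply: (filtration_nondecreasing uF) (FE (n + N)%N); first by rewrite addr_ge0.
apply: le_trans Ns; rewrite lerD2l lef_pV2 ?posrE// ler_nat ltnS.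
exact: leq_addl.
Unshelve. all: by end_near. Qed.

(** It suffices to treat a cadlag adapted process: before [t] it is the limit of
    its values at the next dyadic times, capped at [t] to stay in [F t]. *)
Lemma optional_progressive (B : set (R * T)) t : 0 <= t ->
  optional_sigma_algebra F B ->
  <<s rectangles (F t) >> (B `&` [set z | 0 <= z.1 < t]).
Proof.
move=> t0.
pose Re := @rectangles R _ T (F t).
pose S : set (set (R * T)) := <<s Re >>.
pose D : set (R * T) := [set z | 0 <= z.1 < t].
have -> : <<s rectangles (F t) >> = S by [].
have [S0 SC SU] : sigma_algebra [set: R * T] S by exact: smallest_sigma_algebra.
have Srect A E : measurable A -> F t E -> S (A `*` E).
  by move=> mA FE; apply: sub_sigma_algebra; exists A => //; exists E.
have FT : F t setT := sigma_setT (sF t0).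
have SD : S D.
  rewrite (_ : D = `[0, t[%classic `*` setT); last first.
    by apply/seteqP; split => z /=; rewrite in_itv//= => -[].
  exact: Srect.
suff : optional_sigma_algebra F `<=` [set B | S (B `&` D)] by apply.
apply: smallest_sub.
  split => /=; first by rewrite set0I.
    move=> A SA; rewrite (_ : _ `&` _ = (setT `\` (A `&` D)) `&` D).
      have SI := @measurableI _ (g_sigma_algebraType Re).
      by apply: SI => //; exact: SC.
    apply/seteqP; split => z /=; first by move=> [[_ nA] Dz]; split => //; split => // -[].
    by move=> [[_ nA] Dz]; split => //; split; [case/andP: Dz|move=> Az; apply: nA].
  by move=> A SA; rewrite setI_bigcupl; exact: SU.
move=> _ [X [aX cX]] [A mA <-] /=.
pose f (z : R * T) := X z.1 z.2.
pose h n (z : R * T) := X (Num.min t (dyadic_up n z.1)) z.2.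
have mh n : measurable_fun (D : set (g_sigma_algebraType Re)) (h n).
  move=> _ C mC.
  pose Dk k : set R := `[k%:R / 2 ^+ n, k.+1%:R / 2 ^+ n[ `&` `[0, t[.
  rewrite (_ : _ `&` _ = \bigcup_k (Dk k `*` (X (Num.min t (k.+1%:R / 2 ^+ n)) @^-1` C))).
    apply: bigcupT_measurable => k; apply: Srect; first exact: measurableI.
    have m0 : 0 <= Num.min t (k.+1%:R / 2 ^+ n) by rewrite le_min t0 divr_ge0// exprn_ge0.
    apply: (filtration_nondecreasing uF m0); last exact: aX.
    by rewrite ge_min lexx.
  apply/seteqP; split => z.
    move=> [/= /andP[z0 zt] Cz]; have [k Hk] := dyadic_cell n z0.
    exists k => //; split; first by split; rewrite /= in_itv/= ?z0.
    by rewrite /= -(dyadic_upE z0 Hk).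
  move=> [k _ [[/=]]]; rewrite !in_itv/= => Hk /andP[z0 zt] Cz; split => /=.
    by rewrite /D/= z0.
  by rewrite /h (dyadic_upE z0 Hk).
have mf : measurable_fun (D : set (g_sigma_algebraType Re)) f.
  apply: (measurable_fun_cvg mh) => z /= /andP[z0 zt].
  apply: cadlag_cvg_from_right => //.
    by move=> n; rewrite lt_min zt dyadic_up_gt.
  apply: (@cvg_trans _ (dyadic_up n z.1 @[n --> \oo])); last exact: cvg_dyadic_up.
  apply: near_eq_cvg; near=> n; apply/esym/min_idPr/ltW.
  by near: n; apply: (cvgr_lt _ (cvg_dyadic_up z0)).
have := mf SD A mA.
rewrite (_ : D `&` _ = timeline_prod (T := T) `&` [set z | A (X z.1 z.2)] `&` D)//.
apply/seteqP; split => z /=.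
  by move=> [Dz Az]; split => //; split => //; case/andP: Dz.
by move=> [[_ Az] Dz]; split.
Unshelve. all: by end_near. Qed.

(** The strict inequality [q < t] lets successive debuts explore a set, and makes
    the debut the infimum of an empty set, [+oo], when the set ends before [q]. *)
Definition debut (B : set (R * T)) (q : R) (w : T) : \bar R :=
  ereal_inf [set t%:E | t in [set t | q < t /\ B (t, w)]].

Lemma debut_lt B q w (t : R) :
  (debut B q w < t%:E)%E <-> exists u, [/\ q < u, u < t & B (u, w)].
Proof.
split; last first.
  move=> [u [qu ut Bu]]; apply: (@le_lt_trans _ _ u%:E); last by rewrite lte_fin.
  by apply: ereal_inf_lbound; exists u.
by move=> /ereal_inf_lt[_ [u [qu Bu] <-]]; rewrite lte_fin => ut; exists u.
Qed.

(** Debut theorem: the projection theorem makes the events [debut < t]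
    measurable, and right-continuity of the filtration does the rest. *)
Lemma stopping_time_debut B q : 0 <= q -> optional_sigma_algebra F B ->
  stopping_time F (debut B q).
Proof.
move=> q0 oB; split => [w|t t0].
  apply: le_ereal_inf_tmp => _ [u [qu _] <-].
  by rewrite lee_fin (le_trans q0)// ltW.
have Flt s : 0 <= s -> F s [set w | (debut B q w < s%:E)%E].
  move=> s0.
  rewrite (_ : [set w | _] = proj ((B `&` [set z | 0 <= z.1 < s]) `&` (`]q, +oo[%classic `*` setT))).
    apply: (measurable_projection (sF s0) (filtration_sub uF s0)).
      move=> N nN; apply: (filtration_nondecreasing uF (lexx 0) s0).
      exact: (filtration_complete uF nN).
    apply: (@measurableI _ (g_sigma_algebraType (rectangles (F s)))).
      exact: optional_progressive.
    apply: sub_sigma_algebra; exists `]q, +oo[%classic => //; exists setT => //.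
    exact: sigma_setT (sF s0).
  apply/seteqP; split => w.
    move=> /debut_lt[u [qu us Bu]]; exists u; split; last by rewrite /= in_itv/= andbT.
    by split => //=; rewrite us (le_trans q0)// ltW.
  move=> [u [[Bu /= /andP[_ us]] [/=]]]; rewrite in_itv/= andbT => qu _.
  by apply/debut_lt; exists u.
rewrite (_ : [set w | _] = \bigcap_n [set w | (debut B q w < (t + n.+1%:R^-1)%:E)%E]).
  apply: filtration_bigcap_right => // n; first by apply: Flt; rewrite addr_ge0.
  move=> w /= /lt_le_trans; apply; rewrite lee_fin lerD2l lef_pV2 ?posrE// ler_nat//.
apply/seteqP; split => w /=.
  by move=> Dt n _ /=; apply: (le_lt_trans Dt); rewrite lte_fin ltrDl invr_gt0.
move=> Dt; apply/lee_addgt0Pr => e e0.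
near \oo => n; apply/ltW; apply: (lt_trans (Dt n I)).
rewrite -EFinD lte_fin ltrD2l; near: n; exact: near_infty_natSinv_lt (PosNum e0).
Unshelve. all: by end_near. Qed.

Lemma optional_sigma : sigma_algebra (timeline_prod (T := T)) (optional_sigma_algebra F).
Proof. exact: smallest_sigma_algebra. Qed.

Lemma optional_preimage X (B : set R) : adapted F X -> cadlag X -> measurable B ->
  optional_sigma_algebra F (timeline_prod (T := T) `&` [set z | B (X z.1 z.2)]).
Proof. by move=> aX cX mB; apply: sub_sigma_algebra; exists X => //; exists B. Qed.

Lemma optional_process_cadlag X : adapted F X -> cadlag X -> optional_process F X.
Proof. by move=> aX cX B mB; apply: (@optional_preimage X B). Qed.

Lemma optional_after tau : stopping_time F tau ->
  optional_sigma_algebra F [set z | 0 <= z.1 /\ (tau z.2 <= z.1%:E)%E].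
Proof.
move=> [tau0 st].
rewrite (_ : [set z | _] = timeline_prod (T := T) `&`
   [set z | `[2^-1, +oo[%classic ((tau z.2 <= z.1%:E)%E%:R : R)]).
  apply: (@optional_preimage (fun s w => (tau w <= s%:E)%E%:R) `[2^-1, +oo[%classic);
    [|exact: cadlag_after|exact: measurable_itv].
  move=> t t0 B mB.
  rewrite (_ : _ @^-1` B = ((if `[< B 1 >] then [set w | (tau w <= t%:E)%E] else set0)
      `|` (if `[< B 0 >] then ~` [set w | (tau w <= t%:E)%E] else set0))).
    have G0 := sigma_set0 (sF t0).
    apply: (sigma_setU (sF t0)); case: ifP => // _; first exact: st.
    by apply: (sigma_setC (sF t0)); exact: st.
  apply/seteqP; split => w /=.
    by case: leP => tt Bt; [left|right]; rewrite asboolT//=; apply/negP; rewrite -ltNge.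
  by case; case: asboolP => //= B1; [move=> ->|move=> /negP/negbTE ->].
apply/seteqP; split => z /=; rewrite in_itv/= andbT; move=> [z0]; split => //.
  by rewrite b /= invf_le1// ler1n.
by move: b; case: (leP (tau z.2)) => // _; rewrite mulr0n leNgt invr_gt0 ltr0n.
Qed.

End progressive.

(** * Integrable and square integrable real functions *)

Section integrals.
Context (R : realType) (d : measure_display) (T : measurableType d).
Variable (P : probability T R).
Implicit Types (f g h : T -> R).

Definition intble f : Prop := P.-integrable [set: T] (EFin \o f).

Definition square_intble f : Prop :=
  measurable_fun [set: T] f /\ intble (fun w => f w ^+ 2).

Lemma intble_measurable f : intble f -> measurable_fun [set: T] f.
Proof. by move=> /measurable_int /measurable_EFinP. Qed.

Lemma intbleD f g : intble f -> intble g -> intble (fun w => f w + g w).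
Proof. by move=> If Ig; have := integrableD measurableT If Ig. Qed.

Lemma intbleB f g : intble f -> intble g -> intble (fun w => f w - g w).
Proof. by move=> If Ig; have := integrableB measurableT If Ig. Qed.

Lemma intbleZ k f : intble f -> intble (fun w => k * f w).
Proof. by move=> If; have := integrableZl measurableT k If. Qed.

Lemma intble_sum (I : Type) (s : seq I) (F : I -> T -> R) :
  (forall i, intble (F i)) -> intble (fun w => \sum_(i <- s) F i w).
Proof.
move=> IF; elim: s => [|i s IH].
  rewrite /intble (_ : _ \o _ = EFin \o cst 0); first exact: finite_measure_integrable_cst.
  by apply/funext => w /=; rewrite big_nil.
rewrite (_ : (fun _ => _) = (fun w => F i w + \sum_(i <- s) F i w)); first exact: intbleD.
by apply/funext => w; rewrite big_cons.
Qed.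

Lemma intble_cst k : intble (fun=> k).
Proof. exact: finite_measure_integrable_cst. Qed.

Lemma intble_le f g : measurable_fun [set: T] f -> (forall w, `|f w| <= g w) ->
  intble g -> intble f.
Proof.
move=> mf fg; apply: le_integrable => //; first exact/measurable_EFinP.
by move=> w _ /=; rewrite lee_fin (le_trans (fg w))// ler_norm.
Qed.

Lemma intble_norm f : intble f -> intble (fun w => `|f w|).
Proof. exact: integrable_norm. Qed.

Lemma intble_mul_indic f (B : set T) : measurable B -> intble f ->
  intble (fun w => f w * \1_B w).
Proof.
move=> mB If; apply: (intble_le _ _ (intble_norm If)).
  by apply: measurable_funM; [exact: intble_measurable|exact: measurable_indic].
by move=> w; rewrite normrM ler_piMr// indicE; case: (w \in B); rewrite ?normr1 ?normr0.
Qed.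

Lemma integral_mul_indic f (B : set T) :
  (\int[P]_w (f w * \1_B w)%:E = \int[P]_(w in B) (f w)%:E)%E.
Proof.
rewrite [RHS]integral_mkcond; apply: eq_integral => w _.
by rewrite patchE indicE; case: ifPn => _; rewrite ?mulr1 ?mulr0.
Qed.

Lemma measurable_above f x : measurable_fun [set: T] f -> measurable [set w | x < f w].
Proof.
move=> mf; rewrite (_ : [set w | _] = f @^-1` `]x, +oo[%classic); last first.
  by apply/seteqP; split => w /=; rewrite in_itv/= andbT.
by rewrite -[X in measurable X]setTI; apply: mf => //; exact: measurable_itv.
Qed.

Lemma EFin_Rintegral f : intble f ->
  (\int[P]_w f w)%:E = (\int[P]_w (f w)%:E)%E.
Proof. by move=> If; rewrite fineK//; exact: integrable_fin_num. Qed.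

Lemma Rintegral_sum (I : Type) (s : seq I) (F : I -> T -> R) :
  (forall i, intble (F i)) ->
  \int[P]_w (\sum_(i <- s) F i w) = \sum_(i <- s) \int[P]_w F i w.
Proof.
move=> IF; elim: s => [|i s IH].
  under eq_Rintegral do rewrite big_nil.
  by rewrite big_nil Rintegral_cst// mul0r.
under eq_Rintegral do rewrite big_cons.
by rewrite big_cons RintegralD ?IH//; [exact: IF|exact: intble_sum].
Qed.

Lemma Rintegral_ae_eq f g : intble f -> intble g ->
  {ae P, forall w, f w = g w} -> \int[P]_w f w = \int[P]_w g w.
Proof.
move=> If Ig fg; congr fine; apply: ae_eq_integral => //.
- exact: measurable_int If.
- exact: measurable_int Ig.
- by apply: filterS fg => w -> .
Qed.

Lemma dominated_cvg (F : nat -> T -> R) f g :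
  (forall n, measurable_fun [set: T] (F n)) -> measurable_fun [set: T] f ->
  {ae P, forall w, F n w @[n --> \oo] --> f w} -> intble g ->
  {ae P, forall w, forall n, `|F n w| <= g w} ->
  intble f /\ \int[P]_w F n w @[n --> \oo] --> \int[P]_w f w.
Proof.
move=> mF mf Ff Ig Fg.
have [|||||If _ cv] := @dominated_convergence _ _ _ P setT measurableT
    (fun n => EFin \o F n) (EFin \o f) (EFin \o g).
- by move=> n; exact/measurable_EFinP.
- exact/measurable_EFinP.
- apply: filterS Ff => w Fw _; apply: cvg_EFin => //; exact: nearW.
- exact: Ig.
- by apply: filterS Fg => w Fw n _ /=; rewrite lee_fin.
split=> //; apply: fine_cvg; rewrite fineK; last exact: integrable_fin_num.
exact: cv.
Qed.

Lemma square_intble_mul f g : square_intble f -> square_intble g ->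
  intble (fun w => f w * g w).
Proof.
move=> [mf If] [mg Ig]; apply: (@intble_le _ (fun w => f w ^+ 2 + g w ^+ 2)).
- exact: measurable_funM.
- by move=> w; rewrite ler_norml; apply/andP; split; nra.
- exact: intbleD.
Qed.

Lemma square_intble_cst k : square_intble (fun=> k).
Proof. by split => //; exact: intble_cst. Qed.

Lemma square_intble_intble f : square_intble f -> intble f.
Proof.
move=> sf; have := square_intble_mul sf (square_intble_cst 1).
by under eq_fun do rewrite mulr1.
Qed.

Lemma square_intbleD f g : square_intble f -> square_intble g ->
  square_intble (fun w => f w + g w).
Proof.
move=> sf sg; have fg := square_intble_mul sf sg.
have [[mf If] [mg Ig]] := (sf, sg).
split; first exact: measurable_funD.
under eq_fun => w do rewrite sqrrD -mulr_natl.
by apply: intbleD => //; apply: intbleD => //; exact: intbleZ.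
Qed.

Lemma square_intbleZ k f : square_intble f -> square_intble (fun w => k * f w).
Proof.
move=> [mf If]; split; first exact: measurable_funM.
by under eq_fun => w do rewrite exprMn; exact: intbleZ.
Qed.

Lemma square_intbleB f g : square_intble f -> square_intble g ->
  square_intble (fun w => f w - g w).
Proof.
move=> sf sg; have := square_intbleD sf (square_intbleZ (-1) sg).
by under eq_fun do rewrite mulN1r.
Qed.

Lemma square_intble_le f g : measurable_fun [set: T] f ->
  (forall w, `|f w| <= `|g w|) -> square_intble g -> square_intble f.
Proof.
move=> mf fg [mg Ig]; split => //; apply: (intble_le _ _ Ig).
  exact: measurable_funX.
by move=> w; rewrite normrX -(real_normK (num_real (g w))) lerXn2r ?nnegrE.
Qed.

Lemma square_intble_sum (I : Type) (s : seq I) (F : I -> T -> R) :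
  (forall i, square_intble (F i)) -> square_intble (fun w => \sum_(i <- s) F i w).
Proof.
move=> sF; elim: s => [|i s IH].
  by under eq_fun do rewrite big_nil; exact: square_intble_cst.
by under eq_fun do rewrite big_cons; exact: square_intbleD.
Qed.

(** A weighted form of the Cauchy-Schwarz inequality, which needs no square
    roots; the weight [k] is optimized in applications. *)
Lemma Rintegral_mul_le f g (k : R) : 0 < k -> square_intble f -> square_intble g ->
  `|\int[P]_w (f w * g w)| <= k * \int[P]_w (f w ^+ 2) + k^-1 * \int[P]_w (g w ^+ 2).
Proof.
move=> k0 sf sg; have [[mf If] [mg Ig]] := (sf, sg).
have Ifg := square_intble_mul sf sg.
apply: (le_trans (le_normr_Rintegral measurableT Ifg)).
rewrite -!RintegralZl// -RintegralD//; [|exact: intbleZ..].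
apply: le_Rintegral => //; first exact: intble_norm.
  by apply: intbleD; exact: intbleZ.
move=> w _.
have kk : k * k^-1 = 1 by rewrite divff// gt_eqF.
have k'0 : 0 < k^-1 by rewrite invr_gt0.
set a := f w; set b := g w; set c := k^-1 in kk k'0 *.
have H1 : 0 <= k * (a - c * b) ^+ 2 by rewrite mulr_ge0 ?sqr_ge0// ltW.
have H2 : 0 <= k * (a + c * b) ^+ 2 by rewrite mulr_ge0 ?sqr_ge0// ltW.
have E1 : k * (a - c * b) ^+ 2 = k * a ^+ 2 - 2 * (a * b) + c * b ^+ 2.
  by transitivity (k * a ^+ 2 - 2 * (k * c) * (a * b) + (k * c) * (c * b ^+ 2)); [ring|rewrite kk; ring].
have E2 : k * (a + c * b) ^+ 2 = k * a ^+ 2 + 2 * (a * b) + c * b ^+ 2.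
  by transitivity (k * a ^+ 2 + 2 * (k * c) * (a * b) + (k * c) * (c * b ^+ 2)); [ring|rewrite kk; ring].
have H3 : 0 <= k * a ^+ 2 by rewrite mulr_ge0 ?sqr_ge0// ltW.
have H4 : 0 <= c * b ^+ 2 by rewrite mulr_ge0 ?sqr_ge0// ltW.
move: H1 H2; rewrite E1 E2 => H1 H2.
by rewrite ler_norml; apply/andP; split; lra.
Qed.

Lemma cvg_Rintegral_mul0 (F : nat -> T -> R) g : (forall n, square_intble (F n)) ->
  square_intble g -> \int[P]_w (F n w ^+ 2) @[n --> \oo] --> 0 ->
  \int[P]_w (F n w * g w) @[n --> \oo] --> 0.
Proof.
move=> sF sg cv; pose G := \int[P]_w (g w ^+ 2).
have G0 : 0 <= G by apply: Rintegral_ge0 => w _; exact: sqr_ge0.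
apply/cvgr0Pnorm_lt => e e0.
pose k := 2 * (G + 1) / e.
have k0 : 0 < k by rewrite divr_gt0// mulr_gt0// ltr_wpDl.
have kG : k^-1 * (G + 1) = e / 2.
  have G1 : 0 < G + 1 by rewrite ltr_wpDl.
  by rewrite /k; field; rewrite (lt0r_neq0 e0) (lt0r_neq0 G1).
near=> n; apply: (le_lt_trans (Rintegral_mul_le k0 (sF n) sg)); rewrite -/G.
have : \int[P]_w (F n w ^+ 2) < e / 2 / k.
  by near: n; apply: (cvgr_lt _ cv); rewrite (divr_gt0 (divr_gt0 e0 _) k0).
rewrite ltr_pdivlMr// mulrC.
have : 0 < k^-1 by rewrite invr_gt0.
by move: kG; rewrite mulrDr mulr1; lra.
Unshelve. all: by end_near. Qed.

Lemma square_intble_Lfun f : square_intble f <-> f \in Lfun P 2%:E.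
Proof.
split; last first.
  move=> fL; split; last exact: Lfun2_integrable_sqr.
  by move: fL; rewrite inE => /andP[+ _]; rewrite inE.
move=> [mf /integrableP[_ If]]; rewrite inE; apply/andP; split; rewrite inE//=.
rewrite /finite_norm unlock /= poweR_lty//.
rewrite (le_lt_trans _ If)// le_eqVlt; apply/orP; left; apply/eqP.
by apply: eq_integral => w _ /=; rewrite powR_mulrn// normrX.
Qed.

Lemma ae_measurable f g : measure_is_complete P -> {ae P, forall w, f w = g w} ->
  measurable_fun [set: T] f -> measurable_fun [set: T] g.
Proof.
move=> cP fg /measurable_EFinP mf; apply/measurable_EFinP.
by apply: (@ae_measurable_fun _ _ _ P cP setT (EFin \o f)) => //; apply: filterS fg => w /= ->.
Qed.

End integrals.

Section complete_limits.
Context (R : realType) (d : measure_display) (T : measurableType d).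
Variables (P : probability T R).
Hypothesis cP : measure_is_complete P.

(** Completeness allows almost everywhere limits: pathwise integrals are only
    known to be measurable in this way. *)
Lemma ae_measurable_cvg (f : nat -> T -> R) (g : T -> R) :
  (forall n, measurable_fun [set: T] (f n)) ->
  {ae P, forall w, f n w @[n --> \oo] --> g w} -> measurable_fun [set: T] g.
Proof.
move=> mf [N [mN PN fg]].
have Ng w : ~ N w -> f n w @[n --> \oo] --> g w by move=> Nw; apply: contrapT => /fg.
apply: (@ae_measurable _ _ _ P (fun w => g w * \1_(~` N) w)) => //.
  exists N; split => // w /= H; apply: contrapT => Nw; apply: H.
  by rewrite indicE mem_set// mulr1.
apply: (measurable_fun_cvg (h := fun n w => f n w * \1_(~` N) w)) => [n|w _].
  by apply: measurable_funM => //; apply: measurable_indic; exact: measurableC.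
have [Nw|Nw] := pselect (N w).
  by rewrite indicE memNset//= mulr0; under eq_fun do rewrite mulr0; exact: cvg_cst.
by apply: cvgM; [exact: Ng|exact: cvg_cst].
Qed.

Lemma complete_dominated_cvg (f : nat -> T -> R) g h :
  (forall n, measurable_fun [set: T] (f n)) ->
  {ae P, forall w, f n w @[n --> \oo] --> g w} -> intble P h ->
  {ae P, forall w, forall n, `|f n w| <= h w} ->
  intble P g /\ \int[P]_w f n w @[n --> \oo] --> \int[P]_w g w.
Proof. by move=> mf fg; apply: dominated_cvg => //; exact: ae_measurable_cvg fg. Qed.

Lemma intble_ae_le (f g : T -> R) : measurable_fun [set: T] f ->
  {ae P, forall w, `|f w| <= g w} -> intble P g -> intble P f.
Proof.
move=> mf fg Ig.
have [||||//] := @complete_dominated_cvg (fun=> f) f g.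
- by [].
- by apply: nearW => w; exact: cvg_cst.
- exact: Ig.
- by apply: filterS fg => w.
Qed.

Lemma square_intble_ae_le (f g : T -> R) : measurable_fun [set: T] f ->
  {ae P, forall w, `|f w| <= g w} -> square_intble P g -> square_intble P f.
Proof.
move=> mf fg [mg Ig]; split => //; apply: intble_ae_le Ig; first exact: measurable_funX.
apply: filterS fg => w fg; rewrite ger0_norm ?sqr_ge0// -(real_normK (num_real (f w))).
by rewrite lerXn2r ?nnegrE// (le_trans _ fg).
Qed.

End complete_limits.

(** * Bounded increasing sequences *)

Section monotone_limits.
Context (R : realType) (d : measure_display) (T : measurableType d).
Variable (P : probability T R).

(** A monotone sequence of functions with bounded integrals has an integrable,
    hence real-valued, bound. All the maximal functions below come from it. *)
Lemma monotone_limit_intble (f : nat -> T -> R) (V : R) :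
  (forall k, measurable_fun [set: T] (f k)) -> (forall k w, 0 <= f k w) ->
  (forall k w, f k w <= f k.+1 w) ->
  (forall k, (\int[P]_w (f k w)%:E <= V%:E)%E) ->
  exists g : T -> R, [/\ intble P g, forall w, 0 <= g w, \int[P]_w g w <= V &
    {ae P, forall w, forall k, f k w <= g w}].
Proof.
move=> mf f0 fi fV.
pose h (w : T) : \bar R := ereal_sup (range (fun k => (f k w)%:E)).
have fmn w : nondecreasing_seq (fun k => (f k w)%:E).
  by apply/nondecreasing_seqP => k; rewrite lee_fin.
have cv w : (f k w)%:E @[k --> \oo] --> h w by exact: ereal_nondecreasing_cvgn.
have mEf k : measurable_fun [set: T] (fun w => (f k w)%:E) by exact/measurable_EFinP.
have mh : measurable_fun [set: T] h by exact: (emeasurable_fun_cvg _ _ mEf (fun w _ => cv w)).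
have h0 w : (0 <= h w)%E.
  by apply: (@le_trans _ _ (f 0%N w)%:E); [rewrite lee_fin|apply: ereal_sup_ubound; exists 0%N].
have hV : (\int[P]_w h w <= V%:E)%E.
  have := @cvg_monotone_convergence _ _ _ P setT measurableT (fun k w => (f k w)%:E) mEf.
  move=> /(_ (fun n x _ => f0 n x) (fun x _ => fmn x)) cvi.
  rewrite (_ : (\int[P]_w h w)%E = (\int[P]_w limn (fun k => (f k w)%:E))%E).
    by apply: (cvge_le _ cvi); exact: nearW.
  by apply: eq_integral => w _; apply/esym/cvg_lim.
have Ih : P.-integrable setT h.
  apply/integrableP; split => //.
  under eq_integral do rewrite gee0_abs//.
  by rewrite (le_lt_trans hV)// ltry.
have hfin := integrable_ae measurableT Ih.
pose g w := fine (h w).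
have mg : measurable_fun [set: T] g by exact: measurableT_comp.
have gh : {ae P, forall w, (g w)%:E = h w}.
  by apply: filterS hfin => w hw; rewrite fineK//; exact: hw.
have Igh : (\int[P]_w (g w)%:E = \int[P]_w h w)%E.
  apply: ae_eq_integral => //; first exact/measurable_EFinP.
  by apply: filterS gh => w -> .
have g0 w : 0 <= g w by exact: fine_ge0.
have Ig : intble P g.
  apply/integrableP; split; first exact/measurable_EFinP.
  under eq_integral do rewrite gee0_abs ?lee_fin//.
  by rewrite Igh (le_lt_trans hV)// ltry.
exists g; split => //.
  by rewrite -lee_fin EFin_Rintegral// Igh.
apply: filterS gh => w gw k; rewrite -lee_fin gw.
by apply: ereal_sup_ubound; exists k.
Qed.

Lemma monotone_limit_square (f : nat -> T -> R) (V : R) :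
  (forall k, square_intble P (f k)) -> (forall k w, 0 <= f k w) ->
  (forall k w, f k w <= f k.+1 w) ->
  (forall k, \int[P]_w (f k w ^+ 2) <= V) ->
  exists g : T -> R, [/\ square_intble P g, forall w, 0 <= g w,
    \int[P]_w (g w ^+ 2) <= V & {ae P, forall w, forall k, f k w <= g w}].
Proof.
move=> sf f0 fi fV.
have [|||k|g [Ig g0 gV fg]] := @monotone_limit_intble (fun k w => f k w ^+ 2) V.
- by move=> k; have [? _] := sf k; exact: measurable_funX.
- by move=> k w; exact: sqr_ge0.
- by move=> k w; rewrite lerXn2r ?nnegrE.
- by have [_ If] := sf k; rewrite -EFin_Rintegral// lee_fin.
exists (fun w => Num.sqrt (g w)); split.
- split; first (apply: measurableT_comp (intble_measurable Ig);
    apply: continuous_measurable_fun; exact: sqrt_continuous).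
  by under eq_fun => w do rewrite sqr_sqrtr//.
- by move=> w; exact: sqrtr_ge0.
- by under eq_Rintegral => w _ do rewrite sqr_sqrtr//.
- apply: filterS fg => w fg k; rewrite -[f k w]ger0_norm// -sqrtr_sqr.
  by rewrite ler_wsqrtr.
Qed.

End monotone_limits.

(** * Orthogonality to a sub-sigma-algebra *)

Section conditional_orthogonality.
Context (R : realType) (d : measure_display) (T : measurableType d).
Variables (P : probability T R) (G : set (set T)).
Hypotheses (sG : sigma_algebra [set: T] G) (Gsub : G `<=` measurable).

Let TG := g_sigma_algebraType G.

Lemma measurable_wrtP (f : T -> R) :
  measurable_wrt G f <-> measurable_fun [set: TG] (f : TG -> R).
Proof.
have GE : (@measurable _ TG) = G by exact: measurable_g_measurableTypeE.
split => mf; first by move=> _ B mB; rewrite setTI GE; exact: mf.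
by move=> B mB; have := mf measurableT B mB; rewrite setTI GE.
Qed.

Lemma measurable_wrt_measurable (f : T -> R) :
  measurable_wrt G f -> measurable_fun [set: T] f.
Proof. by move=> mf _ B mB; rewrite setTI; apply/Gsub/mf. Qed.

Import HBNNSimple.

(** By linearity the orthogonality to indicators of events in [G] extends to
    simple functions, then to nonnegative ones by dominated convergence. *)
Lemma Rintegral_mul_eq0 (c Y : T -> R) : square_intble P c ->
  (forall B, G B -> (\int[P]_(w in B) (c w)%:E = 0)%E) ->
  measurable_wrt G Y -> square_intble P Y -> \int[P]_w (c w * Y w) = 0.
Proof.
move=> sc c0.
have GE : (@measurable _ TG) = G by exact: measurable_g_measurableTypeE.
have Ic := square_intble_intble sc.
have indic B : G B -> intble P (fun w => c w * \1_B w) /\ \int[P]_w (c w * \1_B w) = 0.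
  move=> GB; split; first exact: intble_mul_indic (Gsub GB) Ic.
  by rewrite /Rintegral integral_mul_indic c0.
have simple (h : {nnsfun TG >-> R}) :
    intble P (fun w => c w * h w) /\ \int[P]_w (c w * h w) = 0.
  have hE w : c w * h w = \sum_(y <- finmap.enum_fset (fset_set (range h))) y * (c w * \1_(h @^-1` [set y]) w).
    rewrite [in LHS]fimfunE fsbig_finite// mulr_sumr.
    by apply: eq_bigr => y _; rewrite mulrCA.
  have Gh y : G (h @^-1` [set y]).
    suff : @measurable _ TG (h @^-1` [set y]) by move: (h @^-1` _) => B; rewrite GE.
    by rewrite -[X in measurable X]setTI; exact: measurable_funP.
  have Ih y : intble P (fun w => y * (c w * \1_(h @^-1` [set y]) w)).
    by apply: intbleZ; case: (indic _ (Gh y)).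
  split; first by under eq_fun do rewrite hE; exact: intble_sum.
  under eq_Rintegral do rewrite hE.
  rewrite Rintegral_sum// big1// => y _.
  by have [Iy y0] := indic _ (Gh y); rewrite RintegralZl// y0 mulr0.
have nonneg (Z : T -> R) : (forall w, 0 <= Z w) -> measurable_wrt G Z ->
    square_intble P Z -> \int[P]_w (c w * Z w) = 0.
  move=> Z0 GZ sZ.
  have mZ : measurable_fun [set: TG] (EFin \o Z : TG -> \bar R).
    by apply/measurable_EFinP/measurable_wrtP.
  pose h := nnsfun_approx measurableT mZ.
  have hZ w : h n w @[n --> \oo] --> Z w.
    have := @cvg_nnsfun_approx _ _ _ _ measurableT _ mZ (fun w _ => Z0 w) w I.
    by move=> /fine_cvg.
  have nh w : nondecreasing_seq (h ^~ w).
    by move=> m n mn; have := nd_nnsfun_approx measurableT mZ mn => /lefP/(_ w).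
  have hleZ n w : h n w <= Z w.
    rewrite -(cvg_lim _ (hZ w))//; apply: nondecreasing_cvgn_le => //.
    by apply/cvg_ex; exists (Z w); exact: hZ.
  have mc : measurable_fun [set: T] c by case: sc.
  have mZT := measurable_wrt_measurable GZ.
  have IcZ := intble_norm (square_intble_mul sc sZ).
  have [||||_] := @dominated_cvg _ _ _ P (fun n w => c w * h n w) (fun w => c w * Z w)
      (fun w => `|c w * Z w|) _ _ _ IcZ _.
  - move=> n; apply: measurable_funM => //; apply: measurable_wrt_measurable.
    by apply/measurable_wrtP; exact: measurable_funP.
  - exact: measurable_funM.
  - by apply: nearW => w; apply: cvgMl_tmp; exact: hZ.
  - apply: nearW => w n; rewrite !normrM ler_wpM2l// !ger0_norm//; exact: hleZ.
  rewrite (_ : (fun n => _) = fun=> 0); last first.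
    by apply/funext => n; case: (simple (h n)).
  by move=> /cvg_lim <-//; rewrite lim_cst.
move=> GY sY.
have GP : measurable_wrt G (fun w => Num.max (Y w) 0).
  by apply/measurable_wrtP; apply: measurable_funrpos; exact/measurable_wrtP.
have GN : measurable_wrt G (fun w => Num.max (- Y w) 0).
  by apply/measurable_wrtP; apply: measurable_funrneg; exact/measurable_wrtP.
have sP : square_intble P (fun w => Num.max (Y w) 0).
  apply: square_intble_le sY => [|w]; first exact: measurable_wrt_measurable.
  by rewrite maxEle; case: ifPn; rewrite ?normr0.
have sN : square_intble P (fun w => Num.max (- Y w) 0).
  apply: square_intble_le sY => [|w]; first exact: measurable_wrt_measurable.
  by rewrite maxEle; case: ifPn; rewrite ?normr0 ?normrN.
transitivity (\int[P]_w (c w * Num.max (Y w) 0 - c w * Num.max (- Y w) 0)).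
  apply: eq_Rintegral => w _; rewrite -mulrBr; congr (_ * _).
  by rewrite !maxEle oppr_le0; case: ltgtP => // [||->]; rewrite ?subr0 ?sub0r ?opprK ?oppr0.
rewrite RintegralB//; [|exact: square_intble_mul..].
by rewrite !nonneg ?subr0// => w; rewrite le_max lexx orbT.
Qed.

End conditional_orthogonality.

Lemma ae_foralln d (T : measurableType d) (R : realType) (P : probability T R)
    (Q : nat -> T -> Prop) :
  (forall n, {ae P, forall w, Q n w}) -> {ae P, forall w, forall n, Q n w}.
Proof.
move=> aQ; rewrite /almost_everywhere.
apply: negligibleS (negligible_bigcup aQ) => w /= /existsNP[n nQ].
by exists n.
Qed.

Lemma expectationE d (T : measurableType d) (R : realType) (P : probability T R)
  (f : T -> R) : ('E_P[f] = \int[P]_w (f w)%:E)%E.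
Proof. by rewrite unlock. Qed.

Lemma big_iota_recr (V : nmodType) (h : nat -> V) k :
  \sum_(j <- iota 0 k.+1) h j = \sum_(j <- iota 0 k) h j + h k.
Proof. by rewrite -addn1 iotaD big_cat/= big_seq1. Qed.

(** * Doob's maximal inequality *)

Section running_maximum.
Context (R : realType).
Implicit Types (x : nat -> R) (n : nat).

Fixpoint running_max x n : R :=
  if n is k.+1 then Num.max (running_max x k) (x k.+1) else x 0%N.

Lemma running_max_ge x i n : (i <= n)%N -> x i <= running_max x n.
Proof.
elim: n => [|n IH]; first by rewrite leqn0 => /eqP ->.
rewrite leq_eqVlt => /orP[/eqP -> /=|]; first by rewrite le_max lexx orbT.
by rewrite ltnS => /IH /= H; rewrite le_max H.
Qed.

Lemma running_max_le x n a : (forall i, (i <= n)%N -> x i <= a) ->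
  running_max x n <= a.
Proof.
elim: n => [|n IH] H /=; first exact: H.
by rewrite ge_max H// IH// => i ni; rewrite H// leqW.
Qed.

(** The pathwise form of Doob's inequality: when the running maximum [m]
    increases, it equals [x], so that [m_(i+1)^2 - m_i^2] is at most
    [2 x_(i+1) (m_(i+1) - m_i)]; summation by parts does the rest. *)
Lemma running_max_sqr_le x n : (forall i, 0 <= x i) ->
  running_max x n ^+ 2 <= 2 * (x n * running_max x n) -
    2 * \sum_(i < n) running_max x i * (x i.+1 - x i).
Proof.
move=> x0; elim: n => [|n IH].
  by rewrite big_ord0 /=; have := x0 0%N; nra.
rewrite big_ord_recr /=; move: IH; set S := \sum_(i < n) _; set m := running_max x n.
have m0 : 0 <= m by rewrite (le_trans (x0 0%N))// running_max_ge.
set y := x n.+1; set z := x n => IH.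
have ym := sqr_ge0 (y - m).
by rewrite maxEle; case: ifPn => _; nra.
Qed.

End running_maximum.

Section doob.
Context (R : realType) (d : measure_display) (T : measurableType d).
Variables (P : probability T R) (G : nat -> set (set T)) (X : nat -> T -> R).
Hypotheses (sG : forall i, sigma_algebra [set: T] (G i))
  (Gsub : forall i, G i `<=` measurable) (Gmono : forall i, G i `<=` G i.+1)
  (GX : forall i, measurable_wrt (G i) (X i))
  (sX : forall i, square_intble P (X i))
  (mart : forall i B, G i B ->
    (\int[P]_(w in B) (X i.+1 w - X i w)%:E = 0)%E).

Let m i w := running_max (fun j => `|X j w|) i.

Lemma running_max_ge0 i w : 0 <= m i w.
Proof. by rewrite (le_trans _ (@running_max_ge _ _ 0 i _)) ?normr_ge0. Qed.

Lemma measurable_wrt_running_max i : measurable_wrt (G i) (m i).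
Proof.
elim: i => [|i IH].
  apply/(measurable_wrtP (sG 0)); apply: measurableT_comp => //.
  by apply/(measurable_wrtP (sG 0)); exact: GX.
apply/(measurable_wrtP (sG i.+1)); apply: measurable_maxr.
  by apply/(measurable_wrtP (sG i.+1)) => B mB; apply: Gmono; exact: IH.
apply: measurableT_comp => //.
by apply/(measurable_wrtP (sG i.+1)); exact: GX.
Qed.

Lemma square_intble_running_max i : square_intble P (m i).
Proof.
apply: (@square_intble_le _ _ _ _ _ (fun w => \sum_(j <- iota 0 i.+1) `|X j w|)).
- exact: (measurable_wrt_measurable (@Gsub i) (measurable_wrt_running_max i)).
- move=> w; rewrite ger0_norm ?running_max_ge0// ger0_norm; last exact: sumr_ge0.
  apply: running_max_le => j ji.
  have jin : j \in iota 0 i.+1 by rewrite mem_iota.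
  by rewrite (bigD1_seq j jin (iota_uniq _ _)) lerDl sumr_ge0.
- apply: square_intble_sum => j; have [mX _] := sX j.
  by apply: square_intble_le (sX j) => [|w]; [exact: measurableT_comp|rewrite normr_id].
Qed.

(** Integrating the pathwise inequality for [|X|], whose increments are at least
    those of [X] times the sign of [X]; the latter are orthogonal to the past. *)
Lemma doob_L2 n : \int[P]_w (m n w ^+ 2) <= 4 * \int[P]_w (X n w ^+ 2).
Proof.
pose sg i w : R := if 0 <= X i w then 1 else -1.
have sgX i w : sg i w * X i w = `|X i w|.
  by rewrite /sg; case: ger0P; rewrite ?mul1r ?mulN1r.
have sgle i w y : sg i w * y <= `|y|.
  by rewrite /sg; case: ifP => _; rewrite ?mul1r ?mulN1r ?ler_norm// -normrN ler_norm.
have sgn i w : `|sg i w| = 1 by rewrite /sg; case: ifP; rewrite ?normrN normr1.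
have Gsg i : measurable_wrt (G i) (sg i).
  apply/(measurable_wrtP (sG i)).
  apply: measurable_fun_ifT => //.
  apply: measurable_fun_ler => //; exact/measurable_wrtP.
have Gms i : measurable_wrt (G i) (fun w => m i w * sg i w).
  apply/(measurable_wrtP (sG i)); apply: measurable_funM; apply/(measurable_wrtP (sG i)) => //.
  exact: measurable_wrt_running_max.
have sms i : square_intble P (fun w => m i w * sg i w).
  apply: square_intble_le (square_intble_running_max i).
    exact: (measurable_wrt_measurable (@Gsub i) (Gms i)).
  by move=> w; rewrite normrM sgn mulr1.
have sD i := square_intbleB (sX i.+1) (sX i).
have orth i : \int[P]_w ((X i.+1 w - X i w) * (m i w * sg i w)) = 0.
  by apply: (Rintegral_mul_eq0 (sG i) (@Gsub i)) => // B GB; exact: mart.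
pose D w := \sum_(i <- index_iota 0 n) (X i.+1 w - X i w) * (m i w * sg i w).
have ID i : intble P (fun w => (X i.+1 w - X i w) * (m i w * sg i w)).
  exact: square_intble_mul.
have path w : m n w ^+ 2 <= 2 * (`|X n w| * m n w) - 2 * D w.
  apply: (le_trans (running_max_sqr_le n (fun i => normr_ge0 (X i w)))).
  rewrite lerD2l lerN2 ler_pM2l// /D big_mkord.
  apply: ler_sum => i _; rewrite mulrCA ler_wpM2l ?running_max_ge0//.
  by rewrite mulrC mulrBr sgX lerD2r sgle.
have path' w : m n w ^+ 2 <= 4 * X n w ^+ 2 - 4 * D w.
  have := path w; rewrite -(real_normK (num_real (X n w))).
  have := running_max_ge0 n w; rewrite -/(m n w).
  set a := `|_|; set b := m n w; set c := D w => b0 H.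
  by have := sqr_ge0 (b - 2 * a); nra.
have I1 : intble P (fun w => 4 * X n w ^+ 2) by apply: intbleZ; case: (sX n).
have I2 : intble P (fun w => 4 * D w) by apply: intbleZ; exact: intble_sum.
apply: (@le_trans _ _ (\int[P]_w (4 * X n w ^+ 2 - 4 * D w))).
  apply: le_Rintegral => //; last exact: intbleB.
  by case: (square_intble_running_max n).
rewrite RintegralB// RintegralZl//; last by case: (sX n).
rewrite RintegralZl//; last exact: intble_sum.
by rewrite Rintegral_sum// big1 ?mulr0 ?subr0.
Qed.

End doob.

(** * Martingales bounded in the space of square integrable functions *)

Section L2_martingale.
Context (R : realType) (d : measure_display) (T : measurableType d).
Variables (P : probability T R) (F : R -> set (set T)) (M : R -> T -> R).
Hypotheses (uF : usual_filtration P F) (martM : martingale P F M)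
  (M_L2 : L2_bounded P M).

Let sF t : 0 <= t -> sigma_algebra [set: T] (F t).
Proof. exact: (filtration_sigma_algebra uF). Qed.

Let FM t : 0 <= t -> measurable_wrt (F t) (M t).
Proof. by case: martM => + _ _ _; apply. Qed.

Lemma martingale_measurable t : 0 <= t -> measurable_fun [set: T] (M t).
Proof. by move=> t0; exact: (measurable_wrt_measurable (filtration_sub uF t0) (FM t0)). Qed.

Lemma martingale_square_intble t : 0 <= t -> square_intble P (M t).
Proof.
move=> t0; split; first exact: martingale_measurable.
have [C HC] := M_L2.
apply/integrableP; split.
  by apply/measurable_EFinP/measurable_funX; exact: martingale_measurable.
under eq_integral => w _ do rewrite /= ger0_norm ?sqr_ge0//.
by have := HC t t0; rewrite expectationE => /le_lt_trans; apply; rewrite ltry.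
Qed.

Lemma martingale_increment_eq0 s t B : 0 <= s -> s <= t -> F s B ->
  (\int[P]_(w in B) (M t w - M s w)%:E = 0)%E.
Proof.
move=> s0 st FB; have mB := filtration_sub uF s0 FB.
have [_ _ IM /(_ _ _ s0 st)[_ _ /(_ _ FB) E]] := martM.
have It := integrableS measurableT mB (@subsetT _ B) (IM _ (le_trans s0 st)).
have Is := integrableS measurableT mB (@subsetT _ B) (IM _ s0).
by rewrite integralB_EFin//= -E subee// integrable_fin_num.
Qed.

(** An increment of [M] after [s] is orthogonal to the past of [s]. *)
Lemma martingale_orthogonal s t Y : 0 <= s -> s <= t ->
  measurable_wrt (F s) Y -> square_intble P Y ->
  \int[P]_w (M t w * Y w) = \int[P]_w (M s w * Y w).
Proof.
move=> s0 st FY sY.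
have sMt := martingale_square_intble (le_trans s0 st).
have sMs := martingale_square_intble s0.
apply/eqP; rewrite -subr_eq0 -RintegralB//; [|exact: square_intble_mul..].
under eq_Rintegral do rewrite -mulrBl.
apply/eqP; apply: (Rintegral_mul_eq0 (sF s0) (filtration_sub uF s0)) => //.
  exact: square_intbleB.
by move=> B FB; exact: martingale_increment_eq0.
Qed.

Let e t := \int[P]_w (M t w ^+ 2).

Lemma martingale_increment_sqr s t : 0 <= s -> s <= t ->
  \int[P]_w ((M t w - M s w) ^+ 2) = e t - e s.
Proof.
move=> s0 st.
have sMt := martingale_square_intble (le_trans s0 st).
have sMs := martingale_square_intble s0.
have H := martingale_orthogonal s0 st (FM s0) sMs.
have E w : (M t w - M s w) ^+ 2 = M t w ^+ 2 - (2 * (M t w * M s w) - M s w ^+ 2) by ring.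
under eq_Rintegral do rewrite E.
have I1 := square_intble_mul sMt sMs.
rewrite RintegralB//; last 2 first.
- by case: sMt.
- by apply: intbleB; [exact: intbleZ|case: sMs].
rewrite RintegralB//; last 2 first.
- exact: intbleZ.
- by case: sMs.
rewrite RintegralZl// H /e.
under [X in 2 * X]eq_Rintegral do rewrite -expr2.
ring.
Qed.

Lemma martingale_sqr_bounded : exists C, forall t, 0 <= t -> e t <= C.
Proof.
have [C HC] := M_L2; exists C => t t0.
have [_ I2] := martingale_square_intble t0.
by rewrite -lee_fin EFin_Rintegral//; have := HC t t0; rewrite expectationE.
Qed.

(** Doob's inequality for the increments after a time [a], first along dyadic
    grids of finer and finer mesh and longer and longer span, then for all
    times by right-continuity of the paths. *)
Lemma martingale_sup a V : 0 <= a -> (forall t, a <= t -> e t - e a <= V) ->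
  exists S : T -> R, [/\ square_intble P S, forall w, 0 <= S w,
    \int[P]_w (S w ^+ 2) <= 4 * V &
    {ae P, forall w, forall t, a <= t -> `|M t w - M a w| <= S w}].
Proof.
move=> a0 HV.
(* Grid [k] consists of [4^k] cells of length [2^-k], hence ends at [a + 2^k]. *)
pose g k i : R := a + i%:R / 2 ^+ k.
have ag k i : a <= g k i by rewrite lerDl divr_ge0// exprn_ge0.
have g0 k i : 0 <= g k i by exact: le_trans (ag k i).
have gi k i : g k i <= g k i.+1.
  by rewrite lerD2l ler_pM2r ?invr_gt0 ?exprn_gt0// ler_nat.
pose X k i w := M (g k i) w - M a w.
pose f k w := running_max (fun j => `|X k j w|) (4 ^ k).
have sX k i : square_intble P (X k i).
  by apply: square_intbleB; exact: martingale_square_intble.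
have FX k i : measurable_wrt (F (g k i)) (X k i).
  apply/(measurable_wrtP (sF (g0 k i))); apply: measurable_funB.
    by apply/(measurable_wrtP (sF (g0 k i))); exact: FM.
  apply/(measurable_wrtP (sF (g0 k i))) => B mB.
  by apply: (filtration_nondecreasing uF a0 (ag k i)); exact: FM.
have Fsub k i : F (g k i) `<=` measurable by apply: (filtration_sub uF).
have Fmono k i : F (g k i) `<=` F (g k i.+1).
  by apply: (filtration_nondecreasing uF (g0 k i) (gi k i)).
have FX0 k i B : F (g k i) B ->
    (\int[P]_(w in B) (X k i.+1 w - X k i w)%:E = 0)%E.
  move=> FB; rewrite -(martingale_increment_eq0 (g0 k i) (gi k i) FB).
  by apply: eq_integral => w _; congr (_%:E); rewrite /X; ring.
have [|||k|S [sS S0 SV fS]] := @monotone_limit_square _ _ _ P f (4 * V).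
- by move=> k; apply: (square_intble_running_max (G := fun i => F (g k i))) => // i; exact: sF.
- by move=> k w; exact: running_max_ge0.
- move=> k w; apply: running_max_le => i ik.
  have -> : X k i w = X k.+1 (2 * i)%N w.
    rewrite /X /g natrM exprS invfM mulrA.
    by rewrite (_ : 2 * i%:R / 2 = i%:R)// mulrAC mulfV ?mul1r.
  apply: (running_max_ge (fun j => `|X k.+1 j w|)).
  by rewrite expnS (@leq_trans (2 * 4 ^ k))// ?leq_mul// leq_pmul2r ?expn_gt0.
- have := @doob_L2 _ _ _ P (fun i => F (g k i)) (X k) (fun i => sF (g0 k i)) (Fsub k)
    (Fmono k) (FX k) (sX k) (FX0 k) (4 ^ k)%N.
  move=> /le_trans; apply; rewrite ler_pM2l//.
  by rewrite martingale_increment_sqr// HV.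
exists S; split => //; apply: filterS fS => w fS t at_.
have [_ cM _ _] := martM.
have ta0 : 0 <= t - a by rewrite subr_ge0.
have cv : M (a + dyadic_up k (t - a)) w @[k --> \oo] --> M t w.
  apply: cadlag_cvg_from_right => //; first exact: le_trans at_.
    by move=> n; rewrite -ltrBlDl dyadic_up_gt.
  rewrite [X in _ --> X](_ : t = a + (t - a)); last by rewrite addrC subrK.
  by apply: cvgD; [exact: cvg_cst|exact: cvg_dyadic_up].
have cv' : `|M (a + dyadic_up k (t - a)) w - M a w| @[k --> \oo] --> `|M t w - M a w|.
  by apply: cvg_norm; apply: cvgB => //; exact: cvg_cst.
apply: (cvgr_to_le cv'); near=> k; apply: le_trans (fS k).
apply: (running_max_ge (fun j => `|X k j w|)).
rewrite -(@ler_nat R) natrX.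
have : dyadic_up k (t - a) <= 2 ^+ k.
  apply: (le_trans (dyadic_up_le k ta0)).
  apply: (@le_trans _ _ (t - a + 1)).
    by rewrite lerD2l exprn_ile1// ?invr_ge0// invf_le1// ler1n.
  apply: (@le_trans _ _ k%:R); last by rewrite -natrX ler_nat ltnW// ltn_expl.
  near: k; exact: nbhs_infty_ger.
rewrite /dyadic_up ler_pdivrMr ?exprn_gt0// -expr2 -exprM mulnC exprM.
by rewrite -[2 ^+ 2]natrX.
Unshelve. all: by end_near. Qed.

Lemma martingale_maximal : exists S : T -> R, [/\ square_intble P S,
  forall w, 0 <= S w & {ae P, forall w, forall t, 0 <= t -> `|M t w| <= S w}].
Proof.
have [C HC] := martingale_sqr_bounded.
have e0 t : 0 <= e t by apply: Rintegral_ge0 => w _; exact: sqr_ge0.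
have [t t0|S [sS S0 _ MS]] := @martingale_sup 0 C (lexx 0).
  by rewrite lerBlDr (le_trans (HC t t0))// lerDl.
have sM := martingale_square_intble (lexx 0).
exists (fun w => S w + `|M 0 w|); split.
- apply: square_intbleD => //; apply: square_intble_le sM => [|w].
    by apply: measurableT_comp => //; exact: martingale_measurable.
  by rewrite normr_id.
- by move=> w; rewrite addr_ge0.
- apply: filterS MS => w MS t t0.
  by rewrite -[M t w](subrK (M 0 w)) (le_trans (ler_normD _ _))// lerD2r MS.
Qed.

(** The increments after [a_j] are dominated by [S_j] with [E S_j^2] summable, so
    that [S_j] is almost surely small for some [j]: paths are Cauchy. *)
Lemma martingale_cvg : {ae P, forall w, cvg (M t w @[t --> +oo%R])}.
Proof.
have [C HC] := martingale_sqr_bounded.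
pose E := [set e t | t in [set t | 0 <= t]].
have sE : has_sup E.
  by split; [exists (e 0), 0 => /=|exists C => _ [t t0 <-]; exact: HC].
have /choice[a Ha] : forall j : nat, exists a, 0 <= a /\
    forall t, a <= t -> e t - e a <= 2^-1 ^+ j.
  move=> j; have [_ [a a0 <-] lt] := sup_adherent (exprn_gt0 j (ltac:(by rewrite invr_gt0) : 0 < 2^-1 :> R)) sE.
  exists a; split => // t at_; rewrite lerBlDr.
  rewrite -lerBlDl; apply/ltW/(le_lt_trans _ lt); rewrite lerB//.
  by apply: ub_le_sup; [case: sE|exists t => //=; exact: le_trans at_].
have /choice[S HS] : forall j, exists S : T -> R, [/\ square_intble P S, forall w, 0 <= S w,
    \int[P]_w (S w ^+ 2) <= 4 * 2^-1 ^+ j &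
    {ae P, forall w, forall t, a j <= t -> `|M t w - M (a j) w| <= S w}].
  by move=> j; have [a0 aj] := Ha j; exact: martingale_sup.
pose f k w := \sum_(j <- iota 0 k) S j w ^+ 2.
have I2 j : intble P (fun w => S j w ^+ 2) by have [[_ ?] _ _ _] := HS j.
have If k : intble P (f k) by exact: intble_sum.
have [|||k|g [_ _ _ fg]] := @monotone_limit_intble _ _ _ P f 8.
- by move=> k; exact: intble_measurable.
- by move=> k w; apply: sumr_ge0 => j _; exact: sqr_ge0.
- by move=> k w; rewrite /f big_iota_recr lerDl sqr_ge0.
- rewrite -EFin_Rintegral// lee_fin Rintegral_sum//.
  suff : \sum_(j <- iota 0 k) \int[P]_w (S j w ^+ 2) <= 8 * (1 - 2^-1 ^+ k).
    move=> /le_trans; apply; rewrite ler_piMr// gerBl exprn_ge0//.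
  elim: k => [|k IH]; first by rewrite big_nil expr0 subrr mulr0.
  rewrite big_iota_recr exprS.
  have [_ _ Sk _] := HS k.
  by move: IH Sk; set q := 2^-1 ^+ k; lra.
have aS : {ae P, forall w, forall j, forall t, a j <= t -> `|M t w - M (a j) w| <= S j w}.
  apply: ae_foralln => j; by have [_ _ _] := HS j.
apply: filterS2 fg aS => w fg aS.
apply: cauchy_cvg; apply: cauchy_exP => eps eps0.
have [j Sj] : exists j, S j w < eps.
  apply: contrapT => /forallNP nS.
  have fk k : k%:R * eps ^+ 2 <= g w.
    apply: le_trans (fg k); rewrite /f.
    elim: k => [|k IH]; first by rewrite mul0r big_nil.
    rewrite big_iota_recr -natr1 mulrDl mul1r lerD//.
    have := nS k; move/negP; rewrite -leNgt => eS.
    by rewrite lerXn2r ?nnegrE// ?ltW// (lt_le_trans eps0).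
  have e2 : 0 < eps ^+ 2 by rewrite exprn_gt0.
  have := fk (Num.trunc (g w / eps ^+ 2)).+1.
  by apply/negP; rewrite -ltNge -ltr_pdivrMr// truncnS_gt.
exists (M (a j) w); exists (a j); split; first exact: num_real.
move=> t at_ /=; rewrite /ball/= distrC (le_lt_trans _ Sj)// aS// ltW//.
Qed.

End L2_martingale.

(** * Stieltjes integrals along one increasing path *)

Section nonmeasurable.
Context (R : realType) (d : measure_display) (T : measurableType d).
Variable mu : {measure set T -> \bar R}.

(** The integral of a nonnegative function is a supremum over simple functions,
    hence monotone even without measurability. *)
Lemma ge0_le_integral_sup (D : set T) (f g : T -> \bar R) :
  (forall w, D w -> 0 <= f w)%E -> (forall w, D w -> f w <= g w)%E ->
  (\int[mu]_(w in D) f w <= \int[mu]_(w in D) g w)%E.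
Proof.
move=> f0 fg.
have g0 w : D w -> (0 <= g w)%E by move=> Dw; exact: le_trans (f0 w Dw) (fg w Dw).
rewrite !ge0_integralE//; apply: le_ereal_sup => _ [h /= hf <-].
exists h => // w; apply: le_trans (hf w) _; rewrite !patchE; case: ifPn => //.
by rewrite inE; exact: fg.
Qed.

Lemma ge_integral_subset (D E : set T) (g : T -> R) : measurable D -> measurable E ->
  E `<=` D -> (forall w, D w -> 0 <= g w) -> (forall w, E w -> 1 <= g w) ->
  (mu E <= \int[mu]_(w in D) (g w)%:E)%E.
Proof.
move=> mD mE ED g0 Eg.
rewrite -[in leLHS](setIidl ED) -(integral_indic mu mD mE).
apply: ge0_le_integral_sup => w Dw; rewrite lee_fin; first by rewrite indicE.
rewrite indicE; case: (boolP (w \in E)) => [|_]; rewrite ?inE; [exact: Eg|exact: g0].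
Qed.

End nonmeasurable.

Section increasing_path.
Context (R : realType) (f : cumulative R R).
Hypothesis f_neg : forall t, t < 0 -> f t = 0.

Let mu : {measure set (measurableTypeR R) -> \bar R} := lebesgue_stieltjes_measure f.

Lemma path_le s t : s <= t -> f s <= f t.
Proof. exact: cumulative_is_nondecreasing. Qed.

Lemma path_ge0 t : 0 <= f t.
Proof.
have [t0|t0] := ltP t 0; first by rewrite f_neg.
by rewrite -(f_neg (ltrN10 R)) path_le// (le_trans _ t0)// lerN10.
Qed.

Lemma stieltjes_oc a b : a <= b -> mu `]a, b]%classic = (f b - f a)%:E.
Proof.
move=> ab; rewrite /mu/= /lebesgue_stieltjes_measure /measure_extension/=.
by rewrite measurable_mu_extE/= ?wlength_itv_bnd//; exact: is_ocitv.
Qed.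

Lemma stieltjes_0c t : 0 <= t -> mu `[0, t]%classic = (f t)%:E.
Proof.
move=> t0.
have neg0 : mu `]-1, 0[%classic = 0%E.
  have -> : `]-1, 0[%classic = \bigcup_n `](-1 : R), - n.+1%:R^-1]%classic.
    apply/seteqP; split => x /=; rewrite in_itv/=.
      move=> /andP[x1 x0].
      near \oo => n; exists n => //=; rewrite in_itv/= x1/= lerNr; apply/ltW; near: n.
      by apply: (near_infty_natSinv_lt (PosNum (_ : 0 < - x))); rewrite oppr_gt0.
    move=> [n _] /=; rewrite in_itv/= => /andP[-> /le_lt_trans]; apply.
    by rewrite oppr_lt0 invr_gt0.
  apply: measure_negligible; first by apply: bigcupT_measurable => n; exact: measurable_itv.
  apply: negligible_bigcup => n; apply/negligibleP; first exact: measurable_itv.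
  have n1 : - n.+1%:R^-1 < 0 :> R by rewrite oppr_lt0 invr_gt0.
  change (mu `]-1, - n.+1%:R^-1]%classic = 0%E).
  by rewrite stieltjes_oc ?f_neg ?subrr// lerN2 invf_le1 ?ler1n.
have <- : mu `]-1, t]%classic = (f t)%:E.
  rewrite stieltjes_oc; first by rewrite (f_neg (ltrN10 R)) subr0.
  by rewrite (le_trans _ t0)// lerN10.
have -> : `]-1, t]%classic = `]-1, 0[%classic `|` `[0, t]%classic :> set R.
  apply/seteqP; split => x /=; rewrite !in_itv/=.
    by move=> /andP[x1 xt]; case: (ltP x 0) => x0; [left; rewrite x1|right].
  move=> [/andP[-> x0]|/andP[x0 ->]]; first exact: le_trans (ltW x0) t0.
  by rewrite (lt_le_trans (ltrN10 R)).
have E : mu (`]-1, 0[%classic `|` `[0, t]%classic) =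
    (mu `](-1)%R, 0%R[%classic + mu `[0%R, t]%classic)%E.
  apply: measureU; [exact: measurable_itv|exact: measurable_itv|].
  by apply/seteqP; split => // x [] /=; rewrite !in_itv/= => /andP[_ x0] /andP[]; rewrite leNgt x0.
by rewrite E neg0 add0e.
Unshelve. all: by end_near. Qed.

Lemma stieltjes_total : (f n%:R)%:E @[n --> \oo] --> mu `[0, +oo[%classic.
Proof.
have -> : `[0, +oo[%classic = \bigcup_n `[0, n%:R]%classic :> set R.
  apply/seteqP; split => x /=; rewrite in_itv/=; last by move=> [n _] /=; rewrite in_itv/= => /andP[->].
  rewrite andbT => x0; exists (Num.trunc x).+1 => //=; rewrite in_itv/= x0/= ltW// truncnS_gt//.
have : mu `[0, n%:R]%classic @[n --> \oo] --> mu (\bigcup_n `[0, n%:R]%classic).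
  apply: nondecreasing_cvg_mu => //.
  - exact: bigcupT_measurable.
  - by move=> m n mn; apply/subsetPset/subset_itvl; rewrite bnd_simp ler_nat.
apply: cvg_trans; apply: near_eq_cvg; apply: nearW => n.
by rewrite stieltjes_0c.
Qed.

Hypothesis f_fin : (mu `[0%R, +oo[%classic < +oo)%E.

Definition path_total : R := fine (mu `[0, +oo[%classic).

Lemma path_totalE : mu `[0, +oo[%classic = path_total%:E.
Proof. by rewrite fineK// ge0_fin_numE. Qed.

Lemma path_le_total t : f t <= path_total.
Proof.
rewrite -lee_fin -path_totalE.
apply: (@le_trans _ _ (f (Num.max t 0))%:E); first by rewrite lee_fin path_le// le_max lexx.
rewrite -stieltjes_0c ?le_max ?lexx ?orbT//.
by apply: le_measure; rewrite ?inE//; exact: subset_itvl.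
Qed.

Lemma cvg_path_total : f t @[t --> +oo%R] --> path_total.
Proof.
have ub : has_ubound (range f) by exists path_total => _ [t _ <-]; exact: path_le_total.
have cv : f t @[t --> +oo%R] --> sup (range f).
  by apply: nondecreasing_cvgr => //; exact: path_le.
rewrite [X in _ --> X](_ : _ = sup (range f))//.
have c1 : f n%:R @[n --> \oo] --> path_total.
  by have := stieltjes_total; rewrite path_totalE => /fine_cvg.
have c2 : f n%:R @[n --> \oo] --> sup (range f).
  by apply: (cvg_comp _ _ _ cv); exact: cvgr_idn.
exact: cvg_unique c1 c2.
Qed.

Lemma stieltjes_oy t : 0 <= t -> mu `]t, +oo[%classic = (path_total - f t)%:E.
Proof.
move=> t0.
have E : mu (`[0%R, t]%classic `|` `]t, +oo[%classic) =
    (mu `[0%R, t]%classic + mu `]t, +oo[%classic)%E.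
  apply: measureU; [exact: measurable_itv|exact: measurable_itv|].
  by apply/seteqP; split => // x [] /=; rewrite !in_itv/= andbT => /andP[_ xt]; rewrite ltNge xt.
have : mu `[0, +oo[%classic = (mu `[0%R, t]%classic + mu `]t, +oo[%classic)%E.
  rewrite -E.
    congr (mu _); apply/seteqP; split => x /=; rewrite !in_itv/= ?andbT.
      by move=> x0; case: (leP x t) => xt; [left; rewrite x0|right].
    by move=> [/andP[]//|/ltW]; exact: le_trans.
rewrite path_totalE stieltjes_0c//.
case: (mu `]t, +oo[%classic) => [r||]// [E']; congr (_%:E); lra.
Qed.

Lemma stieltjes_jump s e : 0 <= s ->
  (forall n : nat, e <= f s - f (s - n.+1%:R^-1)) -> (e%:E <= mu [set s])%E.
Proof.
move=> s0 He.
have -> : [set s] = \bigcap_n `]s - n.+1%:R^-1, s]%classic.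
  apply/seteqP; split => x.
    by move=> -> n _ /=; rewrite in_itv/= lexx andbT ltrBlDr ltrDl invr_gt0.
  move=> H; have : x <= s by have := H 0%N I; rewrite /= in_itv/= => /andP[].
  rewrite le_eqVlt => /orP[/eqP//|xs]; exfalso.
  near \oo => n; have := H n I; rewrite /= in_itv/= => /andP[+ _].
  apply/negP; rewrite -leNgt lerBrDl -lerBrDr; apply/ltW; near: n.
  by apply: (near_infty_natSinv_lt (PosNum (_ : 0 < s - x))); rewrite subr_gt0.
have cv : mu `]s - n.+1%:R^-1, s]%classic @[n --> \oo] --> mu (\bigcap_n `]s - n.+1%:R^-1, s]%classic).
  apply: (nonincreasing_cvg_mu (mu := mu)) => //.
  - rewrite stieltjes_oc ?ltry//.
    by rewrite lerBlDr lerDl.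
  - by apply: bigcapT_measurable => n; exact: measurable_itv.
  - move=> m n mn; apply/subsetPset => x /=; rewrite !in_itv/= => /andP[nx ->].
    by rewrite andbT (le_lt_trans _ nx)// lerD2l lerN2 lef_pV2 ?posrE// ler_nat.
apply: (cvge_ge _ cv); apply: nearW => n.
by rewrite stieltjes_oc ?lee_fin// lerBlDr lerDl.
Unshelve. all: by end_near. Qed.

(** Without jumps, the path takes each value up to its total, so that the times
    at which it exceeds [x] have mass [(total - x)^+]. *)
Lemma stieltjes_above x : 0 <= x ->
  (forall s e, 0 <= s -> 0 < e -> exists n : nat, f s - f (s - n.+1%:R^-1) < e) ->
  mu [set s | 0 <= s /\ x < f s] = (Num.max (path_total - x) 0)%:E.
Proof.
move=> x0 cont.
set U := [set s | 0 <= s /\ x < f s].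
have [U0|/set0P[u Uu]] := eqVneq U set0.
  rewrite U0 measure0; congr (_%:E); apply/esym/max_idPr.
  rewrite subr_le0; apply: (cvgr_to_le cvg_path_total).
  near=> t; have t0 : 0 <= t by near: t; exact: nbhs_pinfty_ge.
  rewrite leNgt; apply/negP => xt; have : U t by [].
  by rewrite U0.
have lbU : has_lbound U by exists 0 => s [].
have iU : has_inf U by split => //; exists u.
pose tau := inf U.
have tau0 : 0 <= tau by apply: lb_le_inf; [exists u|move=> s []].
have Uafter s : tau < s -> U s.
  move=> ts; have [v [v0 xv] vs] := inf_lt iU.1 ts.
  by split; [exact: le_trans (ltW vs)|exact: lt_le_trans (path_le (ltW vs))].
have fge : x <= f tau.
  have rc := cumulative_is_right_continuous f tau.
  apply: (cvgr_to_ge rc); near=> s.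
  by apply/ltW; have [] : U s by apply: Uafter; near: s; exact: nbhs_right_gt.
have fle : f tau <= x.
  apply/ler_addgt0Pr => e e0; have [n Hn] := cont tau e tau0 e0.
  have : f (tau - n.+1%:R^-1) <= x; last by move: Hn; lra.
  have [t0|t0] := ltP (tau - n.+1%:R^-1) 0; first by rewrite f_neg.
  rewrite leNgt; apply/negP => xf; have : U (tau - n.+1%:R^-1) by [].
  move=> /(ge_inf lbU); rewrite -/tau leNgt => /negP; apply.
  by rewrite ltrBlDr ltrDl invr_gt0.
have fx : f tau = x by apply/eqP; rewrite eq_le fle fge.
have -> : U = `]tau, +oo[%classic.
  apply/seteqP; split => s /=; rewrite in_itv/= andbT; last exact: Uafter.
  by move=> [s0 xs]; rewrite ltNge; apply/negP => st; move: (path_le st); rewrite fx leNgt xs.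
rewrite stieltjes_oy// fx; congr (_%:E); apply/esym/max_idPl.
by rewrite subr_ge0 -fx path_le_total.
Unshelve. all: by end_near. Qed.

Lemma dyadic_cell_oc n (s : R) : 0 < s ->
  exists i : nat, i%:R / 2 ^+ n < s <= i.+1%:R / 2 ^+ n.
Proof.
move=> s0.
have ex : exists k : nat, s * 2 ^+ n <= k%:R.
  by exists (Num.trunc (s * 2 ^+ n)).+1; rewrite ltW// truncnS_gt.
case: (ex_minnP ex) => -[|k] Hk min.
  by exfalso; move: Hk; apply/negP; rewrite -ltNge mulr_gt0// exprn_gt0.
exists k; rewrite ltr_pdivrMr ?exprn_gt0// ler_pdivlMr ?exprn_gt0// Hk andbT ltNge.
by apply/negP => /min; rewrite ltnn.
Qed.

Variables (X : R -> R) (K : R).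
Hypotheses (Xr : forall t, 0 <= t -> X s @[s --> t^'+] --> X t)
  (XK : forall t, 0 <= t -> `|X t| <= K).

(** The grid has mesh [2^-n] and ends at [2^n]. The first term accounts for the
    mass at [0]. *)
Definition stieltjes_sum n : R := X 0 * f 0 +
  \sum_(0 <= i < 4 ^ n) X (i.+1%:R / 2 ^+ n) * (f (i.+1%:R / 2 ^+ n) - f (i%:R / 2 ^+ n)).

Lemma stieltjes_sum_le n : `|stieltjes_sum n| <= K * path_total.
Proof.
have g0 i : 0 <= i%:R / 2 ^+ n :> R by rewrite divr_ge0// exprn_ge0.
have gi i : i%:R / 2 ^+ n <= i.+1%:R / 2 ^+ n :> R.
  by rewrite ler_pM2r ?invr_gt0 ?exprn_gt0// ler_nat.
have K0 : 0 <= K := le_trans (normr_ge0 _) (XK (lexx 0)).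
apply: (@le_trans _ _ (K * f 0 + \sum_(0 <= i < 4 ^ n)
    K * (f (i.+1%:R / 2 ^+ n) - f (i%:R / 2 ^+ n)))).
  apply: (le_trans (ler_normD _ _)); apply: lerD.
    by rewrite normrM (ger0_norm (path_ge0 0)) ler_wpM2r ?path_ge0// XK.
  apply: (le_trans (ler_norm_sum _ _ _)); apply: ler_sum => i _.
  by rewrite normrM [X in _ * X]ger0_norm ?subr_ge0 ?path_le// ler_wpM2r ?subr_ge0 ?path_le// XK.
rewrite -mulr_sumr -mulrDr ler_wpM2l// telescope_sumr// mul0r addrC subrK.
exact: path_le_total.
Qed.

(** Right-endpoint Riemann sums of a right-continuous function converge to its
    Stieltjes integral, by dominated convergence. *)
Lemma cvg_stieltjes_sum :
  (stieltjes_sum n)%:E @[n --> \oo] --> (\int[mu]_(s in `[0%R, +oo[) (X s)%:E)%E.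
Proof.
pose D : set R := `[0, +oo[%classic.
have mD : measurable D by exact: measurable_itv.
pose c n i : set R := `]i%:R / 2 ^+ n, i.+1%:R / 2 ^+ n]%classic.
pose Z n s : R := X 0 * \1_[set 0] s +
  \sum_(0 <= i < 4 ^ n) X (i.+1%:R / 2 ^+ n) * \1_(c n i) s.
have c0 n i : ~ c n i 0.
  by rewrite /c/= in_itv/= ltNge divr_ge0// exprn_ge0.
have Z0 n : Z n 0 = X 0.
  rewrite /Z indicE mem_set// mulr1 big1 ?addr0// => i _.
  by rewrite indicE memNset ?mulr0.
have Zc n i s : (i < 4 ^ n)%N -> 0 < s -> c n i s -> Z n s = X (i.+1%:R / 2 ^+ n).
  move=> iN s0 cs; rewrite /Z indicE memNset; last by move=> /= s_0; move: s0; rewrite s_0 ltxx.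
  rewrite mulr0 add0r (bigD1_seq i)/= ?mem_index_iota ?iota_uniq//.
  rewrite indicE mem_set// mulr1 big1 ?addr0// => j ji.
  rewrite indicE memNset ?mulr0// /c/= in_itv/= => /andP[js sj].
  move: cs; rewrite /c/= in_itv/= => /andP[is_ si].
  have lt_ (a b : nat) : a%:R / 2 ^+ n < b%:R / 2 ^+ n :> R -> (a < b)%N.
    by rewrite ltr_pM2r ?invr_gt0 ?exprn_gt0// ltr_nat.
  have := lt_ _ _ (lt_le_trans js si); have := lt_ _ _ (lt_le_trans is_ sj).
  rewrite !ltnS => ij ji'; move: ji; rewrite eq_le; apply/negP; rewrite negbK.
  by rewrite leEnat ij ji'.
have Zout n s : 0 < s -> (forall i, (i < 4 ^ n)%N -> ~ c n i s) -> Z n s = 0.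
  move=> s0 H; rewrite /Z indicE memNset; last by move=> /= s_0; move: s0; rewrite s_0 ltxx.
  rewrite mulr0 add0r big_nat big1// => i /andP[_ iN].
  by rewrite indicE memNset ?mulr0//; exact: H.
have K0 : 0 <= K := le_trans (normr_ge0 _) (XK (lexx 0)).
have ZK n s : D s -> `|Z n s| <= K.
  rewrite /D/= in_itv/= andbT le_eqVlt => /orP[/eqP <-|s0]; first by rewrite Z0 XK.
  have [[i iN cs]|nc] := pselect (exists2 i, (i < 4 ^ n)%N & c n i s).
    by rewrite (Zc n i s)// XK// divr_ge0// exprn_ge0.
  by rewrite Zout ?normr0// => i iN ci; apply: nc; exists i.
have ZX s : D s -> Z n s @[n --> \oo] --> X s.
  rewrite /D/= in_itv/= andbT le_eqVlt => /orP[/eqP <-|s0].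
    by under eq_fun do rewrite Z0; exact: cvg_cst.
  apply/cvgrPdist_lt => e e0.
  have /cvgrPdist_lt /(_ e e0) := Xr (ltW s0).
  rewrite near_withinE => /nbhs_ballP[dl /= dl0 Hd].
  near=> n.
  have [i /andP[is_ si]] := dyadic_cell_oc n s0.
  have s2n : s <= 2 ^+ n.
    apply: (@le_trans _ _ n%:R); last by rewrite -natrX ler_nat ltnW// ltn_expl.
    near: n; exact: nbhs_infty_ger.
  have iN : (i < 4 ^ n)%N.
    rewrite -(@ltr_nat R) natrX (_ : 4%:R = 2 ^+ 2 :> R); last by rewrite -natrX.
    rewrite -exprM mulnC exprM expr2.
    by rewrite -ltr_pdivrMr ?exprn_gt0// (lt_le_trans is_).
  rewrite (Zc n i s)//; last by rewrite /c/= in_itv/= is_.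
  move: si; rewrite le_eqVlt => /orP[/eqP <-|si]; first by rewrite subrr normr0.
  apply: Hd => //=; rewrite /ball/= distrC gtr0_norm ?subr_gt0//.
  have h : 2^-1 ^+ n < dl.
    near: n; have := @cvg_half0 R => /cvgrPdist_lt /(_ dl dl0).
    by apply: filterS => n; rewrite sub0r normrN ger0_norm// exprn_ge0// invr_ge0.
  apply: le_lt_trans h; rewrite lerBlDl -natr1 mulrDl mul1r exprVn lerD2r.
  exact: ltW.
have mZ n : measurable_fun D (Z n).
  apply: measurable_funTS; apply: measurable_funD.
    by apply: measurable_funM => //; exact: measurable_indic.
  apply: measurable_sum => i; apply: measurable_funM => //.
  by apply: measurable_indic; exact: measurable_itv.
have mX : measurable_fun D X by exact: (measurable_fun_cvg mZ ZX).
have mEZ n : measurable_fun D (EFin \o Z n) by exact/measurable_EFinP.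
have mEX : measurable_fun D (EFin \o X) by exact/measurable_EFinP.
have mEK : measurable_fun D (EFin \o cst K) by exact/measurable_EFinP.
have [||||| _ _ cv] := @dominated_convergence _ _ _ mu D mD
    (fun n => EFin \o Z n) (EFin \o X) (EFin \o cst K).
- exact: mEZ.
- exact: mEX.
- by apply: nearW => s Ds; apply: cvg_EFin; [exact: nearW|exact: ZX].
- apply/integrableP; split; first exact: mEK.
  under eq_integral do rewrite /= ger0_norm//.
  by rewrite integral_cst//= path_totalE -EFinM ltry.
- by apply: nearW => s n Ds /=; rewrite lee_fin ZK.
apply: cvg_trans cv; apply: near_eq_cvg; apply: nearW => n.
have cD i : c n i `<=` D.
  move=> s; rewrite /c/= in_itv/= => /andP[+ _]; rewrite /D/= in_itv/= andbT.
  by move=> /ltW; apply: le_trans; rewrite divr_ge0// exprn_ge0.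
have I1 E (k : R) : measurable E -> E `<=` D ->
    mu.-integrable D (EFin \o (fun s => k * \1_E s)).
  move=> mE ED.
  have := @integrableZl _ _ _ mu D mD k (EFin \o \1_E); apply.
  have m1E : measurable_fun D (EFin \o (\1_E : R -> R)).
    exact/measurable_EFinP/measurable_indic.
  apply/integrableP; split; first exact: m1E.
  under eq_integral do rewrite /= ger0_norm//.
  rewrite (integral_indic mu mD mE) (le_lt_trans _ f_fin)//.
  by apply: le_measure; rewrite ?inE//; exact: measurableI.
have V1 E (k : R) : measurable E -> E `<=` D ->
    (\int[mu]_(s in D) (k * \1_E s)%:E = k%:E * mu E)%E.
  move=> mE ED; under eq_integral do rewrite EFinM.
  rewrite integralZl//; last first.
    have := I1 E 1 mE ED; apply: eq_integrable => // s _ /=; by rewrite mul1r.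
  by rewrite (integral_indic mu mD mE) setIidl.
have mc i : measurable (c n i) by exact: measurable_itv.
have m0 : mu [set 0] = (f 0)%:E by rewrite -stieltjes_0c// set_itv1.
transitivity (\int[mu]_(s in D) ((X 0 * \1_[set 0] s)%:E +
    \sum_(0 <= i < 4 ^ n) (X (i.+1%:R / 2 ^+ n) * \1_(c n i) s)%:E))%E.
  by apply: eq_integral => s _; rewrite /= /Z EFinD sumEFin.
have sub0 : [set 0] `<=` D by move=> s ->; rewrite /D/= in_itv/= lexx.
rewrite integralD//; [|exact: I1|]; last first.
  by apply: integrable_sum => // i _; apply: I1.
rewrite V1// m0 integral_sum//; last by move=> i; apply: I1.
rewrite /stieltjes_sum EFinD -EFinM; congr (_ + _)%E.
rewrite -sumEFin; apply: eq_bigr => i _; rewrite V1// EFinM; congr (_ * _)%E.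
by rewrite -stieltjes_oc// ler_pM2r ?invr_gt0 ?exprn_gt0// ler_nat.
Unshelve. all: by end_near. Qed.

Lemma cvg_stieltjes_integral :
  [/\ (\int[mu]_(s in `[0%R, +oo[) (X s)%:E)%E \is a fin_num,
      stieltjes_sum n @[n --> \oo] --> fine (\int[mu]_(s in `[0%R, +oo[) (X s)%:E)%E &
      `|fine (\int[mu]_(s in `[0%R, +oo[) (X s)%:E)%E| <= K * path_total].
Proof.
have cv := cvg_stieltjes_sum.
set I := (\int[mu]_(s in _) _)%E in cv *.
have ub : (I <= (K * path_total)%:E)%E.
  apply: (cvge_le _ cv); apply: nearW => n; rewrite lee_fin.
  exact: le_trans (ler_norm _) (stieltjes_sum_le n).
have lb : ((- (K * path_total))%:E <= I)%E.
  apply: (cvge_ge _ cv); apply: nearW => n; rewrite lee_fin.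
  by have := stieltjes_sum_le n; rewrite ler_norml => /andP[].
have fI : I \is a fin_num.
  by rewrite fin_numElt (lt_le_trans _ lb) ?ltNyr// (le_lt_trans ub) ?ltry.
split => //.
  by apply: (@fine_cvg _ _ _ _ (fun n => (stieltjes_sum n)%:E)); rewrite fineK.
by rewrite ler_norml -!lee_fin fineK// lb ub.
Qed.

End increasing_path.

(** * Moments of a variable that satisfies the tail identity *)

Section moments.
Context (R : realType) (d : measure_display) (T : measurableType d).
Variables (P : probability T R) (Y : T -> R).
Hypotheses (mY : measurable_fun [set: T] Y) (Y0 : forall w, 0 <= Y w)
  (tail : forall x, 0 <= x ->
    P [set w | x < Y w] = (\int[P]_w (Num.max (Y w - x) 0)%:E)%E)
  (mean : (\int[P]_w (Y w)%:E = 1)%E).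

Lemma integral_deriv_horner (p : {poly R}) (y : R) : 0 <= y ->
  (\int[lebesgue_measure]_(x in `[0%R, y]) (p^`().[x])%:E = (p.[y] - p.[0])%:E)%E.
Proof.
rewrite le_eqVlt => /orP[/eqP <-|y0]; first by rewrite set_itv1 integral_set1 subrr.
rewrite (@continuous_FTC2 _ _ (horner p))//.
- by apply: continuous_subspaceT => x; exact: continuous_horner.
- split.
  + by move=> x _; exact: derivable_horner.
  + by apply: cvg_at_right_filter; exact: continuous_horner.
  + by apply: cvg_at_left_filter; exact: continuous_horner.
- by move=> x _; rewrite -derivE.
Qed.

Lemma integral_window (p : {poly R}) (y : R) : 0 <= y ->
  (\int[lebesgue_measure]_x (if (0 <= x) && (x < y) then p^`().[x] else 0)%:E
   = (p.[y] - p.[0])%:E)%E.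
Proof.
move=> y0; rewrite -integral_deriv_horner// -integral_itv_bndo_bndc; last first.
  by apply/measurable_EFinP; apply: measurable_funTS; apply: continuous_measurable_fun; exact: continuous_horner.
rewrite [RHS]integral_mkcond; apply: eq_integral => x _.
rewrite patchE; case: ifPn => [xy|xy]; last by rewrite memNset//= in_itv/=; exact/negP.
by rewrite mem_set//= in_itv.
Qed.

Lemma tonelli_window (K : R -> R -> R) :
  measurable_fun [set: R * T] (fun z => K z.1 (Y z.2)) ->
  (forall x y, 0 <= x -> x < y -> 0 <= K x y) ->
  (\int[P]_w \int[lebesgue_measure]_x
     (if (0 <= x) && (x < Y w) then K x (Y w) else 0)%:E =
   \int[lebesgue_measure]_x \int[P]_w
     (if (0 <= x) && (x < Y w) then K x (Y w) else 0)%:E)%E.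
Proof.
move=> mK K0.
have := @fubini_tonelli _ _ _ _ R (@lebesgue_measure R) P
  (fun z : R * T => (if (0 <= z.1) && (z.1 < Y z.2) then K z.1 (Y z.2) else 0)%:E).
move=> -> //.
- apply/measurable_EFinP; apply: measurable_fun_ifT => //.
  apply: measurable_and; first exact: measurable_fun_ler.
  by apply: measurable_fun_ltr => //; exact: measurableT_comp.
- move=> z; rewrite lee_fin; case: ifP => // /andP[z0 zY]; exact: K0.
Qed.

(** Integrating [x^(n-1)] against the two sides of the tail identity, with
    Tonelli's theorem: the left side gives [E Y^n / n] and the right side gives
    [E Y^(n+1) / (n (n+1))]. *)
Lemma moment_rec n : (0 < n)%N ->
  (\int[P]_w (Y w ^+ n.+1)%:E = n.+1%:R%:E * \int[P]_w (Y w ^+ n)%:E)%E.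
Proof.
case: n => // n _; set c : R := n.+2%:R * n.+1%:R.
have c0 : 0 <= c by rewrite mulr_ge0.
pose K1 (x y : R) := c * x ^+ n.
pose K2 (x y : R) := c * x ^+ n * (y - x).
have mfst : measurable_fun [set: R * T] (fun z : R * T => z.1) by exact: measurable_fst.
have mYsnd : measurable_fun [set: R * T] (fun z : R * T => Y z.2).
  exact: measurableT_comp mY measurable_snd.
have m1 : measurable_fun [set: R * T] (fun z => K1 z.1 (Y z.2)).
  by apply: measurable_funM => //; exact: measurable_funX.
have m2 : measurable_fun [set: R * T] (fun z => K2 z.1 (Y z.2)).
  by apply: measurable_funM => //; exact: measurable_funB.
have E1 := tonelli_window m1 (fun x y x0 _ => mulr_ge0 c0 (exprn_ge0 n x0)).
have K20 x y : 0 <= x -> x < y -> 0 <= K2 x y.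
  by move=> x0 xy; rewrite !mulr_ge0 ?exprn_ge0// subr_ge0 ltW.
have E2 := tonelli_window m2 K20.
have I1 y : 0 <= y -> (\int[lebesgue_measure]_x
    (if (0 <= x) && (x < y) then K1 x y else 0)%:E = (n.+2%:R * y ^+ n.+1)%:E)%E.
  move=> y0; have := integral_window (n.+2%:R *: 'X^(n.+1)) y0.
  rewrite !hornerE expr0n/= mulr0 subr0 => <-.
  apply: eq_integral => x _; congr (_%:E); case: ifP => // _.
  by rewrite /K1 derivZ derivXn !(hornerE, hornerMn) /= -[_ *+ n.+1]mulr_natl mulrA.
have I2 y : 0 <= y -> (\int[lebesgue_measure]_x
    (if (0 <= x) && (x < y) then K2 x y else 0)%:E = (y ^+ n.+2)%:E)%E.
  move=> y0; have := integral_window ((n.+2%:R * y) *: 'X^(n.+1) - n.+1%:R *: 'X^(n.+2)) y0.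
  set p := _ - _; have -> : p.[y] - p.[0] = y ^+ n.+2.
    by rewrite /p !(hornerD, hornerN, hornerZ, hornerXn) !expr0n !mulr0 subrr subr0 [y ^+ n.+2]exprS -[n.+2%:R]natr1; ring.
  move=> <-; apply: eq_integral => x _; congr (_%:E); case: ifP => // _.
  rewrite /K2 /p derivB !derivZ !derivXn -[n.+2.-1]/(n.+1) -[n.+1.-1]/n.
  rewrite hornerD hornerN !hornerZ !hornerMn !hornerXn.
  rewrite -[x ^+ n *+ _]mulr_natl -[x ^+ n.+1 *+ _]mulr_natl /c exprS; ring.
transitivity (\int[P]_w (n.+2%:R * Y w ^+ n.+1)%:E)%E; last first.
  under eq_integral do rewrite EFinM.
  rewrite ge0_integralZl_EFin//.
  - by move=> w _; rewrite lee_fin exprn_ge0.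
  - by apply/measurable_EFinP; exact: measurable_funX.
transitivity (\int[P]_w \int[lebesgue_measure]_x
     (if (0 <= x) && (x < Y w) then K2 x (Y w) else 0)%:E)%E.
  by apply: eq_integral => w _; rewrite I2.
transitivity (\int[P]_w \int[lebesgue_measure]_x
     (if (0 <= x) && (x < Y w) then K1 x (Y w) else 0)%:E)%E; last first.
  by apply: eq_integral => w _; rewrite I1.
rewrite E1 E2; apply: eq_integral => x _.
have [x0|x0] := leP 0 x; last first.
  by rewrite !integral0_eq// => w _; rewrite leNgt x0.
have cx : 0 <= c * x ^+ n by rewrite mulr_ge0// exprn_ge0.
transitivity ((c * x ^+ n)%:E * \int[P]_w (Num.max (Y w - x) 0)%:E)%E.
  rewrite -ge0_integralZl_EFin//.
  - apply: eq_integral => w _ /=; rewrite -EFinM; congr (_%:E).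
    rewrite maxEle subr_le0; case: ltP => xY; first by [].
    by rewrite mulr0.
  - by move=> w _; rewrite lee_fin le_max lexx orbT.
  - by apply/measurable_EFinP; apply: measurable_maxr => //; exact: measurable_funB.
have mI : measurable [set w | x < Y w] by exact: measurable_above.
rewrite -tail// -[X in P X]setIT -(integral_indic P measurableT mI).
rewrite -ge0_integralZl_EFin//; last exact/measurable_EFinP/measurable_indic.
apply: eq_integral => w _ /=; rewrite -EFinM; congr (_%:E); rewrite indicE.
case: ltP => xY; first by rewrite mem_set// mulr1.
by rewrite memNset ?mulr0//=; apply/negP; rewrite -leNgt.
Qed.

Lemma moment n : (\int[P]_w (Y w ^+ n)%:E = n`!%:R%:E)%E.
Proof.
elim: n => [|n IH].
  by under eq_integral do rewrite expr0; rewrite integral_cst// mul1e; exact: probability_setT.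
case: n IH => [_|n IH]; first by under eq_integral do rewrite expr1.
by rewrite moment_rec// IH -EFinM -natrM -factS.
Qed.

End moments.

(** * Completeness of polynomials *)

Section exponential_series.
Context (R : realType).
Implicit Types (x : R) (n : nat).

Definition exp_sum x n : R := \sum_(k <- iota 0 n) x ^+ k / k`!%:R.

Lemma exp_sumE x n : exp_sum x n = series (exp_coeff x) n.
Proof. by rewrite /exp_sum /series/= /index_iota subn0. Qed.

Lemma cvg_exp_sum x : exp_sum x n @[n --> \oo] --> expR x.
Proof.
under eq_cvg do rewrite exp_sumE; exact: is_cvg_series_exp_coeff.
Qed.

Lemma exp_sum_le x n : 0 <= x -> exp_sum x n <= expR x.
Proof.
move=> x0; rewrite exp_sumE; apply: nondecreasing_cvgn_le; last exact: is_cvg_series_exp_coeff.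
apply/nondecreasing_seqP => k; rewrite -!exp_sumE /exp_sum big_iota_recr lerDl.
by rewrite divr_ge0// exprn_ge0.
Qed.

Lemma norm_exp_sum_le x n : `|exp_sum x n| <= expR `|x|.
Proof.
apply: le_trans (exp_sum_le n (normr_ge0 x)).
apply: (le_trans (ler_norm_sum _ _ _)); apply: ler_sum => k _.
by rewrite normrM normrX [X in _ * X]ger0_norm// invr_ge0.
Qed.

Lemma expr_le_exp x n : 0 <= x -> x ^+ n <= n`!%:R * expR x.
Proof.
move=> x0; rewrite mulrC -ler_pdivrMr ?ltr0n ?fact_gt0//.
apply: le_trans (exp_sum_le n.+1 x0); rewrite /exp_sum big_iota_recr lerDr.
by apply: sumr_ge0 => k _; rewrite divr_ge0// exprn_ge0.
Qed.

End exponential_series.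

Section polynomial_completeness.
Context (R : realType) (d : measure_display) (T : measurableType d).
Variables (P : probability T R) (Y : T -> R).
Hypotheses (mY : measurable_fun [set: T] Y) (Y0 : forall w, 0 <= Y w)
  (momY : forall n, (\int[P]_w (Y w ^+ n)%:E = n`!%:R%:E)%E).

Let mexp (f : T -> R) : measurable_fun [set: T] f -> measurable_fun [set: T] (fun w => expR (f w)).
Proof. by move=> mf; apply: measurableT_comp. Qed.

Lemma power_square_intble n : square_intble P (fun w => Y w ^+ n).
Proof.
split; first exact: measurable_funX.
under eq_fun do rewrite -exprM.
apply/integrableP; split; first by apply/measurable_EFinP; exact: measurable_funX.
by under eq_integral do rewrite /= ger0_norm ?exprn_ge0//; rewrite momY ltry.
Qed.

Let intble_power n : intble P (fun w => Y w ^+ n).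
Proof. exact/square_intble_intble/power_square_intble. Qed.

Let Rintegral_power n : \int[P]_w (Y w ^+ n) = n`!%:R.
Proof. by rewrite /Rintegral momY. Qed.

(** Term by term, [E exp (Y / 2)] is the geometric series of ratio [1/2]. *)
Lemma intble_exp_half : intble P (fun w => expR (Y w / 2)).
Proof.
pose f n w := exp_sum (Y w / 2) n.
have fE n w : f n w = \sum_(k <- iota 0 n) (2^-1 ^+ k / k`!%:R) * Y w ^+ k.
  by apply: eq_bigr => k _; rewrite exprMn; ring.
have If n : intble P (f n).
  rewrite (_ : f n = fun w => \sum_(k <- iota 0 n) (2^-1 ^+ k / k`!%:R) * Y w ^+ k).
    by apply: intble_sum => k; exact: intbleZ.
  by apply/funext => w; exact: fE.
have f0 n w : 0 <= f n w.
  by apply: sumr_ge0 => k _; rewrite divr_ge0// exprn_ge0// divr_ge0.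
have [||| k | g [Ig g0 _ fg]] := @monotone_limit_intble _ _ _ P f 2.
- by move=> k; exact: intble_measurable.
- exact: f0.
- by move=> k w; rewrite /f /exp_sum big_iota_recr lerDl divr_ge0// exprn_ge0// divr_ge0.
- rewrite -EFin_Rintegral// lee_fin.
  under eq_Rintegral do rewrite fE.
  rewrite Rintegral_sum; last by move=> i; exact: intbleZ.
  suff : \sum_(i <- iota 0 k) \int[P]_w (2^-1 ^+ i / i`!%:R * Y w ^+ i) = 2 * (1 - 2^-1 ^+ k).
    by move=> ->; rewrite ler_piMr// gerBl exprn_ge0.
  elim: k => [|k IH]; first by rewrite big_nil expr0 subrr mulr0.
  have -> : \sum_(i <- iota 0 k.+1) \int[P]_w (2^-1 ^+ i / i`!%:R * Y w ^+ i) =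
      2 * (1 - 2^-1 ^+ k) + 2^-1 ^+ k.
    rewrite big_iota_recr IH; congr (_ + _).
    transitivity (2^-1 ^+ k / k`!%:R * \int[P]_w (Y w ^+ k)); first by apply: RintegralZl => //; exact: intble_power.
    by rewrite Rintegral_power divfK// pnatr_eq0 -lt0n fact_gt0.
  by rewrite exprS; field.
have [||||I _] := @dominated_cvg _ _ _ P f (fun w => expR (Y w / 2)) g _ _ _ Ig _ => //.
- by move=> n; exact: intble_measurable.
- by apply: mexp; exact: measurable_funM.
- by apply: nearW => w; exact: cvg_exp_sum.
- by apply: filterS fg => w fg n; rewrite ger0_norm.
Qed.

Definition moments_vanish (X : T -> R) :=
  square_intble P X /\ forall n, \int[P]_w (X w * Y w ^+ n) = 0.

(** The exponential series of [- Y / 8] can be integrated term by term against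
    [X Y^n]: its partial sums are dominated by [exp (Y / 8)], and the square of
    [Y^n exp (Y / 8)] by a multiple of the integrable [exp (Y / 2)]. *)
Lemma moments_vanish_tilt (X : T -> R) : moments_vanish X ->
  moments_vanish (fun w => X w * expR (- (Y w / 8))).
Proof.
move=> [sX X0]; have [mX IX] := sX.
have mE : measurable_fun [set: T] (fun w => expR (- (Y w / 8))).
  by apply: mexp; apply: measurableT_comp => //; exact: measurable_funM.
have E1 w : expR (- (Y w / 8)) <= 1 by rewrite expR_le1 oppr_le0 divr_ge0.
split.
  apply: square_intble_le sX => [|w]; first exact: measurable_funM.
  by rewrite normrM ler_piMr// ger0_norm ?expR_ge0.
move=> n.
pose F N w := X w * Y w ^+ n * exp_sum (- (Y w / 8)) N.
have FE N w : F N w = \sum_(k <- iota 0 N) ((- 8^-1) ^+ k / k`!%:R) * (X w * Y w ^+ (n + k)).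
  rewrite /F /exp_sum mulr_sumr; apply: eq_bigr => k _.
  by rewrite -mulrN exprMn exprD; ring.
have sY := power_square_intble.
have I1 k : intble P (fun w => ((- 8^-1) ^+ k / k`!%:R) * (X w * Y w ^+ (n + k))).
  by apply: intbleZ; exact: square_intble_mul.
have FF N : F N = fun w => \sum_(k <- iota 0 N) ((- 8^-1) ^+ k / k`!%:R) * (X w * Y w ^+ (n + k)).
  by apply/funext => w; exact: FE.
have F0 N : \int[P]_w F N w = 0.
  rewrite FF Rintegral_sum; last exact: I1.
  apply: big1 => k _.
  by rewrite RintegralZl ?X0 ?mulr0//; exact: square_intble_mul.
(* From [(Y / 8)^2n <= (2n)! exp (Y / 8)], and [exp (Y / 8)^3 <= exp (Y / 2)]. *)
pose c : R := (2 * n)`!%:R * 8 ^+ (2 * n).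
have c0 : 0 <= c by rewrite mulr_ge0// exprn_ge0.
pose g w := X w ^+ 2 + c * expR (Y w / 2).
have Ig : intble P g by apply: intbleD => //; apply: intbleZ; exact: intble_exp_half.
have Fg N w : `|F N w| <= g w.
  have H1 : `|F N w| <= `|X w| * (Y w ^+ n * expR (Y w / 8)).
    rewrite /F !normrM -mulrA ler_wpM2l// [X in X * _]ger0_norm ?exprn_ge0//.
    rewrite ler_wpM2l ?exprn_ge0//; apply: le_trans (norm_exp_sum_le _ _) _.
    by rewrite normrN ger0_norm// divr_ge0.
  have H2 : (Y w ^+ n * expR (Y w / 8)) ^+ 2 <= c * expR (Y w / 2).
    have e8 : 0 <= Y w / 8 by rewrite divr_ge0.
    have := expr_le_exp (2 * n) e8; rewrite expr_div_n ler_pdivrMr ?exprn_gt0// => H3.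
    rewrite exprMn -exprM mulnC -expRM_natl.
    apply: (@le_trans _ _ ((2 * n)`!%:R * expR (Y w / 8) * 8 ^+ (2 * n) * expR (2%:R * (Y w / 8)))).
      by rewrite ler_wpM2r// expR_ge0.
    have -> : (2 * n)`!%:R * expR (Y w / 8) * 8 ^+ (2 * n) * expR (2%:R * (Y w / 8)) =
        c * expR (Y w / 8 + 2%:R * (Y w / 8)) by rewrite expRD /c; ring.
    rewrite ler_wpM2l// ler_expR.
    by have := Y0 w; lra.
  apply: (le_trans H1); rewrite /g; apply: le_trans (lerD (lexx _) H2).
  rewrite -[X w ^+ 2](real_normK (num_real _)).
  have := sqr_ge0 (`|X w| - Y w ^+ n * expR (Y w / 8)).
  have : 0 <= Y w ^+ n * expR (Y w / 8) by rewrite mulr_ge0 ?exprn_ge0 ?expR_ge0.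
  have := normr_ge0 (X w); set a := `|X w|; set b := _ * expR _; nra.
have [||||_] := @dominated_cvg _ _ _ P F (fun w => X w * expR (- (Y w / 8)) * Y w ^+ n) g _ _ _ Ig _.
- by move=> N; apply: intble_measurable; rewrite FF; apply: intble_sum.
- by apply: measurable_funM; [exact: measurable_funM|exact: measurable_funX].
- apply: nearW => w; rewrite mulrAC; apply: cvgMl_tmp; exact: cvg_exp_sum.
- exact: nearW.
under eq_cvg do rewrite F0.
by move=> /cvg_lim <-//; rewrite lim_cst.
Qed.

Lemma moments_vanish_exp (X : T -> R) j : moments_vanish X ->
  \int[P]_w (X w * expR (- (Y w / 8)) ^+ j) = 0.
Proof.
move=> vX.
suff : moments_vanish (fun w => X w * expR (- (Y w / 8)) ^+ j).
  by move=> [_ /(_ 0%N)]; under eq_Rintegral do rewrite expr0 mulr1.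
elim: j => [|j IH]; first by under eq_fun do rewrite expr0 mulr1.
by under eq_fun do rewrite exprSr mulrA; exact: moments_vanish_tilt.
Qed.

(** The double exponentials [exp (- exp (m + m^2 (a - y)))] are limits of
    polynomials in [exp (- y / 8)], dominated by a constant since the latter
    lies between 0 and 1; as [m] grows they converge to the indicator of [y > a]. *)
Lemma moments_vanish_ray (X : T -> R) a : moments_vanish X ->
  \int[P]_w (X w * \1_[set w | a < Y w] w) = 0.
Proof.
move=> vX; have [sX X0] := vX; have [mX _] := sX.
have IX := square_intble_intble sX.
pose t m y : R := m%:R + m%:R ^+ 2 * (a - y).
pose f m y : R := expR (- expR (t m y)).
have mf m : measurable_fun [set: T] (fun w => f m (Y w)).
  apply: mexp; apply: measurableT_comp => //; apply: mexp.
  by apply: measurable_funD => //; apply: measurable_funM => //; exact: measurable_funB.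
have f0 m : \int[P]_w (X w * f m (Y w)) = 0.
  pose c : R := expR (m%:R + m%:R ^+ 2 * a).
  have ct y : expR (t m y) = c * expR (- (y / 8)) ^+ (8 * m ^ 2)%N.
    by rewrite -expRM_natl -expRD /t; congr expR; rewrite natrM natrX; field.
  pose F N w := X w * exp_sum (- expR (t m (Y w))) N.
  have FF N : F N = fun w => \sum_(k <- iota 0 N) ((- c) ^+ k / k`!%:R) *
      (X w * expR (- (Y w / 8)) ^+ (8 * m ^ 2 * k)).
    apply/funext => w; rewrite /F /exp_sum mulr_sumr; apply: eq_bigr => k _.
    by rewrite ct -mulNr exprMn -exprM; ring.
  have mE : measurable_fun [set: T] (fun w => expR (- (Y w / 8))).
    by apply: mexp; apply: measurableT_comp => //; exact: measurable_funM.
  have I1 j : intble P (fun w => X w * expR (- (Y w / 8)) ^+ j).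
    apply: (intble_le _ _ (intble_norm IX)); first by apply: measurable_funM => //; exact: measurable_funX.
    move=> w; rewrite normrM ler_piMr// ger0_norm ?exprn_ge0 ?expR_ge0//.
    by rewrite exprn_ile1 ?expR_ge0// expR_le1 oppr_le0 divr_ge0.
  have F0 N : \int[P]_w F N w = 0.
    rewrite FF Rintegral_sum; last by move=> k; exact: intbleZ.
    apply: big1 => k _.
    transitivity ((- c) ^+ k / k`!%:R *
        \int[P]_w (X w * expR (- (Y w / 8)) ^+ (8 * m ^ 2 * k))).
      by apply: RintegralZl => //; exact: I1.
    by rewrite moments_vanish_exp// mulr0.
  have Ig : intble P (fun w => expR c * `|X w|) by apply: intbleZ; exact: intble_norm.
  have [||||_] := @dominated_cvg _ _ _ P F (fun w => X w * f m (Y w)) _ _ _ _ Ig _.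
  - by move=> N; apply: intble_measurable; rewrite FF; apply: intble_sum => k; exact: intbleZ.
  - exact: measurable_funM.
  - by apply: nearW => w; apply: cvgMl_tmp; exact: cvg_exp_sum.
  - apply: nearW => w N; rewrite normrM mulrC ler_wpM2r//.
    apply: (le_trans (norm_exp_sum_le _ _)); rewrite ler_expR normrN ger0_norm ?expR_ge0//.
    rewrite ct ler_piMr ?expR_ge0// exprn_ile1 ?expR_ge0// expR_le1 oppr_le0 divr_ge0//.
  under eq_cvg do rewrite F0.
  by move=> /cvg_lim <-//; rewrite lim_cst.
have mA : measurable [set w | a < Y w] by exact: measurable_above.
have q0 : (fun m : nat => expR (- m%:R) : R) @ \oo --> (0 : R).
  under eq_cvg do rewrite -[X in expR X]mulrN1 expRM_natl.
  by apply: cvg_expr; rewrite ger0_norm ?expR_ge0// expR_lt1 oppr_lt0.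
have cf y : f m y @[m --> \oo] --> ((a < y)%R%:R : R).
  case: (ltP a y) => ay.
    apply: (@squeeze_cvgr _ _ _ _ (fun m : nat => 1 - expR (- m%:R)) (cst 1)).
    - near=> m; apply/andP; split; last by rewrite expR_le1 oppr_le0 expR_ge0.
      apply: le_trans (expR_ge1Dx _); rewrite lerD2l lerN2 ler_expR /t.
      have d0 : 0 < y - a by rewrite subr_gt0.
      have md : 2 / (y - a) <= m%:R by near: m; exact: nbhs_infty_ger.
      rewrite ler_pdivrMr// in md.
      by have m0 : 0 <= m%:R :> R by []; nra.
    - rewrite -[X in _ --> X]subr0; apply: cvgB => //; exact: cvg_cst.
    - exact: cvg_cst.
  apply: (@squeeze_cvgr _ _ _ _ (cst 0) (fun m : nat => expR (- m%:R))) => //; last exact: cvg_cst.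
  apply: nearW => m; rewrite expR_ge0/= ler_expR lerN2.
  apply: (@le_trans _ _ (expR m%:R)).
    by apply: le_trans (expR_ge1Dx _); rewrite lerDr.
  by rewrite ler_expR lerDl mulr_ge0 ?sqr_ge0// subr_ge0.
have [||||_] := @dominated_cvg _ _ _ P (fun m w => X w * f m (Y w))
   (fun w => X w * \1_[set w | a < Y w] w) _ _ _ _ (intble_norm IX) _.
- by move=> m; exact: measurable_funM.
- by apply: measurable_funM => //; exact: measurable_indic.
- apply: nearW => w; apply: cvgMl_tmp; rewrite indicE.
  rewrite (_ : (w \in _) = (a < Y w)); first exact: cf.
  by apply/idP/idP; rewrite inE.
- apply: nearW => w m; rewrite normrM ler_piMr// ger0_norm ?expR_ge0//.
  by rewrite expR_le1 oppr_le0 expR_ge0.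
under eq_cvg do rewrite f0.
by move=> /cvg_lim <-//; rewrite lim_cst.
Unshelve. all: by end_near. Qed.

(** Half-lines are stable under intersection and generate the Borel sets. *)
Lemma moments_vanish_preimage (X : T -> R) (B : set R) : measurable B -> moments_vanish X ->
  (\int[P]_(w in Y @^-1` B) (X w)%:E = 0)%E.
Proof.
move=> mB vX; have [sX X0] := vX; have IX := square_intble_intble sX.
have mYB (C : set R) : measurable C -> measurable (Y @^-1` C).
  by move=> mC; rewrite -[X in measurable X]setTI; apply: mY.
have GE : (measurable : set (set R)) = <<s (@RGenOInfty.G R) >> by exact: RGenOInfty.measurableE.
have EX : (\int[P]_w (X w)%:E = 0)%E.
  rewrite -EFin_Rintegral//; have := X0 0%N.
  by under eq_Rintegral do rewrite expr0 mulr1; move=> ->.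
apply: (dynkin_induction (G := @RGenOInfty.G R)
  (P := fun C => (\int[P]_(w in Y @^-1` C) (X w)%:E = 0)%E)) => //.
- move=> _ _ [x ->] [y ->]; exists (Num.max x y).
  by apply/seteqP; split => z /=; rewrite !in_itv/= !andbT gt_max => /andP.
- move=> _ [x ->]; rewrite (_ : _ @^-1` _ = [set w | x < Y w]); last first.
    by apply/seteqP; split => w /=; rewrite in_itv/= andbT.
  rewrite -integral_mul_indic -EFin_Rintegral ?moments_vanish_ray//.
  by apply: intble_mul_indic IX; exact: measurable_above.
- move=> C mC /= XC; have mYC := mYB C mC; move: EX.
  rewrite -(setUv (Y @^-1` C)) integral_setU_EFin//; last 3 first.
  - exact: measurableC.
  - by case: sX => mX _; rewrite setUv.
  - by apply/disj_setPS; rewrite setICr.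
  by rewrite XC add0e preimage_setC.
- move=> C mC tC /= XC; rewrite preimage_bigcup integral_bigcup//.
  + by apply: eseries0 => k _ _; exact: XC.
  + by apply/trivIsetP => i j _ _ ij; rewrite -preimage_setI; move/trivIsetP: tC => /(_ i j I I ij) ->; rewrite preimage_set0.
  + by move=> k; exact: mYB.
  + apply: (integrableS measurableT) IX => //.
    by apply: bigcupT_measurable => k; exact: mYB.
- by rewrite -GE.
Qed.

(** In other words, polynomials in [Y] are dense in [L^2 (sigma (Y))]. *)
Lemma moments_vanish_orthogonal (X Z : T -> R) : moments_vanish X ->
  measurable_wrt (g_sigma_algebra_preimage Y) Z -> square_intble P Z ->
  \int[P]_w (X w * Z w) = 0.
Proof.
move=> vX mZ sZ; have [sX _] := vX.
apply: (Rintegral_mul_eq0 (G := g_sigma_algebra_preimage Y)) => //.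
- by apply: sigma_algebra_preimage; exact: sigma_algebra_measurable.
- by move=> _ [B mB <-]; exact: mY.
- by move=> _ [B mB <-]; rewrite setTI; exact: moments_vanish_preimage.
Qed.

End polynomial_completeness.

(** * Laguerre polynomials *)

Section laguerre_polynomials.
Context (R : realType).
Implicit Types (p q r : {poly R}) (n k : nat).

(** The operator such that [(p exp (- x))' = rodrigues p * exp (- x)]. *)
Definition rodrigues p : {poly R} := (p^`() - p)%R.

Lemma derive_poly_exp p (x : R) :
  is_derive x (1 : R) (fun y => p.[y] * expR (- y)) ((rodrigues p).[x] * expR (- x)).
Proof.
have d1 : is_derive x (1 : R) (fun y : R => expR (- y)) (- expR (- x)).
  by rewrite (_ : (fun _ => _) = expR \o -%R)//; apply: is_derive_eq; rewrite mulrN1.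
have d2 : is_derive x (1 : R) (horner p) (p^`().[x])%R by exact: is_derive_poly.
have := @is_deriveM _ _ _ _ _ _ _ _ d2 d1.
rewrite (_ : horner p * _ = fun y => p.[y] * expR (- y)); last exact/funext.
by move=> H; apply: is_derive_eq H _; rewrite /GRing.scale/= /rodrigues hornerD hornerN; ring.
Qed.

Lemma derive1n_poly_exp p k :
  derive1n k (fun y => p.[y] * expR (- y)) = fun x => (iter k rodrigues p).[x] * expR (- x).
Proof.
elim: k => [|k IH]; first by rewrite derive1n0.
rewrite derive1nS IH; apply/funext => x; rewrite derive1E.
by have dp := derive_poly_exp (iter k rodrigues p) x; rewrite derive_val.
Qed.

Definition laguerre_poly n : {poly R} := (n`!%:R)^-1 *: iter n rodrigues 'X^n.

Lemma laguerreE n (x : R) : laguerre n x = (laguerre_poly n).[x].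
Proof.
rewrite /laguerre (_ : (fun y : R => _) = fun y => ('X^n : {poly R}).[y] * expR (- y)).
  rewrite derive1n_poly_exp /laguerre_poly hornerZ -mulrA; congr (_ * _).
  by rewrite mulrCA [X in _ * X]expRxMexpNx_1 mulr1.
by apply/funext => y; rewrite hornerXn.
Qed.

Lemma iter_rodrigues_size n k : (size (iter k rodrigues 'X^n) <= n.+1)%N.
Proof.
elim: k => [|k IH]; first by rewrite /= size_polyXn.
rewrite iterS /rodrigues (leq_trans (size_polyD _ _))// geq_max size_polyN IH andbT.
by rewrite (leq_trans (size_poly _ _))// (leq_trans (leq_pred _)).
Qed.

Lemma iter_rodrigues_coef n k : (iter k rodrigues 'X^n)`_n = (-1) ^+ k.
Proof.
elim: k => [|k IH]; first by rewrite /= coefXn eqxx.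
rewrite iterS /rodrigues coefB coef_deriv IH nth_default ?iter_rodrigues_size//.
by rewrite mul0rn sub0r exprS mulN1r.
Qed.

(** Each differentiation lowers the order of vanishing at [0] by one; this is
    what removes the boundary terms in the integrations by parts. *)
Lemma iter_rodrigues_factor n k : (k <= n)%N ->
  exists r, iter k rodrigues 'X^n = 'X^(n - k) * r.
Proof.
elim: k => [_|k IH kn]; first by exists 1; rewrite /= subn0 mulr1.
have [r E] := IH (ltnW kn); rewrite iterS E.
exists ((n - k)%:R *: r + 'X * r^`() - 'X * r).
rewrite -(subnSK kn); set m := (n - k.+1)%N.
rewrite /rodrigues derivM derivXn /= exprS scaler_nat -mulr_natr -[r *+ _]mulr_natr; ring.
Qed.

Lemma laguerre_poly_size n : (size (laguerre_poly n) <= n.+1)%N.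
Proof. by rewrite (leq_trans (size_scale_leq _ _))// iter_rodrigues_size. Qed.

Lemma laguerre_poly_coef n : (laguerre_poly n)`_n = (-1) ^+ n / n`!%:R.
Proof. by rewrite coefZ iter_rodrigues_coef mulrC. Qed.

(** The expectation of [p (Y)] for any [Y] with moments [n!], as an algebraic
    functional. *)
Definition factorial_form p : R := \sum_(i < size p) p`_i * i`!%:R.

Lemma factorial_form_widen p N : (size p <= N)%N ->
  factorial_form p = \sum_(i < N) p`_i * i`!%:R.
Proof.
move=> pN; rewrite /factorial_form (big_ord_widen _ (fun i => p`_i * i`!%:R) pN).
rewrite [RHS](bigID (fun i : 'I_N => (i < size p)%N))/= [X in _ + X]big1 ?addr0// => i.
by rewrite -leqNgt => ip; rewrite nth_default ?mul0r.
Qed.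

Lemma factorial_formD p q : factorial_form (p + q) = factorial_form p + factorial_form q.
Proof.
pose N := maxn (size p) (size q).
rewrite (@factorial_form_widen (p + q) N) ?size_polyD//.
rewrite (@factorial_form_widen p N) ?leq_maxl// (@factorial_form_widen q N) ?leq_maxr//.
by rewrite -big_split/=; apply: eq_bigr => i _; rewrite coefD mulrDl.
Qed.

Lemma factorial_formZ (a : R) p : factorial_form (a *: p) = a * factorial_form p.
Proof.
rewrite (@factorial_form_widen (a *: p) (size p)) ?size_scale_leq// mulr_sumr.
by apply: eq_bigr => i _; rewrite coefZ mulrA.
Qed.

Lemma factorial_formN p : factorial_form (- p) = - factorial_form p.
Proof. by rewrite -scaleN1r factorial_formZ mulN1r. Qed.

Lemma factorial_form_Xn n : factorial_form 'X^n = n`!%:R.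
Proof.
rewrite (@factorial_form_widen _ n.+1) ?size_polyXn// big_ord_recr/= coefXn eqxx mul1r.
by rewrite big1 ?add0r// => i _; rewrite coefXn ltn_eqF ?mul0r.
Qed.

Lemma factorial_form_deriv p : factorial_form p^`() = factorial_form p - p.[0].
Proof.
rewrite (@factorial_form_widen p (size p).+1)// big_ord_recl/= fact0 mulr1.
rewrite -horner_coef0 [in RHS]addrC addKr.
rewrite (@factorial_form_widen _ (size p)); last first.
  by rewrite (leq_trans (size_poly _ _))// leq_pred.
by apply: eq_bigr => i _; rewrite coef_deriv -[p`_i.+1 *+ _]mulr_natr /= /bump/= add1n factS natrM mulrA.
Qed.

Lemma factorial_form_rodrigues p q :
  factorial_form (q * rodrigues p) = - factorial_form (q^`() * p) - q.[0] * p.[0].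
Proof.
have -> : q * rodrigues p = (q * p)^`() + (- (q^`() * p) + - (q * p))%R.
  by rewrite derivM /rodrigues; ring.
rewrite !factorial_formD !factorial_formN factorial_form_deriv hornerM; ring.
Qed.

(** Repeated integration by parts; the boundary terms vanish as long as the
    Rodrigues iterate is divisible by ['X]. *)
Lemma factorial_form_iter n k q : (k <= n)%N ->
  factorial_form (q * iter k rodrigues 'X^n) = (-1) ^+ k * factorial_form (q^`(k) * 'X^n).
Proof.
elim: k q => [|k IH] q kn; first by rewrite mul1r derivn0.
rewrite iterS factorial_form_rodrigues IH ?(ltnW kn)//.
have [r ->] := iter_rodrigues_factor (ltnW kn).
rewrite hornerM hornerXn expr0n subn_eq0 leqNgt kn mul0r mulr0 subr0.
by rewrite exprS mulN1r mulNr derivSn.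
Qed.

Lemma derivn_const q n : (size q <= n.+1)%N -> q^`(n) = (n`!%:R * q`_n)%:P.
Proof.
move=> qn; apply/polyP => i; rewrite coef_derivn coefC.
case: i => [|i]/=; first by rewrite addn0 ffactnn mulr_natl.
by rewrite nth_default ?mul0rn// (leq_trans qn)// addnS ltnS leq_addr.
Qed.

Lemma laguerre_poly_orthonormal m n :
  factorial_form (laguerre_poly m * laguerre_poly n) = (m == n)%:R.
Proof.
wlog mn : m n / (m <= n)%N.
  by move=> H; have [/H//|/ltnW/H] := leqP m n; rewrite mulrC eq_sym.
rewrite {2}/laguerre_poly -scalerAr factorial_formZ factorial_form_iter//.
have n0 : n`!%:R != 0 :> R by rewrite pnatr_eq0 -lt0n fact_gt0.
rewrite derivn_const; last by rewrite (leq_trans (laguerre_poly_size _))// ltnS.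
rewrite mul_polyC factorial_formZ factorial_form_Xn.
move: mn; rewrite leq_eqVlt => /orP[/eqP ->|mn].
  rewrite eqxx laguerre_poly_coef.
  have s1 : (-1) ^+ n * (-1) ^+ n = 1 :> R by rewrite -exprMn mulN1r opprK expr1n.
  set s := (-1) ^+ n in s1 *.
  transitivity ((s * s) * (n`!%:R / n`!%:R) * (n`!%:R^-1 * n`!%:R)); first by ring.
  by rewrite s1 divff// mulVf// !mulr1.
rewrite ltn_eqF// nth_default ?mulr0 ?mul0r ?mulr0//.
exact: leq_trans (laguerre_poly_size _) mn.
Qed.

Lemma laguerre0E (x : R) : laguerre 0 x = 1.
Proof. by rewrite laguerreE /laguerre_poly fact0 invr1 scale1r/= expr0 hornerC. Qed.

Lemma laguerre1E (x : R) : laguerre 1 x = 1 - x.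
Proof.
rewrite laguerreE /laguerre_poly invr1 scale1r/= expr1 /rodrigues derivX hornerD hornerN hornerX.
by rewrite hornerC.
Qed.

End laguerre_polynomials.

Section laguerre_random.
Context (R : realType) (d : measure_display) (T : measurableType d).
Variables (P : probability T R) (Y : T -> R).
Hypotheses (mY : measurable_fun [set: T] Y) (Y0 : forall w, 0 <= Y w)
  (momY : forall n, (\int[P]_w (Y w ^+ n)%:E = n`!%:R%:E)%E).

Lemma horner_sumE (p : {poly R}) : (fun w => p.[Y w]) =
  fun w => \sum_(i <- iota 0 (size p)) p`_i * Y w ^+ i.
Proof.
apply/funext => w; rewrite horner_coef -(big_mkord xpredT (fun i => p`_i * Y w ^+ i)).
by rewrite /index_iota subn0.
Qed.

Lemma poly_square_intble (p : {poly R}) : square_intble P (fun w => p.[Y w]).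
Proof.
rewrite horner_sumE; apply: square_intble_sum => i; apply: square_intbleZ.
exact: (power_square_intble mY Y0 momY).
Qed.

Lemma Rintegral_poly (p : {poly R}) : \int[P]_w p.[Y w] = factorial_form p.
Proof.
rewrite horner_sumE Rintegral_sum; last first.
  by move=> i; apply: intbleZ; exact/square_intble_intble/(power_square_intble mY Y0 momY).
rewrite /factorial_form -(big_mkord xpredT (fun i => p`_i * i`!%:R)) /index_iota subn0.
apply: eq_bigr => i _; transitivity (p`_i * \int[P]_w (Y w ^+ i)).
  by apply: RintegralZl => //; exact/square_intble_intble/(power_square_intble mY Y0 momY).
by congr (_ * _); rewrite /Rintegral momY.
Qed.

Lemma laguerre_square_intble n : square_intble P (fun w => laguerre n (Y w)).
Proof. by under eq_fun do rewrite laguerreE; exact: poly_square_intble. Qed.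

Lemma laguerre_orthonormal m n :
  \int[P]_w (laguerre m (Y w) * laguerre n (Y w)) = (m == n)%:R.
Proof.
under eq_Rintegral do rewrite !laguerreE -hornerM.
by rewrite Rintegral_poly laguerre_poly_orthonormal.
Qed.

(** The Laguerre polynomial of degree [n] has a nonzero leading coefficient, so
    that it expresses the power [n] by lower ones. *)
Lemma laguerre_orthogonal_moments (X : T -> R) : square_intble P X ->
  (forall n, \int[P]_w (X w * laguerre n (Y w)) = 0) -> moments_vanish P Y X.
Proof.
move=> sX Xl; split => // n; have [N] := ubnP n; elim: N n => // N IH n; rewrite ltnS => nN.
pose a : R := (-1) ^+ n * n`!%:R.
pose p : {poly R} := 'X^n - a *: laguerre_poly R n.
have n0 : n`!%:R != 0 :> R by rewrite pnatr_eq0 -lt0n fact_gt0.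
have pn : (size p <= n)%N.
  apply/leq_sizeP => j; rewrite leq_eqVlt => /orP[/eqP <-|nj].
    rewrite coefB coefXn eqxx coefZ laguerre_poly_coef /a.
    have s1 : (-1) ^+ n * (-1) ^+ n = 1 :> R by rewrite -exprMn mulN1r opprK expr1n.
    set s := (-1) ^+ n in s1 *.
    have -> : s * n`!%:R * (s / n`!%:R) = (s * s) * (n`!%:R / n`!%:R) by ring.
    by rewrite s1 divff// mulr1 subrr.
  rewrite coefB coefXn gtn_eqF// coefZ nth_default ?mulr0 ?subr0//.
  exact: leq_trans (laguerre_poly_size _ _) nj.
have E w : X w * Y w ^+ n = X w * p.[Y w] + a * (X w * laguerre n (Y w)).
  by rewrite /p hornerD hornerN hornerZ hornerXn laguerreE; ring.
have I1 : intble P (fun w => X w * p.[Y w]) by apply: square_intble_mul => //; exact: poly_square_intble.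
have I2 : intble P (fun w => X w * laguerre n (Y w)).
  by apply: square_intble_mul => //; exact: laguerre_square_intble.
transitivity (\int[P]_w (X w * p.[Y w] + a * (X w * laguerre n (Y w)))).
  by apply: eq_Rintegral => w _; exact: E.
rewrite RintegralD//; last exact: intbleZ.
have -> : \int[P]_w (a * (X w * laguerre n (Y w))) = 0.
  transitivity (a * \int[P]_w (X w * laguerre n (Y w))); first exact: RintegralZl.
  by rewrite Xl mulr0.
rewrite addr0.
have IX i : intble P (fun w => p`_i * (X w * Y w ^+ i)).
  by apply: intbleZ; apply: square_intble_mul => //; exact: (power_square_intble mY Y0 momY).
transitivity (\int[P]_w \sum_(i <- iota 0 (size p)) p`_i * (X w * Y w ^+ i)).
  apply: eq_Rintegral => w _; have /(congr1 (fun f => f w)) -> := horner_sumE p.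
  by rewrite mulr_sumr; apply: eq_bigr => i _; rewrite mulrCA.
rewrite Rintegral_sum// big_seq big1// => i; rewrite mem_iota add0n/= => ip.
transitivity (p`_i * \int[P]_w (X w * Y w ^+ i)).
  by apply: RintegralZl => //; apply: square_intble_mul => //; exact: (power_square_intble mY Y0 momY).
by rewrite IH ?mulr0// (leq_trans ip)// (leq_trans pn).
Qed.

End laguerre_random.

(** * Orthonormal series in one variable *)

Section orthonormal_series.
Context (R : realType) (d : measure_display) (T : measurableType d).
Variables (P : probability T R) (Y : T -> R) (e : nat -> R -> R).
Hypotheses (mY : measurable_fun [set: T] Y)
  (me : forall n, measurable_fun [set: R] (e n))
  (se : forall n, square_intble P (fun w => e n (Y w)))
  (oe : forall m n, \int[P]_w (e m (Y w) * e n (Y w)) = (m == n)%:R).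
Implicit Types (a : nat -> R) (s : seq nat) (Z : T -> R).

Definition expansion a s (x : R) : R := \sum_(n <- s) a n * e n x.

Lemma measurable_expansion a s : measurable_fun [set: R] (expansion a s).
Proof. by apply: measurable_sum => n; exact: measurable_funM. Qed.

Lemma expansion_square_intble a s : square_intble P (fun w => expansion a s (Y w)).
Proof. by apply: square_intble_sum => n; exact: square_intbleZ. Qed.

Lemma Rintegral_expansion_mul a s Z : square_intble P Z ->
  \int[P]_w (Z w * expansion a s (Y w)) = \sum_(n <- s) a n * \int[P]_w (Z w * e n (Y w)).
Proof.
move=> sZ; have I n : intble P (fun w => Z w * e n (Y w)) by exact: square_intble_mul.
transitivity (\int[P]_w \sum_(n <- s) a n * (Z w * e n (Y w))).
  apply: eq_Rintegral => w _; rewrite mulr_sumr; apply: eq_bigr => n _; exact: mulrCA.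
rewrite Rintegral_sum; last by move=> n; exact: intbleZ.
by apply: eq_bigr => n _; apply: RintegralZl => //; exact: I.
Qed.

Lemma Rintegral_expansion_coef a s m : uniq s ->
  \int[P]_w (e m (Y w) * expansion a s (Y w)) = if m \in s then a m else 0.
Proof.
move=> us; rewrite Rintegral_expansion_mul//.
under eq_bigr do rewrite oe.
case: ifPn => ms.
  rewrite (bigD1_seq m)//= eqxx mulr1 big1 ?addr0// => n nm.
  by rewrite eq_sym (negbTE nm) mulr0.
rewrite big_seq big1// => n ns; case: eqP => [mn|]; last by rewrite mulr0.
by rewrite mn ns in ms.
Qed.

Lemma Rintegral_expansion_sqr a s : uniq s ->
  \int[P]_w (expansion a s (Y w) ^+ 2) = \sum_(n <- s) a n ^+ 2.
Proof.
move=> us; under eq_Rintegral do rewrite expr2.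
rewrite Rintegral_expansion_mul; last exact: expansion_square_intble.
rewrite big_seq [RHS]big_seq; apply: eq_bigr => n ns; rewrite expr2; congr (_ * _).
under eq_Rintegral do rewrite mulrC.
by rewrite Rintegral_expansion_coef// ns.
Qed.

Lemma bessel Z s : square_intble P Z -> uniq s ->
  \sum_(n <- s) (\int[P]_w (Z w * e n (Y w))) ^+ 2 <= \int[P]_w (Z w ^+ 2).
Proof.
move=> sZ us; pose a n := \int[P]_w (Z w * e n (Y w)); have sE := expansion_square_intble a s.
have : 0 <= \int[P]_w ((Z w - expansion a s (Y w)) ^+ 2).
  by apply: Rintegral_ge0 => w _; exact: sqr_ge0.
have E w : (Z w - expansion a s (Y w)) ^+ 2 = Z w ^+ 2 +
  (expansion a s (Y w) ^+ 2 - 2 * (Z w * expansion a s (Y w))) by ring.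
under eq_Rintegral do rewrite E.
have I1 := square_intble_mul sZ sE; have [_ I2] := sE; have [_ I3] := sZ.
rewrite RintegralD//; last by apply: (intbleB I2); exact: intbleZ.
rewrite RintegralB//; last exact: intbleZ.
rewrite RintegralZl// Rintegral_expansion_sqr// Rintegral_expansion_mul//.
under [X in 2 * X]eq_bigr do rewrite -expr2.
rewrite -/(a _); lra.
Qed.

(** Partial sums are Cauchy in square mean. Along a subsequence [N] their
    increments [D j] are so small that the series of [4^j (D j)^2] is integrable,
    so that almost surely [|D j| <= h0 / 2^j] for a square integrable [h0]. The sum
    [phi] is the limit along [N] at all points [x] where such a bound holds; as a
    limit of functions of one real variable it depends on [Y] only. *)
Lemma riesz_fischer a (C : R) :
  (forall N, \sum_(n <- iota 0 N) a n ^+ 2 <= C) ->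
  exists phi : R -> R, [/\ measurable_fun [set: R] phi,
    square_intble P (phi \o Y) &
    \int[P]_w ((phi (Y w) - expansion a (iota 0 N) (Y w)) ^+ 2) @[N --> \oo] --> 0].
Proof.
move=> aC; pose c N := \sum_(n <- iota 0 N) a n ^+ 2.
have cmon m n : (m <= n)%N -> c m <= c n.
  move=> mn; rewrite /c -(subnKC mn) iotaD big_cat/= lerDl.
  by apply: sumr_ge0 => i _; exact: sqr_ge0.
have sc : has_sup (range c).
  by split; [exists (c 0%N), 0%N|exists C => _ [N _ <-]; exact: aC].
have csup n : c n <= sup (range c) by apply: ub_le_sup; [case: sc|exists n].
have /choice[N0 HN0] : forall k, exists n, sup (range c) - c n <= 8^-1 ^+ k.
  move=> k; have [_ [n _ <-] lt] := sup_adherent (exprn_gt0 k (ltac:(by rewrite invr_gt0) : 0 < 8^-1 :> R)) sc.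
  by exists n; rewrite lerBlDr -lerBlDl; exact: ltW.
(* Increasing, at least [k], and beyond [N0 k]. *)
pose N k := (\sum_(j <- iota 0 k.+1) (N0 j).+1)%N.
have NN0 k : (N0 k <= N k)%N by rewrite /N big_iota_recr (leq_trans (leqnSn _))// leq_addl.
have Nmon k : (N k <= N k.+1)%N by rewrite /N [in leqRHS]big_iota_recr leq_addr.
have kN k : (k <= N k)%N.
  elim: k => // k IH; apply: (leq_ltn_trans IH).
  by rewrite /N [in ltnRHS]big_iota_recr -[X in (X < _)%N]addn0 ltn_add2l.
have HN k n : (N k <= n)%N -> sup (range c) - c n <= 8^-1 ^+ k.
  move=> Nn; apply: le_trans (HN0 k); rewrite lerB// cmon// (leq_trans _ Nn)//.
pose S n x := expansion a (iota 0 n) x.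
have sS n : square_intble P (fun w => S n (Y w)) by exact: expansion_square_intble.
have S2 m n : (m <= n)%N -> \int[P]_w ((S n (Y w) - S m (Y w)) ^+ 2) = c n - c m.
  move=> mn; transitivity (\int[P]_w (expansion a (iota m (n - m)) (Y w) ^+ 2)).
    apply: eq_Rintegral => w _; congr (_ ^+ 2); rewrite /S /expansion.
    have -> : iota 0 n = iota 0 m ++ iota m (n - m) by rewrite -{1}(subnKC mn) iotaD add0n.
    by rewrite big_cat/= addrAC subrr add0r.
  rewrite Rintegral_expansion_sqr ?iota_uniq// /c.
  have -> : iota 0 n = iota 0 m ++ iota m (n - m) by rewrite -{1}(subnKC mn) iotaD add0n.
  by rewrite big_cat/= addrAC subrr add0r.
pose D j x := S (N j.+1) x - S (N j) x.
have ID j : intble P (fun w => 4 ^+ j * D j (Y w) ^+ 2).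
  by apply: intbleZ; have [] := square_intbleB (sS (N j.+1)) (sS (N j)).
pose G k w := \sum_(j <- iota 0 k) 4 ^+ j * D j (Y w) ^+ 2.
have G0 j w : 0 <= 4 ^+ j * D j (Y w) ^+ 2 by apply: mulr_ge0; [exact: exprn_ge0|exact: sqr_ge0].
have IG k : intble P (G k) by exact: intble_sum.
have [k|k w|k w|k|g [Ig g0 _ Gg]] := @monotone_limit_intble _ _ _ P G 2.
- exact: intble_measurable.
- exact: sumr_ge0.
- by rewrite /G big_iota_recr lerDl.
- rewrite -EFin_Rintegral// lee_fin Rintegral_sum//.
  suff : \sum_(j <- iota 0 k) \int[P]_w (4 ^+ j * D j (Y w) ^+ 2) <= 2 - 2 * 2^-1 ^+ k.
    have : 0 <= 2^-1 ^+ k :> R by rewrite exprn_ge0// invr_ge0.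
    by move=> q0 H; lra.
  elim: k => [|k IH]; first by rewrite big_nil expr0 mulr1 subrr.
  rewrite big_iota_recr.
  have : \int[P]_w (4 ^+ k * D k (Y w) ^+ 2) <= 2^-1 ^+ k.
    rewrite RintegralZl//; last by have [] := square_intbleB (sS (N k.+1)) (sS (N k)).
    rewrite S2//; apply: (@le_trans _ _ (4 ^+ k * 8^-1 ^+ k)).
      by rewrite ler_wpM2l ?exprn_ge0// (le_trans _ (HN k _ (leqnn _)))// lerB.
    by rewrite -exprMn (_ : 4 / 8 = 2^-1)//; lra.
  by move: IH; rewrite exprS mulrA divff// mul1r; lra.
pose B := [set x | exists m : nat, forall j, `|D j x| <= m%:R * 2^-1 ^+ j].
have mD j : measurable_fun [set: R] (fun x => `|D j x|).
  by apply: measurableT_comp => //; apply: measurable_funB; exact: measurable_expansion.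
have mB : measurable B.
  rewrite [X in measurable X](_ : _ =
      \bigcup_m \bigcap_j ((fun x => `|D j x|) @^-1` `]-oo, m%:R * 2^-1 ^+ j]%classic)).
    apply: bigcupT_measurable => m; apply: bigcapT_measurable => j.
    by rewrite -[X in measurable X]setTI; apply: mD => //; exact: measurable_itv.
  apply/seteqP; split => x.
    by move=> [m Hm]; exists m => // j _ /=; rewrite in_itv/=.
  by move=> [m _ Hm]; exists m => j; have := Hm j I; rewrite /= in_itv.
have SD x m k l : 0 <= m -> (forall j, `|D j x| <= m * 2^-1 ^+ j) -> (k <= l)%N ->
    `|S (N l) x - S (N k) x| <= 2 * m * 2^-1 ^+ k.
  move=> m0 Dm kl.
  have q0 i : 0 <= 2^-1 ^+ i :> R by rewrite exprn_ge0// invr_ge0.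
  suff : `|S (N l) x - S (N k) x| <= 2 * m * (2^-1 ^+ k - 2^-1 ^+ l).
    by move=> /le_trans; apply; rewrite ler_wpM2l ?mulr_ge0// gerBl.
  rewrite -(subnKC kl); elim: (l - k)%N => [|i IH].
    by rewrite addn0 !subrr normr0 mulr0.
  rewrite addnS exprS.
  have -> : S (N (k + i).+1) x - S (N k) x = (S (N (k + i)%N) x - S (N k) x) + D (k + i)%N x.
    by rewrite /D; ring.
  apply: (le_trans (ler_normD _ _)); have := Dm (k + i)%N; move: IH.
  by set q := 2^-1 ^+ (k + i); set a1 := `|_|; set a2 := `|_|; lra.
have cvB x : B x -> cvgn (fun k => S (N k) x).
  move=> [m Hm]; apply: cauchy_cvg; apply: cauchy_exP => eps eps0.
  have cv0 : 2 * m%:R * 2^-1 ^+ k @[k --> \oo] --> 2 * m%:R * (0 : R).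
    by apply: cvgM; [exact: cvg_cst|exact: cvg_half0].
  rewrite mulr0 in cv0; have [k _ Hk] := cvgr_lt _ cv0 _ eps0.
  exists (S (N k) x); exists k => // l /= kl; rewrite /ball/= distrC.
  exact: le_lt_trans (SD x _ k l (ler0n _ m) Hm kl) (Hk k (leqnn _)).
pose phi x := lim (S (N k) x * \1_B x @[k --> \oo]).
have cvphi x : S (N k) x * \1_B x @[k --> \oo] --> phi x.
  suff : cvgn (fun k => S (N k) x * \1_B x) by [].
  have [Bx|nB] := pselect (B x).
    by apply: is_cvgM; [exact: cvB|exact: is_cvg_cst].
  by rewrite indicE memNset//; under eq_fun do rewrite mulr0; exact: is_cvg_cst.
have mphi : measurable_fun [set: R] phi.
  apply: (measurable_fun_cvg (h := fun k x => S (N k) x * \1_B x)) => [k|x _]; last exact: cvphi.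
  by apply: measurable_funM; [exact: measurable_expansion|exact: measurable_indic].
pose h0 w := Num.sqrt (g w).
have Dh : {ae P, forall w, forall j, `|D j (Y w)| <= h0 w * 2^-1 ^+ j}.
  apply: filterS Gg => w Gw j.
  rewrite exprVn ler_pdivlMr ?exprn_gt0// -ler_sqr ?nnegrE ?sqrtr_ge0 ?mulr_ge0 ?exprn_ge0//.
  rewrite sqr_sqrtr// exprMn real_normK ?num_real// -exprM mulnC exprM.
  rewrite [2 ^+ 2](_ : _ = 4); last by rewrite -natrX.
  rewrite mulrC; apply: le_trans (Gw j.+1).
  by rewrite /G big_iota_recr lerDr sumr_ge0.
have aeB : {ae P, forall w, B (Y w)}.
  apply: filterS Dh => w Dw; exists (Num.trunc (h0 w)).+1 => j.
  by rewrite (le_trans (Dw j))// ler_wpM2r ?exprn_ge0 ?invr_ge0// ltW// truncnS_gt.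
have aecv : {ae P, forall w, S (N k) (Y w) @[k --> \oo] --> phi (Y w)}.
  apply: filterS aeB => w Bw; have := cvphi (Y w).
  by rewrite indicE mem_set//; under eq_fun do rewrite mulr1.
pose h w := `|S (N 0%N) (Y w)| + 2 * h0 w.
have sh0 : square_intble P h0.
  split; first by apply: measurableT_comp (intble_measurable Ig);
    apply: continuous_measurable_fun; exact: sqrt_continuous.
  by under eq_fun => w do rewrite sqr_sqrtr//.
have sh : square_intble P h.
  apply: square_intbleD; last exact: square_intbleZ.
  apply: square_intble_le (sS (N 0%N)) => [|w]; last by rewrite normr_id.
  by apply: measurableT_comp => //; case: (sS (N 0%N)).
have h_ge0 w : 0 <= h w by rewrite addr_ge0// mulr_ge0 ?sqrtr_ge0.
have Sh : {ae P, forall w, forall k, `|S (N k) (Y w)| <= h w}.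
  apply: filterS Dh => w Dw k.
  rewrite -[S (N k) _](subrK (S (N 0%N) (Y w))) addrC (le_trans (ler_normD _ _))// lerD2l.
  by have := SD _ _ _ _ (sqrtr_ge0 (g w)) Dw (leq0n k); rewrite expr0 mulr1.
have mphiY : measurable_fun [set: T] (phi \o Y) by exact: measurableT_comp.
have key n : intble P (fun w => (phi (Y w) - S n (Y w)) ^+ 2) /\
    \int[P]_w ((S (N k) (Y w) - S n (Y w)) ^+ 2) @[k --> \oo] -->
    \int[P]_w ((phi (Y w) - S n (Y w)) ^+ 2).
  have sn : square_intble P (fun w => h w + `|S n (Y w)|).
    apply: square_intbleD => //; apply: square_intble_le (sS n) => [|w].
      by apply: measurableT_comp => //; case: (sS n).
    by rewrite normr_id.
  have [mn In] := sn.
  apply: (dominated_cvg _ _ _ In).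
  - by move=> k; apply: measurable_funX; apply: measurable_funB; [case: (sS (N k))|case: (sS n)].
  - by apply: measurable_funX; apply: measurable_funB => //; case: (sS n).
  - apply: filterS aecv => w cw; have cn : S (N k) (Y w) - S n (Y w) @[k --> \oo] --> phi (Y w) - S n (Y w).
      by apply: cvgB => //; exact: cvg_cst.
    by under eq_fun do rewrite expr2; rewrite expr2; exact: cvgM.
  - apply: filterS Sh => w Sw k; rewrite normrX lerXn2r ?nnegrE ?(addr_ge0 (h_ge0 w))//.
    by rewrite (le_trans (ler_normB _ _))// lerD2r.
exists phi; split => //.
  split => //; have [I0 _] := key 0%N; move: I0.
  by under eq_fun do rewrite /S /expansion big_nil subr0.
have ub n : \int[P]_w ((phi (Y w) - S n (Y w)) ^+ 2) <= sup (range c) - c n.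
  have [_ cv] := key n; apply: (cvgr_to_le cv).
  near=> k; rewrite S2; first by rewrite lerB.
  by rewrite (leq_trans _ (kN k))//; near: k; exact: nbhs_infty_ge.
apply: (@squeeze_cvgr _ _ _ _ (cst 0) (fun n => sup (range c) - c n)).
- by apply: nearW => n; rewrite ub andbT; apply: Rintegral_ge0 => w _; exact: sqr_ge0.
- exact: cvg_cst.
- rewrite -[X in _ --> X](subrr (sup (range c))); apply: cvgB; first exact: cvg_cst.
  apply: nondecreasing_cvgn; last by case: sc.
  exact: cmon.
Unshelve. all: by end_near. Qed.

End orthonormal_series.

(** * Truncation *)

Section truncation.
Context (R : realType).

Definition truncate (K x : R) : R := Num.max (- K) (Num.min x K).

Lemma truncate_id K x : `|x| <= K -> truncate K x = x.
Proof.
rewrite ler_norml => /andP[Kx xK]; rewrite /truncate.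
by rewrite (min_idPl xK) (max_idPr Kx).
Qed.

Lemma truncate_le K x : 0 <= K -> `|truncate K x| <= K.
Proof.
move=> K0; rewrite ler_norml /truncate le_max lexx/= ge_max ge_min lexx orbT andbT.
by rewrite (le_trans _ K0)// oppr_le0.
Qed.

Lemma truncate_le_norm K x : 0 <= K -> `|truncate K x| <= `|x|.
Proof.
move=> K0; rewrite ler_norml /truncate; apply/andP; split.
  rewrite le_max le_min; case: (leP (- `|x|) (- K)) => //= Kx.
  rewrite lerNnormlW//=; first by rewrite (le_trans _ K0)// oppr_le0.
by rewrite ge_max ge_min ler_norm/= andbT (le_trans _ (normr_ge0 x))// oppr_le0.
Qed.

Lemma continuous_truncate K : continuous (truncate K).
Proof.
have c k x : {for x, continuous (cst k : R -> R^o)} by exact: cst_continuous.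
by move=> x; exact: (continuous_max (c (- K) x) (continuous_min (@cvg_id _ (nbhs x)) (c K x))).
Qed.

Lemma measurable_truncate K : measurable_fun [set: R] (truncate K).
Proof. by apply: continuous_measurable_fun; exact: continuous_truncate. Qed.

End truncation.

(** * The dual optional projection of an honest time *)

Section complete_probability.
Context (R : realType) (d : measure_display) (T : measurableType d).
Variables (P : probability T R).
Hypothesis cP : measure_is_complete P.

Lemma ae_eq_integral_complete (f g : T -> \bar R) : measurable_fun [set: T] g ->
  {ae P, forall w, f w = g w} -> (\int[P]_w f w = \int[P]_w g w)%E.
Proof.
move=> mg fg.
have gf : ae_eq P setT g f by apply: filterS fg => w ->.
have mf := ae_measurable_fun cP gf mg.
by apply: ae_eq_integral => //; apply: filterS fg => w -> .
Qed.

Lemma prob_eq0_of_integral (D : set T) (g : T -> \bar R) (e : R) : 0 < e ->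
  measurable D -> (forall w, 0 <= g w)%E -> (forall w, D w -> e%:E <= g w)%E ->
  (\int[P]_w g w = 0)%E -> P D = 0%E.
Proof.
move=> e0 mD g0 Dg g_eq0; apply/eqP; rewrite eq_le measure_ge0 andbT.
rewrite -(@pmule_rle0 _ e%:E)// -g_eq0 -[X in P X]setIT -(integral_indic P measurableT mD).
rewrite -ge0_integralZl_EFin//; last 2 first.
- exact/measurable_EFinP/measurable_indic.
- exact: ltW.
apply: ge0_le_integral_sup => w _; first by rewrite mule_ge0// lee_fin ltW.
rewrite indicE; case: (boolP (w \in D)) => [|_]; last by rewrite mule0.
by rewrite inE mule1; exact: Dg.
Qed.

Lemma ae_not_null_event (D : set T) : measurable D -> P D = 0%E -> {ae P, forall w, ~ D w}.
Proof. by move=> mD PD; exists D; split => // w /= /contrapT. Qed.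

End complete_probability.

Section dual_projection.
Context (R : realType) (d : measure_display) (T : measurableType d).
Variables (P : probability T R) (F : R -> set (set T)).
Hypothesis uF : usual_filtration P F.
Variable (L : T -> \bar R).
Hypotheses (honestL : honest_time F L) (L_neq0 : P [set w | L w = 0%E] = 0%E)
  (L_finite : P [set w | L w = +oo%E] = 0%E) (condA : avoids_stopping_times P F L).
Variable (A : T -> cumulative R R).
Hypothesis A_proj : dual_optional_projection P F L A.

Let mu w : {measure set (measurableTypeR R) -> \bar R} :=
  lebesgue_stieltjes_measure (A w).
Let tot w := mu w `[0%R, +oo[%classic.

Let sF t : 0 <= t -> sigma_algebra [set: T] (F t).
Proof. exact: (filtration_sigma_algebra uF). Qed.

Let cP : measure_is_complete P.
Proof.
by move=> N nN; apply: (filtration_sub uF (lexx 0)); exact: (filtration_complete uF).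
Qed.

Let mL : measurable_fun [set: T] L. Proof. by case: honestL. Qed.

Let A_neg w t : t < 0 -> A w t = 0. Proof. by case: A_proj => _ + _; apply. Qed.

Let A_adapted : adapted F (fun t w => A w t). Proof. by case: A_proj. Qed.

Lemma measurable_A t : measurable_fun [set: T] (fun w => A w t).
Proof.
have [t0|t0] := ltP t 0.
  by rewrite (_ : (fun _ => _) = cst 0)//; apply/funext => w; exact: A_neg.
exact: (measurable_wrt_measurable (filtration_sub uF t0) (A_adapted t0)).
Qed.

Lemma measurable_tot : measurable_fun [set: T] tot.
Proof.
apply: (emeasurable_fun_cvg (fun n w => (A w n%:R)%:E)).
  by move=> n; apply/measurable_EFinP; exact: measurable_A.
by move=> w _; apply: stieltjes_total; exact: A_neg.
Qed.

Lemma proj_integral H : optional_process F H ->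
  (exists C : R, forall t w, 0 <= t -> `|H t w| <= C) ->
  (\int[P]_w \int[mu w]_(s in `[0%R, +oo[) (H s w)%:E =
   \int[P]_w (value_at H (cst 0%R) L w)%:E)%E.
Proof. by move=> oH bH; case: A_proj => _ _ /(_ H oH bH); rewrite expectationE. Qed.

Lemma optional_sub_timeline (B : set (R * T)) :
  optional_sigma_algebra F B -> B `<=` timeline_prod (T := T).
Proof.
suff : optional_sigma_algebra F `<=` [set E : set (R * T) | E `<=` timeline_prod (T := T)].
  by apply.
apply: smallest_sub; last by move=> _ [X _] [D _ <-] /= z [].
split; [by move=> z|by move=> E _ z []|].
by move=> E HE z [n _]; exact: (HE n).
Qed.

Lemma optional_indic (B : set (R * T)) : optional_sigma_algebra F B ->
  optional_process F (fun s w => \1_B (s, w)).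
Proof.
move=> oB C mC.
have [opt0 optC optU] := optional_sigma F (T := T).
have OT : optional_sigma_algebra F (timeline_prod (T := T)) by have := optC _ opt0; rewrite setD0.
have sub := optional_sub_timeline oB.
have [C1|C1] := pselect (C 1); have [C0|C0] := pselect (C 0).
- rewrite [X in _ X](_ : _ = timeline_prod (T := T))//; apply/seteqP; split => z; first by case.
  by move=> tz; split => //=; rewrite indicE; case: (_ \in B).
- rewrite [X in _ X](_ : _ = B)//; apply/seteqP; split => -[s w] /=.
    by move=> [_]; rewrite indicE; case: (boolP (_ \in B)) => //; rewrite inE.
  by move=> Bz; split; [exact: sub|rewrite indicE mem_set].
- rewrite [X in _ X](_ : _ = timeline_prod (T := T) `\` B); first exact: optC.
  apply/seteqP; split => -[s w] /= [tz].
    by rewrite indicE; case: (boolP (_ \in B)) => //; rewrite notin_setE.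
  by move=> nB; split => //; rewrite indicE memNset.
- rewrite [X in _ X](_ : _ = set0)//; apply/seteqP; split => // -[s w] /= [_].
  by rewrite indicE; case: (_ \in B).
Qed.

Lemma optional_setI B C : optional_sigma_algebra F B -> optional_sigma_algebra F C ->
  optional_sigma_algebra F (B `&` C).
Proof.
have [opt0 optC optU] := optional_sigma F (T := T).
have sub := optional_sub_timeline.
move=> oB oC; set D := timeline_prod (T := T) in optC sub *.
have -> : B `&` C = D `\` ((D `\` B) `|` (D `\` C)).
  rewrite setDUr !setDD; apply/seteqP; split => z; first by move=> [Bz Cz]; split; split => //; apply: (sub B).
  by move=> [[_ ?] [_ ?]].
by apply: (optC); rewrite -bigcup2E; apply: optU => -[|[|n]]//=; exact: optC.
Qed.

(** The dual projection does not charge an optional set that almost surely does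
    not contain [L]. *)
Lemma prob_value_eq0 (B : set (R * T)) : optional_sigma_algebra F B ->
  {ae P, forall w, forall r, L w = r%:E -> ~ B (r, w)} ->
  (\int[P]_w \int[mu w]_(s in `[0%R, +oo[) (\1_B (s, w))%:E = 0)%E.
Proof.
move=> oB LB; rewrite proj_integral; last 2 first.
- exact: optional_indic.
- by exists 1 => t w _; rewrite indicE; case: (_ \in B); rewrite ?normr1 ?normr0.
rewrite (@ae_eq_integral_complete _ _ _ _ cP _ (cst 0%E))//; first by rewrite integral_cst// mul0e.
apply: filterS LB => w LB; rewrite /value_at.
case: (L w) LB => [r|//|//] /(_ r erefl) nB.
by rewrite indicE memNset.
Qed.

Lemma L_ge0 w : (0 <= L w)%E.
Proof. by have [_ [G _ ->]] := honestL; apply: ereal_sup_ubound; left. Qed.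

Lemma measurable_L_eq (x : \bar R) : measurable [set w | L w = x].
Proof.
by rewrite [X in measurable X](_ : _ = L @^-1` [set x])// -[X in measurable X]setTI; apply: mL.
Qed.

Lemma ae_L_fin : {ae P, forall w, exists r, 0 < r /\ L w = r%:E}.
Proof.
have H1 := ae_not_null_event (measurable_L_eq _) L_neq0.
have H2 := ae_not_null_event (measurable_L_eq _) L_finite.
apply: filterS2 H1 H2 => w /= L0 Loo.
have := L_ge0 w; case: (L w) L0 Loo => [r|//|//] L0 _.
rewrite lee_fin le_eqVlt => /orP[/eqP r0|r0]; first by rewrite -r0 in L0.
by exists r.
Qed.

Lemma optional_cst (k : R) : optional_process F (fun _ _ => k).
Proof.
apply: optional_process_cadlag.
  move=> t t0 B mB; have [Bk|Bk] := pselect (B k).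
    rewrite [X in F t X](_ : _ = setT); first exact: sigma_setT (sF t0).
    by apply/seteqP; split.
  rewrite [X in F t X](_ : _ = set0); first exact: sigma_set0 (sF t0).
  by apply/seteqP; split.
by move=> w; split => t _; [exact: cvg_cst|exact: is_cvg_cst].
Qed.

Lemma integral_tot : (\int[P]_w tot w = 1)%E.
Proof.
have := proj_integral (optional_cst 1).
have bd : exists C : R, forall (t : R) (w : T), 0 <= t -> `|(1 : R)| <= C by exists 1 => *; rewrite normr1.
move=> /(_ bd).
under eq_integral do rewrite integral_cst//= mul1e.
move=> ->; rewrite (@ae_eq_integral_complete _ _ _ _ cP _ (cst 1%E))//.
  by rewrite integral_cst// mul1e; exact: probability_setT.
by apply: filterS ae_L_fin => w [r [_ Lr]]; rewrite /value_at Lr.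
Qed.

Lemma ae_tot_fin : {ae P, forall w, (tot w < +oo)%E}.
Proof.
have I : P.-integrable setT tot.
  apply/integrableP; split; first exact: measurable_tot.
  by under eq_integral do rewrite gee0_abs//; rewrite integral_tot ltry.
by apply: filterS (integrable_ae measurableT I) => w /(_ Logic.I); rewrite ge0_fin_numE.
Qed.

Definition A_oo (w : T) : R := terminal_value (fun t w => A w t) w.

Lemma A_oo_total w : (tot w < +oo)%E -> A_oo w = fine (tot w).
Proof.
move=> fin; apply/cvg_lim => //.
by apply: (cvg_path_total (f := A w)) => //; exact: A_neg.
Qed.

Lemma A_oo_ge0 w : 0 <= A_oo w.
Proof.
have [cv|/dvgP] := pselect (cvg (A w t @[t --> +oo%R])); last by rewrite /A_oo /terminal_value => ->.
apply: limr_ge => //; apply: nearW => t; apply: path_ge0; exact: A_neg.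
Qed.

Lemma measurable_A_oo : measurable_fun [set: T] A_oo.
Proof.
apply: (@ae_measurable _ _ _ P (fine \o tot)) => //.
  by apply: filterS ae_tot_fin => w fin; rewrite A_oo_total.
exact: measurableT_comp measurable_tot.
Qed.

Lemma ae_tot_A_oo : {ae P, forall w, tot w = (A_oo w)%:E}.
Proof. by apply: filterS ae_tot_fin => w fin; rewrite A_oo_total// fineK// ge0_fin_numE. Qed.

Lemma ae_A_le : {ae P, forall w, forall t, A w t <= A_oo w}.
Proof.
apply: filterS ae_tot_fin => w fin t; rewrite A_oo_total//.
by apply: (path_le_total (f := A w)) => //; exact: A_neg.
Qed.

Lemma ae_A_cvg : {ae P, forall w, A w t @[t --> +oo%R] --> A_oo w}.
Proof.
apply: filterS ae_tot_fin => w fin; rewrite A_oo_total//.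
by apply: (cvg_path_total (f := A w)) => //; exact: A_neg.
Qed.

Lemma intble_A_oo : intble P A_oo /\ \int[P]_w A_oo w = 1.
Proof.
have E : (\int[P]_w (A_oo w)%:E = 1)%E.
  rewrite -integral_tot; apply: (ae_eq_integral_complete cP); first exact: measurable_tot.
  by apply: filterS ae_tot_A_oo => w ->.
have I : intble P A_oo.
  apply/integrableP; split; first exact/measurable_EFinP/measurable_A_oo.
  under eq_integral do rewrite /= ger0_norm ?A_oo_ge0//.
  by rewrite E ltry.
by split => //; rewrite /Rintegral E.
Qed.

Lemma stopping_time_cst (q : R) : 0 <= q -> stopping_time F (fun=> q%:E).
Proof.
move=> q0; split => // t t0; have [qt|qt] := leP q t.
  rewrite [X in F t X](_ : _ = setT); first exact: sigma_setT (sF t0).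
  by apply/seteqP; split => // w _ /=; rewrite lee_fin.
rewrite [X in F t X](_ : _ = set0); first exact: sigma_set0 (sF t0).
by apply/seteqP; split => // w /=; rewrite lee_fin leNgt qt.
Qed.

Lemma measurable_stopping_time tau : stopping_time F tau -> measurable_fun [set: T] tau.
Proof.
move=> [tau0 st]; apply: (measurability _ (ErealGenInftyO.measurableE R)) => _ [_ [x ->] <-].
rewrite setTI [X in measurable X](_ : _ =
    \bigcup_n [set w | (tau w <= (x - n.+1%:R^-1)%:E)%E]).
  apply: bigcupT_measurable => n; have [y0|y0] := ltP (x - n.+1%:R^-1) 0.
    rewrite [X in measurable X](_ : _ = set0)//; apply/seteqP; split => // w /=.
    by move=> /(le_trans (tau0 w)); rewrite lee_fin leNgt y0.
  exact: (filtration_sub uF y0 (st _ y0)).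
apply/seteqP; split => w /=; last first.
  move=> [n _ /=] /le_lt_trans; rewrite in_itv/=; apply.
  by rewrite lte_fin ltrBlDr ltrDl invr_gt0.
rewrite in_itv/=; have := tau0 w; case Dy : (tau w) => [y||]//= _; rewrite lte_fin => yx.
near \oo => n; exists n => //=; rewrite Dy lee_fin lerBrDl -lerBrDr; apply/ltW; near: n.
by apply: (near_infty_natSinv_lt (PosNum (_ : 0 < x - y))); rewrite subr_gt0.
Unshelve. all: by end_near. Qed.

Lemma measurable_stopping_oo tau : stopping_time F tau -> measurable [set w | tau w = +oo%E].
Proof.
move=> /measurable_stopping_time mtau.
by rewrite -[X in measurable X]setTI; apply: (mtau measurableT [set +oo%E]).
Qed.

(** [A] does not increase after [L]: the times [s >= q] before the next point of
    [Gamma] form an optional set, which does not contain [L] unless [L = q], an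
    event of probability zero. Indeed, if [L > q] there is a point of [Gamma]
    between [q] and [L], because [L] is a supremum. Hence [A] does not charge this
    set, and if [L < q] it is the whole half-line from [q] on. *)
Lemma A_constant_after q : 0 <= q ->
  {ae P, forall w, (L w < q%:E)%E -> A w q = A_oo w}.
Proof.
move=> q0; have [_ [Gamma oG LG]] := honestL.
pose D := debut Gamma q.
have stD : stopping_time F D by exact: (stopping_time_debut uF).
pose B : set (R * T) := [set z | 0 <= z.1 /\ (q%:E <= z.1%:E)%E] `\`
   [set z | 0 <= z.1 /\ (D z.2 <= z.1%:E)%E].
have oB : optional_sigma_algebra F B.
  have [opt0 optC optU] := optional_sigma F (T := T).
  rewrite [X in _ X](_ : _ = [set z | 0 <= z.1 /\ (q%:E <= z.1%:E)%E] `&`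
    (timeline_prod (T := T) `\` [set z | 0 <= z.1 /\ (D z.2 <= z.1%:E)%E])).
    apply: optional_setI; first exact: (optional_after uF (stopping_time_cst q0)).
    by apply: (optC); exact: (optional_after uF).
  by apply/seteqP; split => z [[z0 qz] H]; split => //; case: H.
have LB : {ae P, forall w, forall r, L w = r%:E -> ~ B (r, w)}.
  have Lq := ae_not_null_event (measurable_L_eq _) (condA (stopping_time_cst q0)).
  apply: filterS Lq => w /= Lq r Lr [[/= r0 qr] nD].
  move: qr; rewrite lee_fin le_eqVlt => /orP[/eqP qr|qr]; first by rewrite Lr qr in Lq.
  apply: nD; split => //=.
  have : (q%:E < L w)%E by rewrite Lr lte_fin.
  rewrite {1}LG => /ereal_sup_gt[_ [->|[u Gu <-]]].
    by rewrite lte_fin ltNge q0.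
  rewrite lte_fin => qu; apply: (@le_trans _ _ u%:E).
    by apply: ereal_inf_lbound; exists u.
  by rewrite -Lr LG; apply: ereal_sup_ubound; right; exists u.
have I0 := prob_value_eq0 oB LB.
have key : {ae P, forall w, forall k : nat,
    ~ (D w = +oo%E /\ (A w q)%:E + (k.+1%:R^-1)%:E <= tot w)%E}.
  apply: ae_foralln => k.
  pose E := [set w | D w = +oo%E] `&` [set w | (A w q)%:E + (k.+1%:R^-1)%:E <= tot w]%E.
  have mE : measurable E.
    apply: measurableI; first exact: measurable_stopping_oo.
    rewrite -[X in measurable X]setTI; apply: emeasurable_fun_le => //; last exact: measurable_tot.
    by apply: emeasurable_funD => //; apply/measurable_EFinP; exact: measurable_A.
  apply: (ae_not_null_event mE).
  apply: (@prob_eq0_of_integral _ _ _ P E _ (k.+1%:R^-1) _ mE _ _ I0).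
  - by rewrite invr_gt0.
  - by move=> w; apply: integral_ge0 => s _; rewrite lee_fin indicE.
  - move=> w [/= Doo le_].
    apply: (@le_trans _ _ (mu w `]q, +oo[%classic)).
      have tE : tot w = ((A w q)%:E + mu w `]q, +oo[%classic)%E.
        rewrite -(stieltjes_0c (@A_neg w) q0) -measureU//.
          congr (mu w _); apply/seteqP; split => x /=; rewrite !in_itv/= ?andbT.
            by move=> x0; case: (leP x q) => xq; [left; rewrite x0|right].
          by move=> [/andP[]//|/ltW]; exact: le_trans.
        by apply/seteqP; split => // x [] /=; rewrite !in_itv/= andbT => /andP[_ xt]; rewrite ltNge xt.
      by move: le_; rewrite tE leeD2lE.
    apply: (@ge_integral_subset _ _ _ (mu w) `[0%R, +oo[%classic `]q, +oo[%classic
      (fun s => \1_B (s, w))).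
    - exact: measurable_itv.
    - exact: measurable_itv.
    - by move=> x /=; rewrite !in_itv/= !andbT => /ltW; exact: le_trans.
    - by move=> x _; rewrite indicE.
    - move=> x /=; rewrite in_itv/= andbT => qx; rewrite indicE mem_set//.
      split => /=; first by split; [exact: le_trans (ltW qx)|rewrite lee_fin ltW].
      by move=> [_]; rewrite Doo leNgt ltry.
apply: filterS3 key ae_tot_A_oo ae_A_le => w key totw Ale Lq.
apply/eqP; rewrite eq_le Ale/=; apply/ler_addgt0Pr => e e0.
have Doo : D w = +oo%E.
  apply/eqP; rewrite -leye_eq; apply: le_ereal_inf_tmp => _ [u [qu Gu] <-].
  exfalso; move: qu; apply/negP; rewrite -leNgt -lee_fin; apply: le_trans (ltW Lq).
  by rewrite LG; apply: ereal_sup_ubound; right; exists u.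
near \oo => k; have := key k; rewrite totw -EFinD lee_fin => nle.
have : ~ (A w q + k.+1%:R^-1 <= A_oo w) by move=> H; apply: nle.
move/negP; rewrite -ltNge => /ltW /le_trans; apply; rewrite lerD2l; apply/ltW.
near: k; exact: near_infty_natSinv_lt (PosNum e0).
Unshelve. all: by end_near. Qed.

Lemma ae_A_L : {ae P, forall w, forall r, L w = r%:E -> A w r = A_oo w}.
Proof.
have H : {ae P, forall w, forall n k : nat,
    (L w < (k%:R / 2 ^+ n)%:E)%E -> A w (k%:R / 2 ^+ n) = A_oo w}.
  apply: ae_foralln => n; apply: ae_foralln => k; apply: A_constant_after.
  by rewrite divr_ge0// exprn_ge0.
apply: filterS H => w H r Lr.
have r0 : 0 <= r by rewrite -lee_fin -Lr L_ge0.
have rc := cumulative_is_right_continuous (A w) r.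
have : A w (dyadic_up n r) @[n --> \oo] --> A w r.
  move/cvg_at_rightP : rc; apply; split; last exact: cvg_dyadic_up.
  by move=> n; exact: dyadic_up_gt.
rewrite (_ : (fun _ => _) = cst (A_oo w)).
  by move=> /cvg_lim <-//; rewrite lim_cst.
by apply/funext => n; rewrite /dyadic_up H// Lr lte_fin dyadic_up_gt.
Qed.

Lemma optional_bigcap (E : (set (R * T))^nat) :
  (forall n, optional_sigma_algebra F (E n)) -> optional_sigma_algebra F (\bigcap_n E n).
Proof.
move=> oE; have [opt0 optC optU] := optional_sigma F (T := T).
have -> : \bigcap_n E n = timeline_prod (T := T) `\` \bigcup_n (timeline_prod (T := T) `\` E n).
  apply/seteqP; split => z.
    move=> Ez; split; last by move=> [n _ [_ nE]]; apply: nE; exact: Ez.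
    by apply: (optional_sub_timeline (oE 0%N)); exact: Ez.
  by move=> [tz nE] n _; apply: contrapT => nEz; apply: nE; exists n.
by apply: (optC); apply: optU => n; exact: optC.
Qed.

(** Times at which [A] increases by at least [e] over each interval to the left;
    at [0] the convention [A_t = 0] for [t < 0] makes the initial mass a jump. *)
Definition jumps (e : R) : set (R * T) :=
  [set z | 0 <= z.1 /\ forall n, e <= A z.2 z.1 - A z.2 (z.1 - n.+1%:R^-1)].

Lemma cadlag_shift (h : R) : cadlag (fun t w => A w (t - h)).
Proof.
apply: cadlag_nondecreasing => [w s t st|w t t0].
  by apply: cumulative_is_nondecreasing; rewrite lerD2r.
have rc := cumulative_is_right_continuous (A w) (t - h).
apply/cvg_at_rightP => u [ut cu]; move/cvg_at_rightP : rc; apply; split.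
  by move=> n; rewrite ltrD2r.
by apply: cvgB => //; exact: cvg_cst.
Qed.

Lemma adapted_shift (h : R) : 0 <= h -> adapted F (fun t w => A w (t - h)).
Proof.
move=> h0 t t0; have [th|th] := ltP (t - h) 0.
  rewrite (_ : (fun _ => _) = fun=> 0); last by apply/funext => w; rewrite A_neg.
  apply/(measurable_wrtP (sF t0)); exact: measurable_cst.
move=> B mB; apply: (filtration_nondecreasing uF th); last exact: A_adapted.
by rewrite gerBl.
Qed.

Lemma optional_jumps (e : R) : optional_sigma_algebra F (jumps e).
Proof.
rewrite [X in _ X](_ : _ = \bigcap_n (timeline_prod (T := T) `&`
    [set z | `[e, +oo[%classic ((fun t w => A w (t - 0) - A w (t - n.+1%:R^-1)) z.1 z.2)])).
  apply: optional_bigcap => n.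
  apply: (@optional_preimage _ _ _ _ (fun t w => A w (t - 0) - A w (t - n.+1%:R^-1))
    `[e, +oo[%classic); last exact: measurable_itv.
    move=> t t0; apply/(measurable_wrtP (sF t0)); apply: measurable_funB;
      apply/(measurable_wrtP (sF t0)); exact: adapted_shift.
  by apply: cadlagB; exact: cadlag_shift.
apply/seteqP; split => z.
  by move=> [z0 Hz] n _; split => //=; rewrite in_itv/= andbT subr0.
move=> Hz; split; first by case: (Hz 0%N I).
by move=> n; case: (Hz n I) => _ /=; rewrite in_itv/= andbT subr0.
Qed.

(** By monotonicity there is no jump of size [e] just before [r], hence [r] is the
    first one after some dyadic time. *)
Lemma jump_debut w r e : 0 < e -> 0 < r -> jumps e (r, w) ->
  exists n k : nat, debut (jumps e) (k%:R / 2 ^+ n) w = r%:E.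
Proof.
move=> e0 r0 Jr.
pose S := [set A w s | s in [set s | s < r]].
have sS : has_sup S.
  split; first by exists (A w 0), 0.
  by exists (A w r) => _ [s sr <-]; apply: cumulative_is_nondecreasing; exact: ltW.
have [_ [s0 s0r <-] lt0] := sup_adherent e0 sS.
pose s1 := Num.max s0 0.
have s10 : 0 <= s1 by rewrite le_max lexx orbT.
have s1r : s1 < r by rewrite gt_max s0r.
have [n nr] : exists n, dyadic_up n s1 < r.
  near \oo => n; exists n; near: n; exact: (cvgr_lt _ (cvg_dyadic_up s10)).
exists n, (Num.trunc (s1 * 2 ^+ n)).+1; rewrite -/(dyadic_up n s1).
apply/eqP; rewrite eq_le; apply/andP; split.
  by apply: ereal_inf_lbound; exists r.
apply: le_ereal_inf_tmp => _ [u [qu [/= u0 Ju]] <-].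
rewrite lee_fin leNgt; apply/negP => ur.
have su : s0 < u.
  by apply: le_lt_trans qu; apply: le_trans (ltW (dyadic_up_gt n s1)); rewrite le_max lexx.
have Aus : A w u <= sup S by apply: ub_le_sup; [case: sS|exists u].
near \oo => m; have := Ju m.
suff : A w s0 <= A w (u - m.+1%:R^-1) by lra.
apply: cumulative_is_nondecreasing; rewrite lerBrDl -lerBrDr; apply/ltW; near: m.
by apply: (near_infty_natSinv_lt (PosNum (_ : 0 < u - s0))); rewrite subr_gt0.
Unshelve. all: by end_near. Qed.

(** The jump set is exhausted by countably many debuts, which [L] avoids; so the
    dual projection does not charge it, whereas it would charge each of its points
    with a mass of at least [e]. *)
Lemma ae_no_jump e : 0 < e -> {ae P, forall w, forall s, ~ jumps e (s, w)}.
Proof.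
move=> e0.
have stD q : 0 <= q -> stopping_time F (debut (jumps e) q).
  by move=> q0; apply: (stopping_time_debut uF) => //; exact: optional_jumps.
have dy0 n k : 0 <= k%:R / 2 ^+ n :> R by rewrite divr_ge0// exprn_ge0.
have mLD q : 0 <= q -> measurable [set w | L w = debut (jumps e) q w].
  move=> q0; rewrite -[X in measurable X]setTI.
  exact: (emeasurable_fun_eq measurableT mL (measurable_stopping_time (stD q q0))).
have LD : {ae P, forall w, forall n k : nat, L w <> debut (jumps e) (k%:R / 2 ^+ n) w}.
  apply: ae_foralln => n; apply: ae_foralln => k.
  by apply: (ae_not_null_event (mLD _ (dy0 n k))); exact: condA (stD _ (dy0 n k)).
have LJ : {ae P, forall w, forall r, L w = r%:E -> ~ jumps e (r, w)}.
  apply: filterS2 LD (ae_L_fin) => w LD [r' [r0 Lr']] r Lr Jr.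
  move: Lr; rewrite Lr' => -[rr']; rewrite rr' in Lr' r0.
  have [n [k Dr]] := jump_debut e0 r0 Jr.
  by apply: (LD n k); rewrite Dr.
have I0 := prob_value_eq0 (optional_jumps e) LJ.
pose D := [set w | debut (jumps e) 0 w = +oo%E].
have mD : measurable D by apply: (measurable_stopping_oo); exact: stD.
pose D0 := [set w | e <= A w 0].
have mD0 : measurable D0.
  rewrite -[X in measurable X]setTI; apply: measurable_fun_le => //.
  exact: (measurable_A).
have PD : P (~` D `|` D0) = 0%E.
  apply: (@prob_eq0_of_integral _ _ _ P _ _ e _ _ _ _ I0) => //.
  - by apply: measurableU => //; exact: measurableC.
  - by move=> w; apply: integral_ge0 => s _; rewrite lee_fin indicE.
  move=> w Dw; have [s Js] : exists s, jumps e (s, w).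
    case: Dw => [Dw|A0].
      have /debut_lt[u [_ _ Ju]] : (debut (jumps e) 0 w < (fine (debut (jumps e) 0 w) + 1)%:E)%E.
        have [d0 _] := stD 0 (lexx 0); have := d0 w.
        move: Dw; rewrite /D /=; case: (debut _ _ _) => [y||]//= _ _.
        by rewrite lte_fin ltrDl.
      by exists u.
    exists 0; split => //= n; rewrite sub0r [A w (- _)]A_neg ?subr0 ?oppr_lt0 ?invr_gt0//.
  have [/= s0 Hs] := Js.
  apply: (le_trans (stieltjes_jump s0 Hs)).
  apply: (@ge_integral_subset _ _ _ (mu w) `[0%R, +oo[%classic [set s] (fun s => \1_(jumps e) (s, w))).
  - exact: measurable_itv.
  - exact: measurable_set1.
  - by move=> x -> /=; rewrite in_itv/= andbT.
  - by move=> x _; rewrite indicE.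
  - by move=> x ->; rewrite indicE mem_set.
apply: filterS (ae_not_null_event _ PD) => [w nD s [/= s0 Js]|]; last first.
  by apply: measurableU => //; exact: measurableC.
apply: nD; move: s0; rewrite le_eqVlt => /orP[/eqP s0|s0].
  right; have := Js 0%N; rewrite -s0 sub0r [A w (- _)]A_neg ?subr0 ?oppr_lt0 ?invr_gt0//.
left => Doo; have : (debut (jumps e) 0 w <= s%:E)%E.
  by apply: ereal_inf_lbound; exists s => //; split => //; split => //=; exact: ltW.
by rewrite Doo leNgt ltry.
Unshelve. all: by end_near. Qed.

Lemma ae_continuous_A : {ae P, forall w, forall s e : R, 0 <= s -> 0 < e ->
  exists n : nat, A w s - A w (s - n.+1%:R^-1) < e}.
Proof.
have H : {ae P, forall w, forall m : nat, forall s, ~ jumps (m.+1%:R^-1) (s, w)}.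
  by apply: ae_foralln => m; apply: ae_no_jump; rewrite invr_gt0.
apply: filterS H => w H s e s0 e0.
near \oo => m; have nJ := H m s; apply: contrapT => /forallNP nex; apply: nJ.
split => //= n; have := nex n; move/negP; rewrite -leNgt; apply: le_trans.
by apply/ltW; near: m; exact: near_infty_natSinv_lt (PosNum e0).
Unshelve. all: by end_near. Qed.

(** The dual projection is tested on the set of times [s] with [A_s > x]. It
    contains [L] if and only if [A_oo > x], since [A_L = A_oo]; by continuity of
    [A] its mass is [(A_oo - x)^+]. *)
Lemma tail_A_oo x : 0 <= x ->
  P [set w | x < A_oo w] = (\int[P]_w (Num.max (A_oo w - x) 0)%:E)%E.
Proof.
move=> x0.
have mAoo := measurable_A_oo.
pose B : set (R * T) := timeline_prod (T := T) `&`
  [set z | `]x, +oo[%classic ((fun t w => A w (t - 0)) z.1 z.2)].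
have oB : optional_sigma_algebra F B.
  apply: (@optional_preimage _ _ _ _ (fun t w => A w (t - 0)) `]x, +oo[%classic).
  - exact: adapted_shift.
  - exact: cadlag_shift.
  - exact: measurable_itv.
have bB : exists C : R, forall t w, 0 <= t -> `|\1_B (t, w)| <= C.
  by exists 1 => t w _; rewrite indicE; case: (_ \in B); rewrite ?normr1 ?normr0.
have := proj_integral (optional_indic oB) bB.
rewrite (@ae_eq_integral_complete _ _ _ _ cP _ (fun w => (Num.max (A_oo w - x) 0)%:E)); last 2 first.
- by apply/measurable_EFinP; apply: measurable_maxr => //; exact: measurable_funB.
- apply: filterS2 (ae_tot_fin) ae_continuous_A => w fin cont.
  have mB : measurable ([set s | 0 <= s /\ x < A w s] : set R).
    rewrite [X in measurable X](_ : _ = `[0, +oo[%classic `&` A w @^-1` `]x, +oo[%classic); last first.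
      by apply/seteqP; split => s /=; rewrite !in_itv/= !andbT.
    apply: measurableI; first exact: measurable_itv.
    rewrite -[X in measurable X]setTI.
    have : measurable_fun [set: R] (A w : R -> R).
      by apply: nondecreasing_measurable => //; exact: cumulative_is_nondecreasing.
    by apply => //; exact: measurable_itv.
  have := stieltjes_above (@A_neg w) fin x0 cont.
  rewrite /path_total -(A_oo_total fin) => <-.
  rewrite (_ : [set s | _] = [set s | 0 <= s /\ x < A w s] `&` `[0, +oo[%classic).
    rewrite -(integral_indic (mu w) (measurable_itv _) mB).
    apply: eq_integral => s; rewrite inE/= in_itv/= andbT => s0; congr (_%:E).
    rewrite !indicE; congr ((nat_of_bool _)%:R); apply/idP/idP; rewrite !inE /B/= in_itv/= andbT subr0.
      by case.
    by move=> [_ xs]; split.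
  by apply/seteqP; split => s /=; [move=> [? ?]; split => //; rewrite in_itv/= andbT|case].
move=> ->.
rewrite -[X in P X]setIT -(integral_indic P measurableT).
  apply/esym; apply: (ae_eq_integral_complete cP).
    by apply/measurable_EFinP/measurable_indic; exact: measurable_above.
  apply: filterS2 (ae_A_L) (ae_L_fin) => w AL [r [r0 Lr]].
  rewrite /value_at Lr; congr (_%:E); rewrite !indicE; congr ((nat_of_bool _)%:R).
  have Ar := AL r Lr.
  apply/idP/idP; rewrite !inE /B/= in_itv/= andbT subr0 Ar; first by case.
  by move=> xA; split => //; exact: ltW.
exact: measurable_above.
Qed.

Lemma moment_A_oo n : (\int[P]_w (A_oo w ^+ n)%:E = n`!%:R%:E)%E.
Proof.
have [I E] := intble_A_oo.
apply: moment.
- exact: (measurable_A_oo).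
- exact: (A_oo_ge0).
- exact: (tail_A_oo).
- by rewrite -EFin_Rintegral// E.
Qed.

Lemma A_oo_square_intble : square_intble P (A_oo).
Proof.
have mA := measurable_A_oo.
split => //; apply/integrableP; split; first by apply/measurable_EFinP; exact: measurable_funX.
under eq_integral do rewrite /= ger0_norm ?sqr_ge0//.
by rewrite moment_A_oo ltry.
Qed.

Lemma A_square_intble t : 0 <= t -> square_intble P (fun w => A w t).
Proof.
move=> t0; apply: (square_intble_ae_le cP) A_oo_square_intble.
  exact: (measurable_A).
apply: filterS (ae_A_le) => w Aw.
by rewrite ger0_norm//; apply: (path_ge0 (f := A w)); exact: A_neg.
Qed.

Variable (M : R -> T -> R).
Hypotheses (martM : martingale P F M) (M_L2 : L2_bounded P M).

Let sM t : 0 <= t -> square_intble P (M t).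
Proof. exact: (martingale_square_intble uF martM M_L2). Qed.

Let cM : cadlag M. Proof. by case: martM. Qed.

(** [fine] sends the infinite values of [L], of probability zero, to [0]. *)
Definition at_L (w : T) : R := M (fine (L w)) w.

Let fL0 w : 0 <= fine (L w). Proof. by apply: fine_ge0; exact: (L_ge0). Qed.

Lemma measurable_at_L : measurable_fun [set: T] at_L.
Proof.
apply: (measurable_fun_cvg (h := fun n w => M (dyadic_up n (fine (L w))) w)) => [n|w _]; last first.
  by apply: cadlag_cvg_from_right => //; [move=> n; exact: dyadic_up_gt|exact: cvg_dyadic_up].
move=> _ B mB; rewrite setTI.
have mfL : measurable_fun [set: T] (fun w => fine (L w)) by exact: measurableT_comp.
rewrite [X in measurable X](_ : _ = \bigcup_k
   ((fun w => fine (L w)) @^-1` `[k%:R / 2 ^+ n, k.+1%:R / 2 ^+ n[%classic `&` M (k.+1%:R / 2 ^+ n) @^-1` B)).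
  apply: bigcupT_measurable => k; apply: measurableI.
    by rewrite -[X in measurable X]setTI; apply: mfL => //; exact: measurable_itv.
  rewrite -[X in measurable X]setTI; have [mMk _] := @sM (k.+1%:R / 2 ^+ n) (divr_ge0 (ler0n _ _) (exprn_ge0 _ (ler0n _ 2))).
  exact: mMk.
apply/seteqP; split => w /=.
  have [k Hk] := dyadic_cell n (fL0 w).
  by rewrite (dyadic_upE (fL0 w) Hk) => BM; exists k => //; split => //=; rewrite in_itv.
by move=> [k _ [/=]]; rewrite in_itv/= => Hk; rewrite (dyadic_upE (fL0 w) Hk).
Qed.

Lemma ae_at_L Y : {ae P, forall w, value_at M Y L w = at_L w}.
Proof.
apply: filterS (ae_L_fin) => w [r [_ Lr]].
by rewrite /value_at /at_L Lr.
Qed.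

Let grid n i : R := i%:R / 2 ^+ n.

Let grid_ge0 n i : 0 <= grid n i. Proof. by rewrite divr_ge0// exprn_ge0. Qed.

Lemma measurable_stieltjes_sum (X : R -> T -> R) n :
  (forall t, 0 <= t -> measurable_fun [set: T] (X t)) ->
  measurable_fun [set: T] (fun w => stieltjes_sum (A w) (X^~ w) n).
Proof.
move=> mX; have mA t := measurable_A t.
rewrite /stieltjes_sum; apply: measurable_funD.
  by apply: measurable_funM; [exact: mX|exact: mA].
apply: measurable_sum => i; apply: measurable_funM; first exact: mX (grid_ge0 _ _).
by apply: measurable_funB; exact: mA.
Qed.

(** Summation by parts: the increment of [M] over a cell is orthogonal to the
    value of [A] at its left end. *)
Lemma Rintegral_stieltjes_sum n :
  \int[P]_w stieltjes_sum (A w) (M^~ w) n =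
  \int[P]_w (M (2 ^+ n) w * A w (2 ^+ n)).
Proof.
have sA n' i := A_square_intble (grid_ge0 n' i).
have IMA i j : intble P (fun w => M (grid n i) w * A w (grid n j)).
  by apply: square_intble_mul; [exact: sM|exact: sA].
have I1 i : intble P (fun w => M (grid n i.+1) w * (A w (grid n i.+1) - A w (grid n i))).
  by under eq_fun do rewrite mulrBr; exact: intbleB.
have E0 : grid n 0 = 0 by rewrite /grid mul0r.
have I0 : intble P (fun w => M 0 w * A w 0) by have := IMA 0%N 0%N; rewrite E0.
have sum_ k : \int[P]_w (M 0 w * A w 0 + \sum_(i <- iota 0 k)
    M (grid n i.+1) w * (A w (grid n i.+1) - A w (grid n i))) =
    \int[P]_w (M (grid n k) w * A w (grid n k)).
  elim: k => [|k IH].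
    by apply: eq_Rintegral => w _; rewrite big_nil addr0 E0.
  under eq_Rintegral do rewrite big_iota_recr addrA.
  rewrite RintegralD//; last 2 first.
  - exact: (intbleD I0 (intble_sum _ I1)).
  - exact: I1.
  rewrite IH.
  under [X in _ + X]eq_Rintegral do rewrite mulrBr.
  rewrite RintegralB//; last 2 first.
  - exact: IMA.
  - exact: IMA.
  rewrite (martingale_orthogonal uF martM M_L2 (grid_ge0 n k) (t := grid n k.+1) (Y := fun w => A w (grid n k)))//.
  - by rewrite addrC subrK.
  - by rewrite ler_pM2r ?invr_gt0 ?exprn_gt0// ler_nat.
  - exact: A_adapted.
have -> : 2 ^+ n = grid n (4 ^ n).
  rewrite /grid natrX (_ : 4%:R = 2 ^+ 2); last by rewrite -natrX.
  by rewrite -exprM mulnC exprM expr2 mulfK// expf_neq0.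
rewrite -sum_; apply: eq_Rintegral => w _; by rewrite /stieltjes_sum /index_iota subn0.
Qed.

Lemma martingale_dominated : exists S : T -> R, [/\ square_intble P S, forall w, 0 <= S w,
  {ae P, forall w, forall t, 0 <= t -> `|M t w| <= S w},
  {ae P, forall w, M t w @[t --> +oo%R] --> terminal_value M w} &
  {ae P, forall w, `|terminal_value M w| <= S w}].
Proof.
have [S [sS S0 MS]] := martingale_maximal uF martM M_L2.
have cv := martingale_cvg uF martM M_L2.
exists S; split => //.
apply: filterS2 MS cv => w MS cv; apply: (cvgr_to_le (cvg_norm cv)).
by near=> t; apply: MS; near: t; exact: nbhs_pinfty_ge.
Unshelve. all: by end_near. Qed.

Lemma terminal_square_intble : square_intble P (terminal_value M).
Proof.
have [S [sS S0 MS cv Sinf]] := martingale_dominated.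
apply: (square_intble_ae_le cP) sS => //.
apply: (@ae_measurable_cvg _ _ _ _ cP (fun n => M n%:R)).
  by move=> n; case: (@sM n%:R).
apply: filterS cv => w cv; apply: (cvg_comp _ _ _ cv); exact: cvgr_idn.
Qed.
Let truncated_path K w : (tot w < +oo)%E -> 0 <= K ->
  let I := (\int[mu w]_(s in `[0%R, +oo[) (truncate K (M s w))%:E)%E in
  [/\ I \is a fin_num,
      stieltjes_sum (A w) (fun s => truncate K (M s w)) n @[n --> \oo] --> fine I &
      forall c, (forall t, 0 <= t -> `|M t w| <= c) -> `|fine I| <= c * A_oo w].
Proof.
move=> fin K0 I.
have rX t : 0 <= t -> truncate K (M s w) @[s --> t^'+] --> truncate K (M t w).
  by move=> t0; apply: continuous_cvg; [exact: continuous_truncate|have [rM _] := cM w; exact: rM].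
have XK t : 0 <= t -> `|truncate K (M t w)| <= K by move=> _; exact: truncate_le.
have [fI cv _] := cvg_stieltjes_integral (@A_neg w) fin rX XK.
split => // c Mc.
have XC t : 0 <= t -> `|truncate K (M t w)| <= c.
  by move=> t0; rewrite (le_trans (truncate_le_norm _ _))// Mc.
by have [_ _] := cvg_stieltjes_integral (@A_neg w) fin rX XC; rewrite (A_oo_total fin).
Qed.

Let measurable_truncated_path K : 0 <= K -> measurable_fun [set: T]
  (fun w => fine (\int[mu w]_(s in `[0%R, +oo[) (truncate K (M s w))%:E)%E).
Proof.
move=> K0; apply: (@ae_measurable_cvg _ _ _ _ cP
    (fun n w => stieltjes_sum (A w) (fun s => truncate K (M s w)) n)).
  move=> n; apply: (measurable_stieltjes_sum (X := fun s w => truncate K (M s w))) => t t0.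
  by apply: measurableT_comp; [exact: measurable_truncate|case: (sM t0)].
by apply: filterS ae_tot_fin => w fin; have [] := truncated_path fin K0.
Qed.

(** The dual projection is tested on the truncations of [M], which are bounded
    optional processes. *)
Lemma Rintegral_truncate_at_L K : 0 <= K ->
  \int[P]_w truncate K (at_L w) =
  \int[P]_w fine (\int[mu w]_(s in `[0%R, +oo[) (truncate K (M s w))%:E)%E.
Proof.
move=> K0; rewrite /Rintegral; congr fine.
have oH : optional_process F (fun s w => truncate K (M s w)).
  apply: optional_process_cadlag.
    move=> t t0; apply/(measurable_wrtP (sF t0)).
    apply: measurableT_comp; first exact: measurable_truncate.
    by apply/(measurable_wrtP (sF t0)); case: martM => + _ _ _; apply.
  move=> w; have [rM lM] := cM w; split => t t0.
    by apply: continuous_cvg; [exact: continuous_truncate|exact: rM].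
  apply/cvg_ex; exists (truncate K (lim (M s w @[s --> t^'-]))).
  by apply: continuous_cvg; [exact: continuous_truncate|exact: lM].
have bH : exists C : R, forall t w, 0 <= t -> `|truncate K (M t w)| <= C.
  by exists K => t w _; exact: truncate_le.
transitivity (\int[P]_w (value_at (fun s w => truncate K (M s w)) (cst 0%R) L w)%:E)%E.
  apply/esym/(ae_eq_integral_complete cP).
    by apply/measurable_EFinP; apply: measurableT_comp measurable_at_L; exact: measurable_truncate.
  apply: filterS (ae_L_fin) => w [r [_ Lr]].
  by rewrite /value_at /at_L Lr.
rewrite -(proj_integral oH bH).
apply: (ae_eq_integral_complete cP); first exact/measurable_EFinP/measurable_truncated_path.
by apply: filterS ae_tot_fin => w fin; have [fI _ _] := truncated_path fin K0; rewrite fineK.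
Qed.

(** Both sides are the mean of the integral of [M] against [dA]: the left one by
    the dual projection, removing the truncation, and the right one by Riemann
    sums. All limits are dominated by [S A_oo], where [S] bounds [|M|]. *)
Lemma Rintegral_at_L :
  intble P at_L /\ \int[P]_w at_L w = \int[P]_w (terminal_value M w * A_oo w).
Proof.
have [S [sS S0 MS cvM Sinf]] := martingale_dominated.
pose Phi w := fine (\int[mu w]_(s in `[0%R, +oo[) (M s w)%:E)%E.
pose PhiK (k : nat) w := fine (\int[mu w]_(s in `[0%R, +oo[) (truncate k%:R (M s w))%:E)%E.
have IS := square_intble_intble sS.
have ISA : intble P (fun w => S w * A_oo w) by exact: square_intble_mul A_oo_square_intble.
have atS : {ae P, forall w, `|at_L w| <= S w}.
  by apply: filterS MS => w; apply; exact: fL0.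
have IN : intble P at_L by exact: (intble_ae_le cP measurable_at_L atS).
split => //.
have tr_eventually w x : `|x| <= S w -> truncate n%:R x @[n --> \oo] --> x.
  move=> xS; apply: (@cvg_trans _ (cst x @ \oo)); last exact: cvg_cst.
  apply: near_eq_cvg; near=> n; rewrite truncate_id// (le_trans xS)//.
  by near: n; exact: nbhs_infty_ger.
have [|||_ cvN] := @complete_dominated_cvg _ _ _ _ cP (fun k w => truncate k%:R (at_L w)) at_L S _ _ IS.
- by move=> n; apply: measurableT_comp measurable_at_L; exact: measurable_truncate.
- by apply: filterS atS => w; exact: tr_eventually.
- apply: filterS atS => w aS n; apply: le_trans aS; exact: truncate_le_norm.
have [|||_ cvK] := @complete_dominated_cvg _ _ _ _ cP PhiK Phi (fun w => S w * A_oo w) _ _ ISA.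
- by move=> k; exact: measurable_truncated_path.
- apply: filterS MS => w MSw.
  apply: (@cvg_trans _ (cst (Phi w) @ \oo)); last exact: cvg_cst.
  apply: near_eq_cvg; near=> k; congr fine; apply: eq_integral => s; rewrite inE/= in_itv/= andbT => s0.
  rewrite truncate_id// (le_trans (MSw s s0))//.
  by near: k; exact: nbhs_infty_ger.
- by apply: filterS2 ae_tot_fin MS => w fin MSw k; have [_ _] := truncated_path fin (ler0n R k); apply.
have E1 : \int[P]_w at_L w = \int[P]_w Phi w.
  suff cvK' : \int[P]_w truncate k%:R (at_L w) @[k --> \oo] --> \int[P]_w Phi w.
    exact: cvg_unique cvN cvK'.
  by under eq_fun do rewrite Rintegral_truncate_at_L//.
have path w : (tot w < +oo)%E -> (forall t, 0 <= t -> `|M t w| <= S w) ->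
    stieltjes_sum (A w) (M^~ w) n @[n --> \oo] --> Phi w.
  move=> fin MSw.
  have [t t0|t t0|_ cv _] := @cvg_stieltjes_integral _ (A w) (@A_neg w) fin (M^~ w) (S w).
  - by have [rM _] := cM w; exact: rM.
  - exact: MSw.
  - exact: cv.
have [|||_ cvS] := @complete_dominated_cvg _ _ _ _ cP
    (fun n w => stieltjes_sum (A w) (M^~ w) n) Phi (fun w => S w * A_oo w) _ _ ISA.
- by move=> n; apply: measurable_stieltjes_sum => t t0; case: (sM t0).
- by apply: filterS2 ae_tot_fin MS => w; exact: path.
- apply: filterS2 ae_tot_fin MS => w fin MSw n; rewrite (A_oo_total fin).
  by apply: (stieltjes_sum_le (@A_neg w) fin) => t; exact: MSw.
have two0 n : 0 <= 2 ^+ n :> R by exact: exprn_ge0.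
have cv2 : (2 ^+ n : R) @[n --> \oo] --> +oo%R.
  apply/cvgryPge => K; near=> n; apply: (@le_trans _ _ n%:R).
    by near: n; exact: nbhs_infty_ger.
  by rewrite -natrX ler_nat ltnW// ltn_expl.
have [|||_ cvT] := @complete_dominated_cvg _ _ _ _ cP
    (fun n w => M (2 ^+ n) w * A w (2 ^+ n)) (fun w => terminal_value M w * A_oo w)
    (fun w => S w * A_oo w) _ _ ISA.
- by move=> n; apply: measurable_funM; [case: (sM (two0 n))|exact: (measurable_A)].
- apply: filterS2 cvM (ae_A_cvg) => w cMw cAw.
  by apply: cvgM; [exact: cvg_comp cv2 cMw|exact: cvg_comp cv2 cAw].
- apply: filterS2 MS (ae_A_le) => w MSw Aw n.
  rewrite normrM ler_pM// ?MSw// ger0_norm//.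
  by apply: (path_ge0 (f := A w)); exact: A_neg.
rewrite E1; suff cvT' : \int[P]_w stieltjes_sum (A w) (M^~ w) n @[n --> \oo] -->
    \int[P]_w (terminal_value M w * A_oo w) by exact: cvg_unique cvS cvT'.
by under eq_fun do rewrite Rintegral_stieltjes_sum.
Unshelve. all: by end_near. Qed.

(** The supremum of the uncountable family need not be a measurable function
    a priori; it is compared with the bound [S], set to [+oo] on a null set. *)
Lemma martingale_H1 : H1_martingale P F M.
Proof.
split => //; have [S [sS S0 [N [mN PN MS]] _ _]] := martingale_dominated.
have IS := square_intble_intble sS.
apply: (@le_lt_trans _ _ (\int[P]_w (if w \in N then +oo else (S w)%:E))%E).
  apply: ge0_le_integral_sup => w _.
    apply: (@le_trans _ _ `|M 0 w|%:E); first by rewrite lee_fin.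
    by apply: ereal_sup_ubound; exists 0 => //=.
  case: ifPn => wN; first by rewrite leey.
  apply: ge_ereal_sup => _ [t t0 <-]; rewrite lee_fin.
  have : ~ (~` [set w | forall t, 0 <= t -> `|M t w| <= S w]) w.
    by move=> /MS Nw; rewrite mem_set in wN.
  by move=> /contrapT; apply.
rewrite (@ae_eq_integral_complete _ _ _ _ cP _ (EFin \o S)).
- by rewrite -EFin_Rintegral// ltry.
- exact: measurable_int IS.
- exists N; split => // w /= H; apply: contrapT => Nw; apply: H.
  by rewrite memNset.
Qed.

(** Since [E M_L = E (M_oo A_oo)], and the Laguerre polynomial of degree 1 is
    [1 - x]. *)
Lemma S1_martingaleE : S1_martingale P F L M <->
  \int[P]_w (terminal_value M w * laguerre 1 (A_oo w)) = 0.
Proof.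
have [IN E] := Rintegral_at_L.
have sT := terminal_square_intble; have IT := square_intble_intble sT.
have ITA := square_intble_mul sT A_oo_square_intble.
have EV : ('E_P[value_at M (terminal_value M) L] = (\int[P]_w at_L w)%:E)%E.
  rewrite expectationE EFin_Rintegral//; apply: (ae_eq_integral_complete cP).
    exact: measurable_int IN.
  by apply: filterS (ae_at_L (terminal_value M)) => w ->.
have ET : ('E_P[terminal_value M] = (\int[P]_w terminal_value M w)%:E)%E.
  by rewrite expectationE EFin_Rintegral.
have -> : \int[P]_w (terminal_value M w * laguerre 1 (A_oo w)) =
    \int[P]_w terminal_value M w - \int[P]_w at_L w.
  rewrite E -RintegralB//; apply: eq_Rintegral => w _.
  by rewrite laguerre1E mulrBr mulr1.
rewrite /S1_martingale EV ET; split; first by move=> [_ [->]]; rewrite subrr.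
by move=> /eqP; rewrite subr_eq0 => /eqP ->; split => //; exact: martingale_H1.
Qed.
End dual_projection.

(** * The two implications *)

Section laguerre_expansion.
Context (R : realType) (d : measure_display) (T : measurableType d).
Variables (P : probability T R) (Y : T -> R).
Hypotheses (mY : measurable_fun [set: T] Y) (Y0 : forall w, 0 <= Y w)
  (momY : forall n, (\int[P]_w (Y w ^+ n)%:E = n`!%:R%:E)%E).

Let sY := g_sigma_algebra_preimage Y.

Lemma Lnorm2E (f : T -> R) : square_intble P f ->
  ('N[P]_2%:E[EFin \o f])%E = (Num.sqrt (\int[P]_w (f w ^+ 2)))%:E.
Proof.
move=> [mf If]; rewrite unlock /=.
have -> : (\int[P]_x `|(f x)%:E| `^ 2)%E = (\int[P]_w (f w ^+ 2)%:E)%E.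
  by apply: eq_integral => w _ /=; rewrite powR_mulrn// real_normK ?num_real.
by rewrite -EFin_Rintegral// poweR_EFin powR12_sqrt// Rintegral_ge0// => w _; exact: sqr_ge0.
Qed.

Lemma cvg_Lnorm2 (f : nat -> T -> R) : (forall n, square_intble P (f n)) ->
  (('N[P]_2%:E[EFin \o f n])%E @[n --> \oo] --> 0%E) <->
  (\int[P]_w (f n w ^+ 2) @[n --> \oo] --> 0).
Proof.
move=> sf; have i0 n : 0 <= \int[P]_w (f n w ^+ 2).
  by apply: Rintegral_ge0 => w _; exact: sqr_ge0.
under eq_fun do rewrite Lnorm2E//.
split => cv.
  have cs : Num.sqrt (\int[P]_w (f n w ^+ 2)) @[n --> \oo] --> 0.
    exact: (@fine_cvg _ _ _ _ (fun n => (Num.sqrt (\int[P]_w (f n w ^+ 2)))%:E) 0).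
  under eq_fun => n do rewrite -(sqr_sqrtr (i0 n)) expr2.
  rewrite -(mulr0 (0 : R)); exact: (cvgM cs cs).
apply: cvg_EFin; first exact: nearW.
rewrite -sqrtr0; apply: (cvg_comp _ _ cv); exact: sqrt_continuous.
Qed.

Lemma preimage_measurable_wrt (phi : R -> R) : measurable_fun [set: R] phi ->
  measurable_wrt sY (phi \o Y).
Proof.
move=> mphi B mB; exists (phi @^-1` B); last by rewrite setTI.
by rewrite -[X in measurable X]setTI; exact: mphi.
Qed.

Lemma measurable_laguerre n : measurable_fun [set: R] (laguerre n : R -> R).
Proof.
rewrite (_ : laguerre n = horner (laguerre_poly R n)); last by apply/funext => x; exact: laguerreE.
by apply: continuous_measurable_fun; exact: continuous_horner.
Qed.

Let se n : square_intble P (fun w => laguerre n (Y w)).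
Proof. exact: laguerre_square_intble. Qed.

Let oe m n : \int[P]_w (laguerre m (Y w) * laguerre n (Y w)) = (m == n)%:R.
Proof. exact: laguerre_orthonormal. Qed.

Lemma L2_square_intble (f : T -> R) : square_intble P f -> measurable_wrt sY f -> L2 P sY f.
Proof. by move=> sf mf; split => //; apply/square_intble_Lfun. Qed.

Lemma orthogonal_complementP (X : T -> R) :
  orthogonal_complement P (L2 P sY) X <->
  square_intble P X /\ forall Z, square_intble P Z -> measurable_wrt sY Z ->
    \int[P]_w (X w * Z w) = 0.
Proof.
split.
  move=> [[/square_intble_Lfun sX _] oX]; split => // Z sZ mZ.
  have := oX Z (L2_square_intble sZ mZ); rewrite expectationE -EFin_Rintegral.
    by move=> [].
  exact: square_intble_mul.
move=> [sX oX]; split.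
  split; first exact/square_intble_Lfun.
  by case: sX => mX _ B mB; rewrite -[X in measurable X]setTI; exact: mX.
move=> Z [/square_intble_Lfun sZ mZ]; rewrite expectationE -EFin_Rintegral.
  by rewrite oX.
exact: square_intble_mul.
Qed.

Definition laguerre_sum (a : nat -> R) N x : R :=
  a 0%N + \sum_(2 <= n < N) a n * laguerre n x.

Lemma laguerre_sumE a N x :
  laguerre_sum a N x = expansion (@laguerre R) a (0%N :: index_iota 2 N) x.
Proof. by rewrite /expansion big_cons laguerre0E mulr1. Qed.

Lemma laguerre_sum_square_intble a N : square_intble P (fun w => laguerre_sum a N (Y w)).
Proof. by under eq_fun do rewrite laguerre_sumE; exact: expansion_square_intble. Qed.

(** [phi] is the Laguerre series of [Z], and completeness of the Laguerre system
    makes the remainder orthogonal to all functions of [Y]. *)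
Lemma laguerre_decomposition (Z : T -> R) : square_intble P Z ->
  \int[P]_w (Z w * laguerre 1 (Y w)) = 0 ->
  exists (X : T -> R) (phi : R -> R),
    [/\ orthogonal_complement P (L2 P sY) X,
        measurable_fun [set: R] phi,
        L2 P sY (phi \o Y),
        {ae P, forall w, Z w = X w + phi (Y w)} &
        exists alpha : nat -> R,
          (\sum_(2 <= n <oo) (alpha n ^+ 2)%:E < +oo)%E /\
          ('N[P]_2%:E[(fun w => (phi (Y w) - (alpha 0%N +
                \sum_(2 <= n < N) alpha n * laguerre n (Y w)))%:E)])%E
            @[N --> \oo] --> 0%E].
Proof.
move=> sZ Z1; pose a n := \int[P]_w (Z w * laguerre n (Y w)).
have aC N : \sum_(n <- iota 0 N) a n ^+ 2 <= \int[P]_w (Z w ^+ 2).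
  by apply: (bessel se oe) => //; exact: iota_uniq.
have [phi [mphi sphi cv]] := riesz_fischer mY measurable_laguerre se oe aC.
have wphi := preimage_measurable_wrt mphi.
exists (fun w => Z w - phi (Y w)), phi; split => //.
- have sX := square_intbleB sZ sphi.
  apply/orthogonal_complementP; split => // V sV mV.
  apply: (moments_vanish_orthogonal mY Y0 momY) mV sV.
  apply: (laguerre_orthogonal_moments mY Y0 momY) => // m.
  under eq_Rintegral do rewrite mulrBl.
  rewrite RintegralB//; [|exact: square_intble_mul..].
  rewrite -/(a m); apply/eqP; rewrite subr_eq0; apply/eqP.
  pose Q N w := phi (Y w) - expansion (@laguerre R) a (iota 0 N) (Y w).
  have sQ N : square_intble P (Q N).
    by apply: square_intbleB => //; exact: expansion_square_intble.
  have E N : (m < N)%N -> \int[P]_w (Q N w * laguerre m (Y w)) =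
      \int[P]_w (phi (Y w) * laguerre m (Y w)) - a m.
    move=> mN; under eq_Rintegral do rewrite mulrBl.
    rewrite RintegralB//; last 2 first.
    - exact: square_intble_mul.
    - by apply: square_intble_mul => //; exact: expansion_square_intble.
    congr (_ - _); under eq_Rintegral do rewrite mulrC.
    by rewrite (Rintegral_expansion_coef se oe)// ?iota_uniq// mem_iota mN.
  have cvQ := cvg_Rintegral_mul0 sQ (se m) cv.
  apply/esym/subr0_eq/(cvg_unique _ _ cvQ) => //; apply: cvg_near_cst.
  by near=> N; apply: E; near: N; exact: nbhs_infty_gt.
- exact: L2_square_intble.
- by apply: nearW => w; rewrite subrK.
- exists a; split.
    apply: (@le_lt_trans _ _ (\int[P]_w (Z w ^+ 2))%:E); last exact: ltry.
    apply: lime_le; first by apply: is_cvg_nneseries => n _ _; rewrite lee_fin sqr_ge0.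
    apply: nearW => N; rewrite sumEFin lee_fin.
    by apply: (bessel se oe) => //; exact: iota_uniq.
  apply/(@cvg_Lnorm2 (fun N w => phi (Y w) - laguerre_sum a N (Y w))).
    by move=> N; apply: square_intbleB => //; exact: laguerre_sum_square_intble.
  apply: cvg_trans cv; apply: near_eq_cvg; near=> N; apply: eq_Rintegral => w _.
  congr ((_ - _) ^+ 2); rewrite /laguerre_sum /expansion.
  have N2 : (2 <= N)%N by near: N; exact: nbhs_infty_ge.
  rewrite -[N](subnKC N2) iotaD big_cat/= !big_cons big_nil laguerre0E.
  by rewrite [a 1%N]Z1 mul0r mulr1 !addr0 add0n /index_iota addnC addnK.
Unshelve. all: by end_near. Qed.

(** The partial sums have no term of degree 1, so that their limit [phi (Y)] is
    orthogonal to it, and [X] is by assumption. *)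
Lemma laguerre1_orthogonal (Z X : T -> R) (phi : R -> R) (alpha : nat -> R) :
  square_intble P Z -> orthogonal_complement P (L2 P sY) X -> L2 P sY (phi \o Y) ->
  {ae P, forall w, Z w = X w + phi (Y w)} ->
  ('N[P]_2%:E[(fun w => (phi (Y w) - (alpha 0%N +
      \sum_(2 <= n < N) alpha n * laguerre n (Y w)))%:E)])%E
    @[N --> \oo] --> 0%E ->
  \int[P]_w (Z w * laguerre 1 (Y w)) = 0.
Proof.
move=> sZ /orthogonal_complementP[sX oX] [/square_intble_Lfun sphi _] ZX.
pose Q N w := phi (Y w) - laguerre_sum alpha N (Y w).
have sQ N : square_intble P (Q N).
  by apply: square_intbleB => //; exact: laguerre_sum_square_intble.
move=> /(@cvg_Lnorm2 Q sQ) cv.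
transitivity (\int[P]_w (X w * laguerre 1 (Y w) + phi (Y w) * laguerre 1 (Y w))).
  apply: Rintegral_ae_eq.
  - exact: square_intble_mul.
  - by apply: intbleD; exact: square_intble_mul.
  - by apply: filterS ZX => w ->; rewrite mulrDl.
rewrite RintegralD//; [|exact: square_intble_mul..].
rewrite oX// ?add0r; last exact: (preimage_measurable_wrt (measurable_laguerre 1)).
have E N : \int[P]_w (phi (Y w) * laguerre 1 (Y w)) = \int[P]_w (Q N w * laguerre 1 (Y w)).
  under [RHS]eq_Rintegral do rewrite mulrBl.
  rewrite RintegralB//; last 2 first.
  - exact: square_intble_mul.
  - by apply: square_intble_mul => //; exact: laguerre_sum_square_intble.
  rewrite (_ : \int[P]_w (laguerre_sum _ _ _ * _) = 0) ?subr0//.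
  under eq_Rintegral do rewrite mulrC laguerre_sumE.
  have u : uniq (0%N :: index_iota 2 N) by rewrite /= mem_index_iota iota_uniq.
  by rewrite (Rintegral_expansion_coef se oe _ _ u) in_cons mem_index_iota.
have cvQ := cvg_Rintegral_mul0 sQ (se 1) cv.
apply: (cvg_unique _ _ cvQ) => //; apply: cvg_near_cst.
by apply: nearW => N; exact/esym/E.
Qed.

End laguerre_expansion.

Theorem theorem3p6 (R : realType) (d : measure_display) (T : measurableType d)
    (P : probability T R) (F : R -> set (set T)) (usualF : usual_filtration P F)
    (L : T -> \bar R) (honestL : honest_time F L)
    (L_neq0 : P [set w | L w = 0%E] = 0%E)
    (L_finite : P [set w | L w = +oo%E] = 0%E)
    (condA : avoids_stopping_times P F L)
    (A : T -> cumulative R R) (A_proj : dual_optional_projection P F L A)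
    (M : R -> T -> R) (M_mart : martingale P F M) (M_L2 : L2_bounded P M) :
  let Minf := terminal_value M in
  let Ainf := terminal_value (fun t w => A w t) in
  let sigmaAinf := g_sigma_algebra_preimage Ainf in
  S1_martingale P F L M <->
  exists (X : T -> R) (phi : R -> R),
    [/\ orthogonal_complement P (L2 P sigmaAinf) X,
        measurable_fun [set: R] phi,
        L2 P sigmaAinf (phi \o Ainf),
        {ae P, forall w, Minf w = X w + phi (Ainf w)} &
        exists alpha : nat -> R,
          (\sum_(2 <= n <oo) (alpha n ^+ 2)%:E < +oo)%E /\
          ('N[P]_2%:E[(fun w => (phi (Ainf w) - (alpha 0%N +
                \sum_(2 <= n < N) alpha n * laguerre n (Ainf w)))%:E)])%E
            @[N --> \oo] --> 0%E].
Proof.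
have mA := measurable_A_oo usualF honestL L_neq0 L_finite A_proj.
have A0 := A_oo_ge0 A_proj.
have momA := moment_A_oo usualF honestL L_neq0 L_finite condA A_proj.
have sM := terminal_square_intble usualF M_mart M_L2.
have S1E := S1_martingaleE usualF honestL L_neq0 L_finite condA A_proj M_mart M_L2.
move=> Minf Ainf sigmaAinf; split.
  by move=> /S1E; exact: (laguerre_decomposition mA A0 momA sM).
move=> [X [phi [oX _ Lphi ZX [alpha [_ cv]]]]]; apply/S1E.
exact: (laguerre1_orthogonal mA A0 momA sM oX Lphi ZX cv).
Qed.
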